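(* Let Standing Assumption 1 hold and let $\sigma\in C^1(\mathbb R)$. Fix $L\ge2$, an architecture $\mathcal R$, $\eta_1,\eta_2>0$ and $\alpha_{\mathcal R}>0$. If problem $(\mathcal P^\sigma_{\mathcal R})$ has at least one admissible pair, i.e. there is $\theta\in\mathcal R_{ad}$ for which an ensemble solution for $\mathcal F^\sigma_\theta$ exists, then $(\mathcal P^\sigma_{\mathcal R})$ admits a global minimizer $(\theta^*,\mathbf y_{\theta^*})\in\mathcal R_{ad}\times L^\infty_\mu(Y_0;W_\infty)$.
   Context: $I=[0,\infty)$, $W_\infty=\{y\in L^2(I;\mathbb R^n):\dot y\in L^2(I;\mathbb R^n)\}$ with norm $\|y\|_{W_\infty}=(\|y\|_{L^2}^2+\|\dot y\|_{L^2}^2)^{1/2}$; $C_\imath>0$ is a constant with $\sup_{t\ge0}|y(t)|\le C_\imath\|y\|_{W_\infty}$. Given $f:\mathbb R^n\to\mathbb R^n$, $B\in\mathbb R^{n\times m}$, positive semidefinite $Q$, $\beta>0$, problem $(P^{y_0}_\beta)$ is: minimize $J(y,u)=\frac12\int_0^\infty(|Qy|^2+\beta|u|^2)dt$ over $(y,u)\in W_\infty\times L^2(I;\mathbb R^m)$ with $\dot y=f(y)+Bu$, $y(0)=y_0$; the minimum is assumed attained. Standing Assumption 1: $Y_0\subset\mathbb R^n$ is compact with $0\in Y_0$, and (A.1) $f\in C^1$, $f(0)=0$, $Df$ Lipschitz on compact sets; (A.2) there exist an open neighbourhood $\mathcal N(Y_0)$ of $Y_0$ and $F^*:\mathcal N(Y_0)\to\mathbb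 R^m$, $F^*(0)=0$, such that for every $y_0\in\mathcal N(Y_0)$ the closed-loop system $\dot y=f(y)+BF^*(y)$, $y(0)=y_0$ has a unique solution $y^*(y_0)\in W_\infty$ and $(y^*(y_0),F^*(y^*(y_0)))$ minimizes $(P^{y_0}_\beta)$; (A.3) $y_0\mapsto y^*(y_0)$ is continuously Fréchet differentiable from $\mathcal N(Y_0)$ to $W_\infty$ and $\|y^*(y_0)\|_{W_\infty}\le M|y_0|$ for some $M>0$ and all $y_0\in\mathcal N(Y_0)$. Set $M_{Y_0}=M\max_{y_0\in Y_0}|y_0|$, $\widehat M=C_\imath M_{Y_0}$, $\mathcal Y_{ad}=\{y\in W_\infty:\|y\|_{W_\infty}\le2M_{Y_0}\}$; (A.4) $F^*$ extends to a $C^1$ map on $\bar B_{2\widehat M}(0)$ with Lipschitz derivative there. $\mathcal H$ is the set of operators $\mathcal F:\mathcal Y_{ad}\to L^2(I;\mathbb R^m)$, $\mathcal F(y)(t)=F(y(t))$, with $F:\bar B_{2\widehat M}(0)\to\mathbb R^m$ Lipschitz and $F(0)=0$. For $\mathcal F\in\mathcal H$: $a(\mathcal F)(y,y_0,\phi)=(\dot y-f(y)-B\mathcal F(y),\phi)_{L^2(I;\mathbb R^n)}+(y(0)-y_0)\cdot\phi(0)$. $(Y_0,\mathcal A,\mu)$ is a complete probability space; an ensemble solution for $\mathcal F$ is $\mathbf y\in L^\infty_\mu(Y_0;W_\infty)$ with $\|\mathbf y\|_{L^\infty_\mu(Y_0;W_\infty)}\le2M_{Y_0}$ and $\int_{Y_0}a(\mathcal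 F)(\mathbf y(y_0),y_0,\Phi(y_0))\,d\mu=0$ for all $\Phi\in L^2_\mu(Y_0;W_\infty)$; $j(\mathbf y,\mathcal F)=\int_{Y_0}J(\mathbf y(y_0),\mathcal F(\mathbf y(y_0)))\,d\mu$. Networks: architecture $(N_0,\dots,N_L)$, $N_0=n$, $N_L=m$; $\mathcal R=\prod_{i=1}^L(\mathbb R^{N_i\times N_{i-1}}\times\mathbb R^{N_i})$ with the Euclidean product norm; $\theta=(W_1,b_1,\dots,W_L,b_L)$; $f_{i,\theta}(x)=\sigma(W_ix+b_i)$ for $i<L$, $f_{L,\theta}(x)=W_Lx+b_L$, $\Psi_\theta=f_{L,\theta}\circ\dots\circ f_{1,\theta}$, $F^\sigma_\theta(x)=\Psi_\theta(x)-\Psi_\theta(0)$, $\mathcal F^\sigma_\theta\in\mathcal H$ its Nemytskii operator. $\mathcal R_{ad}=\{\theta:\|W_1\|_\infty\le\eta_1,\ |b_i|_\infty\le\eta_2,\ i=1,\dots,L\}$ (max norm and induced matrix norm). $\mathcal G_{\mathcal R}(\theta)=\alpha_{\mathcal R}\sum_{i=2}^L\|W_i\|^2$ (Frobenius) if $\theta\in\mathcal R_{ad}$ and $+\infty$ otherwise. Problem $(\mathcal P^\sigma_{\mathcal R})$: minimize $j(\mathbf y,\mathcal F^\sigma_\theta)+\mathcal G_{\mathcal R}(\theta)$ over $\theta\in\mathcal R$ and ensemble solutions $\mathbf y$ for $\mathcal F^\sigma_\theta$. *)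

(* Defs.v *)
From HB Require Import structures.
From mathcomp Require Import all_boot all_order all_algebra.
From mathcomp Require Import all_classical all_reals all_analysis.
Set Implicit Arguments. Unset Strict Implicit. Unset Printing Implicit Defensive.
Import Order.TTheory GRing.Theory Num.Theory.
Import numFieldNormedType.Exports.
Local Open Scope classical_set_scope.
Local Open Scope ring_scope.

Section FinDim.
Variable R : realType.

Definition enorm2 (k : nat) (v : 'cV[R]_k) : R := \sum_(i < k) (v i ord0) ^+ 2.
Definition enorm (k : nat) (v : 'cV[R]_k) : R := Num.sqrt (enorm2 v).
Definition edot (k : nat) (v w : 'cV[R]_k) : R := \sum_(i < k) v i ord0 * w i ord0.
Definition frob2 (p q : nat) (A : 'M[R]_(p, q)) : R :=
  \sum_(i < p) \sum_(j < q) (A i j) ^+ 2.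
Definition frob (p q : nat) (A : 'M[R]_(p, q)) : R := Num.sqrt (frob2 A).
Definition mx_inf_norm (p q : nat) (A : 'M[R]_(p, q)) : R :=
  \big[Num.max/0]_(i < p) \sum_(j < q) `|A i j|.
Definition vec_max_norm (k : nat) (v : 'cV[R]_k) : R :=
  \big[Num.max/0]_(i < k) `|v i ord0|.

Definition has_jac_within (p q : nat) (A : set 'cV[R]_p)
    (F : 'cV[R]_p -> 'cV[R]_q) (DF : 'cV[R]_p -> 'M[R]_(q, p)) (x : 'cV[R]_p) :=
  forall eps : R, 0 < eps -> exists2 delta : R, 0 < delta &
    forall h : 'cV[R]_p, A (x + h) -> enorm h < delta ->
      enorm (F (x + h) - F x - DF x *m h) <= eps * enorm h.

Definition C1_on (p q : nat) (A : set 'cV[R]_p)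
    (F : 'cV[R]_p -> 'cV[R]_q) (DF : 'cV[R]_p -> 'M[R]_(q, p)) :=
  (forall x, A x -> has_jac_within A F DF x) /\
  (forall x, A x -> forall eps : R, 0 < eps -> exists2 delta : R, 0 < delta &
     forall y, A y -> enorm (y - x) < delta -> frob (DF y - DF x) < eps).

Definition lipschitz_on (p q r : nat) (A : set 'cV[R]_p)
    (G : 'cV[R]_p -> 'M[R]_(q, r)) :=
  exists Lip : R, forall x y, A x -> A y -> frob (G x - G y) <= Lip * enorm (x - y).

End FinDim.

(* Functions on I are represented as functions R -> 'cV_k; only their  *)
(* values on I matter.  Elements of W_oo are represented by their      *)
(* (unique) continuous representative.                                 *)
Section FunSpaces.
Variable R : realType.
Local Notation leb := (@lebesgue_measure R).

Definition Iset : set R := [set t | 0 <= t].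

Definition L2fun (g : R -> R) :=
  measurable_fun Iset g /\ (\int[leb]_(t in Iset) ((g t) ^+ 2)%:E < +oo)%E.

Definition L2vec (k : nat) (g : R -> 'cV[R]_k) :=
  forall i : 'I_k, L2fun (fun t => g t i ord0).

Definition l2dot (k : nat) (g h : R -> 'cV[R]_k) : R :=
  fine (\int[leb]_(t in Iset) (edot (g t) (h t))%:E).

Definition l2sq (k : nat) (g : R -> 'cV[R]_k) : R :=
  fine (\int[leb]_(t in Iset) (enorm2 (g t))%:E).

Definition is_derivI (k : nat) (y g : R -> 'cV[R]_k) :=
  forall t : R, 0 <= t -> forall i : 'I_k,
    leb.-integrable `[0, t] (fun s => (g s i ord0)%:E) /\
    y t i ord0 = y 0 i ord0 + fine (\int[leb]_(s in `[0, t]) (g s i ord0)%:E).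

Definition inW (k : nat) (y : R -> 'cV[R]_k) :=
  L2vec y /\ exists g, is_derivI y g /\ L2vec g.

(* the (a.e. unique) weak derivative of y in L^2 (chosen) *)
Definition Wdot (k : nat) (y : R -> 'cV[R]_k) : R -> 'cV[R]_k :=
  match pselect (exists g, is_derivI y g /\ L2vec g) with
  | left e => proj1_sig (cid e)
  | right _ => fun _ => 0
  end.

Definition Wnorm (k : nat) (y : R -> 'cV[R]_k) : R :=
  Num.sqrt (l2sq y + l2sq (Wdot y)).

Definition fsub (k : nat) (y z : R -> 'cV[R]_k) : R -> 'cV[R]_k :=
  fun t => y t - z t.

End FunSpaces.

Section Control.
Variables (R : realType) (n m : nat).
Variables (f : 'cV[R]_n -> 'cV[R]_n) (B : 'M[R]_(n, m)) (Q : 'M[R]_n) (beta : R).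
Local Notation leb := (@lebesgue_measure R).

Definition Jcost (y : R -> 'cV[R]_n) (u : R -> 'cV[R]_m) : \bar R :=
  ((1/2)%:E * \int[leb]_(t in @Iset R)
      (enorm2 (Q *m y t) + beta * enorm2 (u t))%:E)%E.

Definition feasible (y0 : 'cV[R]_n) (y : R -> 'cV[R]_n) (u : R -> 'cV[R]_m) :=
  inW y /\ L2vec u /\ y 0 = y0 /\ is_derivI y (fun t => f (y t) + B *m u t).

Definition minimizes (y0 : 'cV[R]_n) (y : R -> 'cV[R]_n) (u : R -> 'cV[R]_m) :=
  feasible y0 y u /\
  forall y' u', feasible y0 y' u' -> (Jcost y u <= Jcost y' u')%E.

Definition closed_loop_sol (F : 'cV[R]_n -> 'cV[R]_m) (y0 : 'cV[R]_n)
    (y : R -> 'cV[R]_n) :=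
  inW y /\ y 0 = y0 /\ is_derivI y (fun t => f (y t) + B *m F (y t)).

Definition MY0 (M : R) (Y0 : set 'cV[R]_n) : R :=
  M * sup [set enorm x | x in Y0].

Definition standing_assumption (Y0 : set 'cV[R]_n) (Ci : R)
    (Nb : set 'cV[R]_n) (Fs : 'cV[R]_n -> 'cV[R]_m)
    (ystar : 'cV[R]_n -> R -> 'cV[R]_n) (M : R) :=
  Q^T = Q /\ (forall v : 'cV[R]_n, 0 <= (v^T *m Q *m v) ord0 ord0) /\ 0 < beta /\
  0 < Ci /\
  (forall y : R -> 'cV[R]_n, inW y -> forall t, 0 <= t -> enorm (y t) <= Ci * Wnorm y) /\
  compact Y0 /\ Y0 0 /\
  (exists Df, C1_on setT f Df /\
     forall K, compact K -> lipschitz_on K Df) /\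
  f 0 = 0 /\
  open Nb /\ Y0 `<=` Nb /\ Fs 0 = 0 /\
  (forall y0, Nb y0 ->
     closed_loop_sol Fs y0 (ystar y0) /\
     (forall y, closed_loop_sol Fs y0 y -> forall t, 0 <= t -> y t = ystar y0 t) /\
     minimizes y0 (ystar y0) (fun t => Fs (ystar y0 t))) /\
  (exists dY : 'cV[R]_n -> 'I_n -> R -> 'cV[R]_n,
     (forall y0, Nb y0 -> forall k, inW (dY y0 k)) /\
     (forall y0, Nb y0 -> forall eps : R, 0 < eps -> exists2 delta : R, 0 < delta &
        forall h : 'cV[R]_n, Nb (y0 + h) -> enorm h < delta ->
          Wnorm (fun t => ystar (y0 + h) t - ystar y0 t
                            - \sum_(k < n) h k ord0 *: dY y0 k t)
            <= eps * enorm h) /\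
     (forall y0, Nb y0 -> forall k, forall eps : R, 0 < eps ->
        exists2 delta : R, 0 < delta &
        forall y1, Nb y1 -> enorm (y1 - y0) < delta ->
          Wnorm (fsub (dY y1 k) (dY y0 k)) < eps)) /\
  0 < M /\ (forall y0, Nb y0 -> Wnorm (ystar y0) <= M * enorm y0) /\
  (let hatM := Ci * MY0 M Y0 in
   let ball := [set x : 'cV[R]_n | enorm x <= 2 * hatM] in
   exists DF, C1_on ball Fs DF /\ lipschitz_on ball DF).

End Control.

(* The probability space is a measurable type T with probability P,    *)
(* identified with Y0 through a bijection pt : T -> Y0.                 *)
Section Ensemble.
Variables (R : realType) (n m : nat).
Variables (f : 'cV[R]_n -> 'cV[R]_n) (B : 'M[R]_(n, m)) (Q : 'M[R]_n) (beta : R).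
Variables (d : measure_display) (T : measurableType d) (P : probability T R).
Variable (pt : T -> 'cV[R]_n).

Definition complete_prob :=
  forall N : set T, measurable N -> P N = 0%E ->
    forall A : set T, A `<=` N -> measurable A.

Definition strongly_meas (y : T -> R -> 'cV[R]_n) :=
  exists s : nat -> T -> R -> 'cV[R]_n,
    (forall k, finite_set (range (s k))) /\
    (forall k v, measurable (s k @^-1` [set v])) /\
    (forall k p, inW (s k p)) /\
    {ae P, forall p, (fun k => Wnorm (fsub (s k p) (y p))) @ \oo --> (0 : R)}.

Definition Linf_bounded (y : T -> R -> 'cV[R]_n) (c : R) :=
  strongly_meas y /\ {ae P, forall p, inW (y p) /\ Wnorm (y p) <= c}.

Definition L2W (Phi : T -> R -> 'cV[R]_n) :=
  strongly_meas Phi /\ {ae P, forall p, inW (Phi p)} /\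
  (\int[P]_p ((Wnorm (Phi p)) ^+ 2)%:E < +oo)%E.

Definition aform (F : 'cV[R]_n -> 'cV[R]_m) (y : R -> 'cV[R]_n) (y0 : 'cV[R]_n)
    (phi : R -> 'cV[R]_n) : R :=
  l2dot (fun t => Wdot y t - f (y t) - B *m F (y t)) phi + edot (y 0 - y0) (phi 0).

Definition ensemble_sol (MY : R) (F : 'cV[R]_n -> 'cV[R]_m) (y : T -> R -> 'cV[R]_n) :=
  Linf_bounded y (2 * MY) /\
  forall Phi, L2W Phi -> (\int[P]_p (aform F (y p) (pt p) (Phi p))%:E = 0)%E.

Definition jcost (F : 'cV[R]_n -> 'cV[R]_m) (y : T -> R -> 'cV[R]_n) : \bar R :=
  \int[P]_p Jcost Q beta (y p) (fun t => F (y p t)).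

End Ensemble.

(* Neural networks.  Architecture N : nat -> nat with N_0 = N 0,       *)
(* N_L = N L.  Parameters theta = (Wt, bt) with, for k < L,            *)
(* Wt k = W_{k+1} : 'M_(N (k+1), N k) and bt k = b_{k+1}.  Entries with *)
(* k >= L are unused.                                                  *)
Section Network.
Variables (R : realType) (sigma : R -> R) (N : nat -> nat) (L : nat).

Definition weights := forall k : nat, 'M[R]_(N k.+1, N k).
Definition biases := forall k : nat, 'cV[R]_(N k.+1).

Fixpoint layers (Wt : weights) (bt : biases) (k : nat) : 'cV[R]_(N 0) -> 'cV[R]_(N k) :=
  match k with
  | 0 => fun x => x
  | k'.+1 => fun x =>
      let z := Wt k' *m layers Wt bt k' x + bt k' in
      if (k'.+1 < L)%N then map_mx sigma z else z
  end.

Definition Psi (Wt : weights) (bt : biases) : 'cV[R]_(N 0) -> 'cV[R]_(N L) :=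
  layers Wt bt L.

Definition Fnet (Wt : weights) (bt : biases) (x : 'cV[R]_(N 0)) : 'cV[R]_(N L) :=
  Psi Wt bt x - Psi Wt bt 0.

Definition R_ad (eta1 eta2 : R) (Wt : weights) (bt : biases) :=
  mx_inf_norm (Wt 0%N) <= eta1 /\
  forall k, (k < L)%N -> vec_max_norm (bt k) <= eta2.

Definition Greg (eta1 eta2 alpha : R) (Wt : weights) (bt : biases) : \bar R :=
  match pselect (R_ad eta1 eta2 Wt bt) with
  | left _ => (alpha * \sum_(1 <= k < L) frob2 (Wt k))%:E
  | right _ => +oo%E
  end.

End Network.

(* Main.v *)
Require Import Defs.
From HB Require Import structures.
From mathcomp Require Import all_boot all_order all_algebra.
From mathcomp Require Import all_classical all_reals all_analysis.
From mathcomp Require Import measurable_realfun ring lra.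
Import Order.TTheory GRing.Theory Num.Theory.
Import numFieldNormedType.Exports.
Set Implicit Arguments.
Unset Strict Implicit.
Unset Printing Implicit Defensive.
Local Open Scope classical_set_scope.
Local Open Scope ring_scope.

(** Take a minimizing sequence of parameters and ensemble solutions.  The
    regularizer and the constraints bound the parameters, so a subsequence
    converges to some [theta], uniformly on bounded sets of states.  Testing the
    weak formulation with trapezoids in time shows that almost every path of an
    ensemble solution solves the closed-loop equation; the paths are therefore
    uniformly bounded and uniformly Lipschitz, and every sequence of them has
    pointwise convergent subsequences, whose limits solve the limit equation.

    The subsequence is chosen separately for every [p] in the probability space,
    by deciding countably many cuts [y_k(p)(t) < q] one after the other and
    keeping each time infinitely many indices; the chosen side of each cut is a
    measurable set of [p], so the limit ensemble is measurable.  Only indices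
    [k] whose cost is close to [liminf_k J(y_k(p))] are used, so that Fatou's
    lemma, first in time and then in [p], makes the limit optimal.

    No measurability of the initial data [pt] is available.  The weak formulation
    is used in the following form: there is no set [A] of positive measure on
    which the tested residual is bounded below by a positive constant. *)

(** * Measurable choice of subsequences *)

(** The subsequence has to depend on [p]: a bounded sequence of ensembles need not have one
    subsequence that converges at almost every [p], as Rademacher functions show, and weak limits do
    not pass through the nonlinear [f] and [F]. Measurability of the limit is the price, so the
    extraction is a deterministic rule made of countable set operations. Pointwise limits are enough
    because a path solves its own equation: its derivative is the drift along the path, so it
    converges wherever the path does, and grid times decide all times because the drift is bounded.
    The W-norm may still drop in the limit; the norm constraint and the cost only need lower
    semicontinuity. Convergence in norm is proved for simple approximations of one fixed ensemble,
    where cuts of the norm itself are added. The trapezoids vanish at time [0], so the equation is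
    obtained without touching the initial data; the initial condition is recovered separately, from
    differences of initial values in which [pt] cancels. *)

Section Selection.
Variables (T : Type) (D E : nat -> nat -> set T).
Hypothesis D_noninc : forall j k p, D j.+1 k p -> D j k p.
Hypothesis D_io : forall p j m, exists2 k, (m <= k)%N & D j k p.

(** Infinitely many kept indices lie in [e], at every level [j] of [D]. Asking for all levels at
    once lets the diagonal sequence tighten [D] while it decides cuts; only countable operations
    occur, so measurability in [p] is kept. *)
Definition sel_hit (S : nat -> set T) (e : nat -> set T) : set T :=
  \bigcap_j \bigcap_m \bigcup_k
    [set p | (m <= k)%N /\ D j k p /\ S k p /\ e k p].

(** The side [E i] of a cut is preferred as soon as it is hit; the rule leaves nothing to choose and
    is applied to all [p] simultaneously. *)
Fixpoint sel_set (i : nat) : nat -> set T :=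
  if i is i'.+1 then
    fun k => sel_set i' k `&`
      ((sel_hit (sel_set i') (E i') `&` E i' k) `|`
       (~` sel_hit (sel_set i') (E i') `&` ~` E i' k))
  else fun=> setT.

Definition sel_choice (i : nat) : set T := sel_hit (sel_set i) (E i).

Lemma D_anti j j' k p : (j <= j')%N -> D j' k p -> D j k p.
Proof.
move=> /subnKC <-; elim: (j' - j)%N => [|l IH]; first by rewrite addn0.
by rewrite addnS => /D_noninc.
Qed.

(** Invariant of the rule. If [E i] is not hit, then at some level [j0] every kept index from some
    [m0] on lies outside [E i]; [D] decreases in the level, so the indices supplied at level
    [maxn j j0] serve on the other side. *)
Lemma sel_set_io i p j m : exists k, [/\ (m <= k)%N, D j k p & sel_set i k p].
Proof.
elim: i j m => [|i IH] j m /=.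
  by have [k mk Dk] := D_io p j m; exists k.
have [h|h] := pselect (sel_hit (sel_set i) (E i) p).
  have [k _ [mk [Dk [Sk Ek]]]] := h j I m I.
  by exists k; split => //; split => //; left.
have [j0 [m0 nh]] : exists j0 m0, forall k,
    (m0 <= k)%N -> D j0 k p -> sel_set i k p -> ~ E i k p.
  apply: contrapT => /forallNP nh; apply: h => j0 _ m0 _.
  apply: contrapT => nk; apply: (nh j0); exists m0 => k mk Dk Sk Ek.
  by apply: nk; exists k.
have [k [mk Dk Sk]] := IH (maxn j j0) (maxn m m0).
exists k; split; first by apply: leq_trans mk; exact: leq_maxl.
  by apply: D_anti Dk; exact: leq_maxl.
split => //; right; split => //; apply: nh => //.
  by apply: leq_trans mk; exact: leq_maxr.
by apply: D_anti Dk; exact: leq_maxr.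
Qed.

Lemma sel_setE i i' k p : (i < i')%N -> sel_set i' k p ->
  E i k p <-> sel_choice i p.
Proof.
elim: i' => // i' IH; rewrite ltnS leq_eqVlt => /predU1P[->|ii'].
  by move=> [_ [[h e]|[h e]]]; split.
by move=> [Sk _]; exact: IH.
Qed.

(** Diagonal choice: the [j]-th index is taken in [sel_set j], which has already decided all cuts
    [i < j]. The side on which the sequence settles is [sel_choice i], a set described without
    reference to [kap]. *)
Lemma selection p : exists kap : nat -> nat,
  [/\ forall j, (kap j < kap j.+1)%N, forall j, D j (kap j) p &
      forall i j, (i < j)%N -> E i (kap j) p <-> sel_choice i p].
Proof.
have next j m : {k | (m <= k)%N /\ D j k p /\ sel_set j k p}.
  by apply: cid; have [k [? ? ?]] := sel_set_io j p j m; exists k.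
pose kap := fix kap j := match j with
  | 0 => sval (next 0 0)
  | j'.+1 => sval (next j'.+1 (kap j').+1) end.
exists kap; split.
- by move=> j /=; case: (next _ _) => k /= [].
- by case=> [|j] /=; case: (next _ _) => k /= [? []].
- move=> i [//|j] ij; apply: sel_setE ij _.
  by rewrite /=; case: (next _ _) => k /= [? []].
Qed.

End Selection.

Lemma sel_choice_measurable (d : measure_display) (T : measurableType d)
    (D E : nat -> nat -> set T) :
  (forall j k, measurable (D j k)) -> (forall i k, measurable (E i k)) ->
  forall i, measurable (sel_choice D E i).
Proof.
move=> mD mE.
have mhit S e : (forall k, measurable (S k)) -> (forall k, measurable (e k)) ->
    measurable (sel_hit D S e).
  move=> mS me; apply: bigcapT_measurable => j; apply: bigcapT_measurable => m.
  apply: bigcupT_measurable => k.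
  have [mk|mk] := boolP (m <= k)%N.
    rewrite (_ : [set p | _] = D j k `&` (S k `&` e k)); last first.
      by apply/seteqP; split => p /=; [case=> ? [? [? ?]]|case=> ? []].
    by apply: measurableI => //; exact: measurableI.
  rewrite (_ : [set p | _] = set0) //.
  by apply/seteqP; split => p //= -[].
have mS i k : measurable (sel_set D E i k).
  elim: i k => [|i IH] k /=; first exact: measurableT.
  have mh := mhit _ _ IH (mE i).
  apply: measurableI => //; apply: measurableU; apply: measurableI => //;
  exact: measurableC.
by move=> i; apply: mhit.
Qed.

Lemma leq_incr_seq (kap : nat -> nat) : (forall j, (kap j < kap j.+1)%N) ->
  forall j, (j <= kap j)%N.
Proof. by move=> h; elim=> // j /leq_ltn_trans; apply. Qed.

Lemma cvg_subseq (T : topologicalType) (x : nat -> T) (kap : nat -> nat) (l : T) :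
  (forall j, (kap j < kap j.+1)%N) -> x @ \oo --> l -> (x \o kap) @ \oo --> l.
Proof.
move=> /leq_incr_seq hk xl; apply: cvg_comp xl.
move=> A [N _ NA]; exists N => // j /= Nj; apply: NA => /=.
exact: leq_trans Nj (hk j).
Qed.

(** * Limits of real sequences determined by rational cuts *)

Section RealCuts.
Variable R : realType.

Lemma ratr_between (a b : R) : a < b -> exists q : rat, a < ratr q < b.
Proof.
by move=> /rat_in_itvoo[q]; rewrite in_itv /= => h; exists q.
Qed.

(* [b q] records on which side of the cut [q] the sequence eventually stays. *)
Definition cut_limit (b : rat -> Prop) : R := inf [set ratr q | q in [set q | b q]].

Lemma cvg_cut_limit (x : nat -> R) (C : R) (b : rat -> Prop) :
  (forall k, `|x k| <= C) ->
  (forall q, exists m, forall k, (m <= k)%N -> (x k < ratr q) <-> b q) ->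
  x @ \oo --> cut_limit b.
Proof.
move=> xC hb; set S := [set (ratr q : R) | q in [set q | b q]].
have lbS : lbound S (- C).
  move=> _ [q /= bq <-]; have [m hm] := hb q.
  have := (hm m (leqnn m)).2 bq; have := xC m; rewrite ler_norml => /andP[h _].
  by move=> /ltW; apply: le_trans.
have S0 : S !=set0.
  have [q /andP[Cq _]] : exists q : rat, C < ratr q < C + 1.
    by apply: ratr_between; rewrite ltrDl.
  exists (ratr q), q => //=; have [m hm] := hb q.
  apply/(hm m (leqnn m)); apply: le_lt_trans Cq.
  by apply: le_trans (xC m); exact: ler_norm.
have hi : has_inf S by split => //; exists (- C).
apply/cvgrPdist_lt => e e0.
have [_ [q bq <-] qe] : exists2 z, S z & z < inf S + e.
  exact: inf_adherent.
have [q' /andP[q'1 q'2]] : exists q' : rat, inf S - e < ratr q' < inf S.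
  by apply: ratr_between; rewrite gtrBl.
have nbq' : ~ b q'.
  move=> bq'; have : inf S <= ratr q' by apply: ge_inf => //; [exists (- C)|exists q'].
  by rewrite leNgt q'2.
have [m hm] := hb q; have [m' hm'] := hb q'.
exists (maxn m m') => // k /=; rewrite geq_max => /andP[mk m'k].
have x1 : x k < ratr q by apply/(hm k mk).
have x2 : ratr q' <= x k by rewrite leNgt; apply/negP => /(hm' k m'k).
rewrite /cut_limit -/S ltr_norml; move: x1 x2 q'1 qe; lra.
Qed.

(** Writes the strict sublevel sets of the limit through countably many [b q]; this is how
    measurability of the limit follows from that of the choices. *)
Lemma cut_limit_lt (x : nat -> R) (C : R) (b : rat -> Prop) (r : R) :
  (forall k, `|x k| <= C) ->
  (forall q, exists m, forall k, (m <= k)%N -> (x k < ratr q) <-> b q) ->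
  cut_limit b < r <-> exists2 q : rat, b q & ratr q < r.
Proof.
move=> xC hb; have xl := cvg_cut_limit xC hb; split.
  move=> /ratr_between[q /andP[lq qr]]; exists q => //.
  have [m hm] := hb q.
  have [m' _ hm'] := cvgr_lt _ xl _ lq.
  apply/(hm (maxn m m') (leq_maxl _ _)); apply: hm' => /=; exact: leq_maxr.
move=> [q bq qr]; apply: le_lt_trans qr.
rewrite leNgt; apply/negP => ql; have [m' _ hm'] := cvgr_gt _ xl _ ql; have [m hm] := hb q.
have := hm' (maxn m m') (leq_maxr _ _); rewrite ltNge => /negP; apply.
by apply/ltW/(hm _ (leq_maxl _ _)).
Qed.

(** Diagonal Bolzano-Weierstrass theorem: [selection] over a one-point parameter space with a
    trivial [D]. *)
Lemma common_subsequence (I : countType) (x : nat -> I -> R) (C : I -> R) :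
  (forall k i, `|x k i| <= C i) ->
  exists kap : nat -> nat, exists l : I -> R,
    (forall j, (kap j < kap j.+1)%N) /\
    forall i, (fun j => x (kap j) i) @ \oo --> l i.
Proof.
move=> xC.
(* Pairs of a coordinate and a rational are numbered by [pickle]; numbers that code nothing give
   empty cuts. *)
pose E (a k : nat) : set unit := [set _ |
  if unpickle a is Some (i, q) then x k i < ratr (q : rat) else false].
have [kap [kincr _ hk]] := @selection unit (fun _ _ => setT) E (fun _ _ _ => id)
  (fun _ _ m => ex_intro2 _ _ m (leqnn m) Logic.I) tt.
pose b (i : I) (q : rat) := sel_choice (fun _ _ => setT) E (pickle (i, q)) tt.
exists kap, (fun i => cut_limit (b i)); split => // i.
apply: (@cvg_cut_limit _ (C i)) => // q.
exists (pickle (i, q)).+1 => k ik.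
by have := hk _ _ ik; rewrite /E /= pickleK.
Qed.

End RealCuts.

(** * Integration without measurability, and Tonelli's theorem *)

Section LevelSets.
Context d (T : measurableType d) (R : realType).
Variables (f g : T -> R).
Hypotheses (mf : measurable_fun setT f) (mg : measurable_fun setT g).

Lemma measurable_le_set : measurable [set x | f x <= g x].
Proof.
rewrite -[X in measurable X]setTI.
exact: (measurable_fun_ler mf mg measurableT (Y := [set true])).
Qed.

Lemma measurable_lt_set : measurable [set x | f x < g x].
Proof.
rewrite -[X in measurable X]setTI.
exact: (measurable_fun_ltr mf mg measurableT (Y := [set true])).
Qed.

End LevelSets.

Section LowerIntegral.
Context d (T : measurableType d) (R : realType).
Variable mu : {measure set T -> \bar R}.
Local Open Scope ereal_scope.
Import HBNNSimple.

(* The integral of a nonnegative function is a supremum over simple functions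
   below it, so it is monotone without any measurability assumption. *)
Lemma ge0_le_lower_integral (D : set T) (f g : T -> \bar R) :
  (forall x, D x -> 0 <= f x) -> (forall x, D x -> f x <= g x) ->
  \int[mu]_(x in D) f x <= \int[mu]_(x in D) g x.
Proof.
move=> f0 fg.
have g0 x : D x -> 0 <= g x by move=> Dx; exact: le_trans (f0 x Dx) (fg x Dx).
rewrite !ge0_integralE //; apply: ereal_sup_le => _ [h /= hf <-].
exists h => //= x; apply: le_trans (hf x) _.
by apply: lee_restrict => y Dy; exact: fg.
Qed.

(** A simple function below [h] is measurable even if [h] is not, so dropping [N] does not change
    its integral; the supremum inherits this. *)
Lemma lower_integral_setC_null (h : T -> \bar R) (N : set T) :
  (forall x, 0 <= h x) -> measurable N -> mu N = 0 ->
  \int[mu]_x h x = \int[mu]_(x in ~` N) h x.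
Proof.
move=> h0 mN N0; apply/eqP; rewrite eq_le; apply/andP; split; last first.
  rewrite [leLHS]integral_mkcond; apply: ge0_le_lower_integral => x _;
  by rewrite patchE; case: ifP.
rewrite [leLHS]ge0_integralTE //; apply: ge_ereal_sup => _ [g /= gh <-].
rewrite -integralT_nnsfun.
have mg : measurable_fun setT (fun x => (g x)%:E) by exact/measurable_EFinP.
have g0 x : 0 <= (g x)%:E by rewrite lee_fin; exact: fun_ge0.
rewrite (ge0_negligible_integral mN measurableT mg) // setTD.
exact: ge0_le_lower_integral.
Qed.

(** Markov's inequality without measurability of [h]: [c] times the indicator of [A] is a simple
    function below [h]. *)
Lemma integral_eq0_null (h : T -> R) (A : set T) (c : R) :
  (forall x, (0 <= h x)%R) -> measurable A -> (0 < c)%R ->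
  (forall x, A x -> (c <= h x)%R) -> \int[mu]_x (h x)%:E = 0 -> mu A = 0.
Proof.
move=> h0 mA c0 hc hI.
have : \int[mu]_x (c * \1_A x)%:E <= \int[mu]_x (h x)%:E.
  apply: ge0_le_lower_integral => x _; rewrite lee_fin.
    by rewrite mulr_ge0 // ltW.
  rewrite indicE; have [/set_mem Ax|_] := boolP (x \in A).
    by rewrite mulr1 hc.
  by rewrite mulr0.
rewrite hI; under eq_integral do rewrite EFinM.
rewrite ge0_integralZl_EFin //; [|exact/measurable_EFinP/measurable_indic|exact: ltW].
rewrite integral_indic // setIT => h1; apply/eqP; rewrite eq_le measure_ge0 andbT.
by rewrite -(@lee_pmul2l _ c%:E) ?mule0 // ?lte_fin.
Qed.

(** A simple [g] below the positive part is measurable, and where [g] is at least [1/(k+1)] so is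
    [h], since there the positive part is not [0]. These level sets are null, hence [g] vanishes
    almost everywhere. *)
Let integral_pos_part_eq0 (h : T -> R) :
  (forall A c, measurable A -> (0 < c)%R -> (forall x, A x -> (c <= h x)%R) ->
     mu A = 0) ->
  \int[mu]_x (fun x => (h x)%:E)^\+ x = 0.
Proof.
move=> hA; apply/eqP; rewrite eq_le; apply/andP; split; last first.
  by apply: integral_ge0 => x _; exact: funepos_ge0.
rewrite ge0_integralTE; last by move=> x; exact: funepos_ge0.
apply: ge_ereal_sup => _ [g /= gh <-].
rewrite -integralT_nnsfun.
have g0 x : (0 <= g x)%R by exact: fun_ge0.
rewrite (ae_eq_integral (cst 0)) //.
- by rewrite integral0.
- exact/measurable_EFinP.
- have : mu.-negligible (\bigcup_k [set x | (k.+1%:R^-1 <= g x)%R]).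
    have mk k : measurable [set x | (k.+1%:R^-1 <= g x)%R].
      exact: (@measurable_le_set _ T R (fun=> k.+1%:R^-1%R) g).
    apply: negligible_bigcup => k; apply/negligibleP => //.
    apply: (hA _ k.+1%:R^-1%R) => //.
    move=> x /= gx; have := gh x; rewrite funeposE /= -EFin_max lee_fin le_max.
    case/orP=> [|gx0]; first exact: le_trans.
    have k0 : (0 < k.+1%:R^-1 :> R)%R by [].
    by have := lt_le_trans k0 (le_trans gx gx0); rewrite ltxx.
  apply: negligibleS => x /= gx; apply: contrapT => nx; apply: gx => _.
  congr (_%:E); apply/eqP; rewrite eq_le g0 andbT leNgt; apply/negP => gx.
  apply: nx; exists (Num.truncn (g x)^-1) => //=.
  rewrite -[leRHS]invrK lef_pV2 ?posrE ?invr_gt0 //.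
  exact: ltW (truncnS_gt _).
Qed.

(** Counterpart of [integral_eq0_null]: it turns null-set statements back into a vanishing integral,
    for integrands containing the possibly nonmeasurable [pt]. *)
Lemma integral_eq0_of_null (h : T -> R) :
  (forall A c, measurable A -> (0 < c)%R -> (forall x, A x -> (c <= h x)%R) ->
     mu A = 0) ->
  (forall A c, measurable A -> (0 < c)%R -> (forall x, A x -> (c <= - h x)%R) ->
     mu A = 0) ->
  \int[mu]_x (h x)%:E = 0.
Proof.
move=> hp hn; rewrite integralE integral_pos_part_eq0 //.
rewrite (_ : (fun x => (h x)%:E)^\- = (fun x => (- h x)%:E)^\+).
  by rewrite (integral_pos_part_eq0 hn) sube0.
by apply/funext => x; rewrite funeposE funenegE EFinN.
Qed.

End LowerIntegral.

Section Liminf.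
Variable R : realType.
Local Open Scope ereal_scope.

Lemma limn_einf_le_cvg (u v : nat -> \bar R) (l : \bar R) :
  (forall k, u k <= v k) -> v @ \oo --> l -> limn_einf u <= l.
Proof.
move=> uv vl; rewrite limn_einf_lim -(cvg_lim _ vl) //.
apply: lee_lim; [exact: is_cvg_einfs|by apply/cvg_ex; exists l|].
apply: nearW => k; apply: le_trans (uv k).
by apply: ereal_inf_lbound; exists k => /=.
Qed.

Lemma fatou_cvg d (T : measurableType d) (mu : {measure set T -> \bar R})
    (D : set T) (f_ : nat -> T -> \bar R) (f : T -> \bar R) :
  measurable D -> (forall k, measurable_fun D (f_ k)) ->
  (forall k x, D x -> 0 <= f_ k x) ->
  (forall x, D x -> f_ ^~ x @ \oo --> f x) ->
  \int[mu]_(x in D) f x <= limn_einf (fun k => \int[mu]_(x in D) f_ k x).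
Proof.
move=> mD mf f0 ff; have := fatou mu mD mf f0; apply: le_trans.
rewrite le_eqVlt; apply/orP; left; apply/eqP; apply: eq_integral => x /set_mem Dx.
by rewrite (cvg_limn_einf_sup (ff x Dx)).1.
Qed.

End Liminf.

(** * Joint measurability of Caratheodory functions and of their integrals in time *)

Section Tonelli.
Context d (T : measurableType d) (R : realType).
Local Notation leb := (@lebesgue_measure R).
Variable (h : T -> R -> R).
Hypothesis mh : forall t : R, 0 <= t -> measurable_fun setT (h ^~ t).
Hypothesis ch : forall p (t : R) (s : nat -> R), 0 <= t -> (forall k, 0 <= s k) ->
  s @ \oo --> t -> (fun k => h p (s k)) @ \oo --> h p t.

(** Index of the cell of width [1/(N+1)] containing [t]; negative times are sent to cell [0]. *)
Definition grid (N : nat) (t : R) : nat := Num.truncn (Num.max t 0 * N.+1%:R).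

Lemma grid_measurable N k : measurable [set t | grid N t = k].
Proof.
rewrite (_ : [set t | _] = [set t | k%:R <= Num.max t 0 * N.+1%:R] `&`
   [set t | Num.max t 0 * N.+1%:R < k.+1%:R]); last first.
  have h0 t : 0 <= Num.max t 0 * N.+1%:R :> R by rewrite mulr_ge0 // le_max lexx orbT.
  apply/seteqP; split => t /=.
    by move=> <-; have /andP[] := truncn_itv (h0 t).
  by move=> [a b]; apply: truncn_def; rewrite a.
have mg : measurable_fun setT (fun t : R => Num.max t 0 * N.+1%:R).
  by apply: measurable_funM => //; exact: measurable_maxr.
apply: measurableI; first exact: (@measurable_le_set _ _ R (fun=> k%:R)).
exact: (@measurable_lt_set _ _ R _ (fun=> k.+1%:R)).
Qed.

Lemma cvg_grid (t : R) : 0 <= t ->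
  (fun N => (grid N t)%:R / N.+1%:R : R) @ \oo --> t.
Proof.
move=> t0; apply/cvgrPdist_le => e e0.
exists (Num.truncn e^-1) => // N /= hN.
have N0 : 0 < N.+1%:R :> R by [].
have := @truncn_itv _ (t * N.+1%:R) (mulr_ge0 t0 (ltW N0)).
rewrite /grid (max_idPl t0); set k := Num.truncn _ => /andP[k1 k2].
have a1 : k%:R / N.+1%:R <= t by rewrite ler_pdivrMr.
have a2 : t <= k%:R / N.+1%:R + N.+1%:R^-1.
  by rewrite -[X in _ + X]mul1r -mulrDl ler_pdivlMr // natr1 ltW.
have a3 : N.+1%:R^-1 <= e.
  rewrite -[leRHS]invrK lef_pV2 ?posrE ?invr_gt0 //.
  apply: le_trans (ltW (truncnS_gt e^-1)) _.
  by rewrite ler_nat ltnS.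
by rewrite ger0_norm ?subr_ge0 // lerBlDl (le_trans a2) // lerD2l.
Qed.

(** With time frozen at the left end of its grid cell, preimages are countable unions of measurable
    rectangles; continuity in time gives the limit. Cutting off at [0] extends [h] to negative
    times, where nothing is assumed. *)
Lemma caratheodory_measurable :
  measurable_fun setT (fun z : T * R => h z.1 (Num.max z.2 0)).
Proof.
pose hN N (z : T * R) := h z.1 ((grid N z.2)%:R / N.+1%:R).
apply: (@measurable_fun_cvg _ _ R setT hN).
  move=> N _ U mU; rewrite setTI.
  rewrite (_ : hN N @^-1` U = \bigcup_k
     ((h ^~ (k%:R / N.+1%:R) @^-1` U) `*` [set t | grid N t = k])); last first.
    apply/seteqP; split => [[p t] /= Ut|[p t] [k _ [/= Ut gk]]].
      by exists (grid N t).
    by rewrite /hN /= gk.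
  apply: bigcupT_measurable => k; apply: measurableX; last exact: grid_measurable.
  by rewrite -[X in measurable X]setTI; apply: mh => //; rewrite mulr_ge0.
move=> [p t] _; apply: ch => /=.
- by rewrite le_max lexx orbT.
- by move=> k; rewrite mulr_ge0.
- have -> : (fun N => (grid N t)%:R / N.+1%:R : R) =
      (fun N => (grid N (Num.max t 0))%:R / N.+1%:R).
    by apply/funext => N; rewrite /grid [in RHS](max_idPl (_ : 0 <= Num.max t 0)) // le_max lexx orbT.
  by apply: cvg_grid; rewrite le_max lexx orbT.
Qed.

Lemma measurable_fun_integral_param (D : set R) : measurable D ->
  (forall t, D t -> 0 <= t) -> (forall p t, 0 <= t -> 0 <= h p t) ->
  measurable_fun setT (fun p => \int[leb]_(t in D) (h p t)%:E)%E.
Proof.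
move=> mD D0 h0.
pose f (z : T * R) := (h z.1 (Num.max z.2 0) * \1_D z.2)%:E.
have mf : measurable_fun setT f.
  apply/measurable_EFinP; apply: measurable_funM; first exact: caratheodory_measurable.
  apply: measurableT_comp => //; exact: measurable_indic.
have := @measurable_fun_fubini_tonelli_F _ _ T _ R leb f mf.
rewrite /fubini_F; set g := (X in measurable_fun _ X) => mg.
have <- : g = (fun p => \int[leb]_(t in D) (h p t)%:E)%E.
  apply/funext => p; rewrite /g [RHS]integral_mkcond; apply: eq_integral => t _.
  rewrite /f /= patchE indicE; case: ifPn => [/set_mem/D0 t0|_].
    by rewrite mulr1 (max_idPl t0).
  by rewrite mulr0.
apply: mg => -[p t]; rewrite lee_fin mulr_ge0 //; apply: h0.
by rewrite le_max lexx orbT.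
Qed.

End Tonelli.

Section AlmostEverywhere.
Context d (T : measurableType d) (R : realType) (mu : {measure set T -> \bar R}).

Lemma ae_imp (A B : T -> Prop) : {ae mu, forall x, A x} ->
  (forall x, A x -> B x) -> {ae mu, forall x, B x}.
Proof.
move=> hA AB; apply: filterS hA => //; exact: (ae_filter_ringOfSetsType mu).
Qed.

Lemma ae_imp2 (A B C : T -> Prop) : {ae mu, forall x, A x} ->
  {ae mu, forall x, B x} -> (forall x, A x -> B x -> C x) ->
  {ae mu, forall x, C x}.
Proof.
move=> hA hB ABC; apply: filterS2 hA hB => //; exact: (ae_filter_ringOfSetsType mu).
Qed.

Lemma ae_null_cover (A : T -> Prop) : {ae mu, forall x, A x} ->
  exists N, [/\ measurable N, mu N = 0%E & forall x, ~ N x -> A x].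
Proof.
by move=> [N [mN N0 sN]]; exists N; split=> // x Nx; apply: contrapT => /sN.
Qed.

Lemma ae_forall_countable (I : countType) (A : I -> T -> Prop) :
  (forall i, {ae mu, forall x, A i x}) -> {ae mu, forall x, forall i, A i x}.
Proof.
move=> hA.
have h : {ae mu, forall x, forall k : nat,
    if unpickle k is Some i then A i x else True}.
  apply: ae_foralln => k; case: (unpickle k) => [i|]; first exact: hA.
  by exists set0; split => // x /=.
by apply: (ae_imp h) => x {}h i; have := h (pickle i); rewrite pickleK.
Qed.

End AlmostEverywhere.

(** * Entrywise limits and networks *)

Section EntrywiseLimits.
Variable R : realType.

Definition mx_cvg p q (x : nat -> 'M[R]_(p, q)) (l : 'M[R]_(p, q)) :=
  forall i j, (fun k => x k i j) @ \oo --> l i j.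

(** Continuity by sequences and entries: the limits taken below are sequential, and subsequences and
    measurability are handled coordinate by coordinate. *)
Definition seq_cont p q (G : 'cV[R]_p -> 'cV[R]_q) :=
  forall x l, mx_cvg x l -> mx_cvg (G \o x) (G l).

Lemma cvg_sum_ord n (x : nat -> 'I_n -> R) (l : 'I_n -> R) :
  (forall i, (fun k => x k i) @ \oo --> l i) ->
  (fun k => \sum_i x k i) @ \oo --> \sum_i l i.
Proof.
move=> h; elim: (index_enum _) => [|a s IH].
  by rewrite big_nil; under eq_fun do rewrite big_nil; exact: cvg_cst.
rewrite big_cons; under eq_fun do rewrite big_cons.
by apply: cvgD; [exact: h|exact: IH].
Qed.

Lemma mx_cvg_cst p q (l : 'M[R]_(p, q)) : mx_cvg (fun=> l) l.
Proof. by move=> i j; exact: cvg_cst. Qed.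
Arguments mx_cvg_cst {p q} l i j.

Lemma mx_cvgD p q (x y : nat -> 'M[R]_(p, q)) l m :
  mx_cvg x l -> mx_cvg y m -> mx_cvg (fun k => x k + y k) (l + m).
Proof.
move=> xl ym i j; rewrite mxE.
under eq_fun do rewrite mxE.
by apply: cvgD; [exact: xl|exact: ym].
Qed.

Lemma mx_cvgB p q (x y : nat -> 'M[R]_(p, q)) l m :
  mx_cvg x l -> mx_cvg y m -> mx_cvg (fun k => x k - y k) (l - m).
Proof.
move=> xl ym i j; rewrite !mxE.
under eq_fun do rewrite !mxE.
by apply: cvgB; [exact: xl|exact: ym].
Qed.

Lemma mx_cvgM p q r (x : nat -> 'M[R]_(p, q)) (y : nat -> 'M[R]_(q, r)) l m :
  mx_cvg x l -> mx_cvg y m -> mx_cvg (fun k => x k *m y k) (l *m m).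
Proof.
move=> xl ym i j; rewrite mxE.
under eq_fun do rewrite mxE.
by apply: cvg_sum_ord => a; apply: cvgM; [exact: xl|exact: ym].
Qed.

Lemma mx_cvg_map p q (s : R -> R) (x : nat -> 'M[R]_(p, q)) l :
  continuous s -> mx_cvg x l -> mx_cvg (fun k => map_mx s (x k)) (map_mx s l).
Proof.
move=> cs xl i j; rewrite mxE.
under eq_fun do rewrite mxE.
by apply: continuous_cvg; [exact: cs|exact: xl].
Qed.

Lemma mx_cvg_subseq p q (x : nat -> 'M[R]_(p, q)) l (kap : nat -> nat) :
  (forall j, (kap j < kap j.+1)%N) -> mx_cvg x l -> mx_cvg (x \o kap) l.
Proof. by move=> hk xl i j; exact: (cvg_subseq hk (xl i j)). Qed.

Lemma cvg_frob2 p q (x : nat -> 'M[R]_(p, q)) l :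
  mx_cvg x l -> (fun k => frob2 (x k)) @ \oo --> frob2 l.
Proof.
move=> xl; apply: cvg_sum_ord => i; apply: cvg_sum_ord => j.
by rewrite expr2; under eq_fun do rewrite expr2; apply: cvgM; exact: xl.
Qed.

Lemma cvg_enorm2 p (x : nat -> 'cV[R]_p) l :
  mx_cvg x l -> (fun k => enorm2 (x k)) @ \oo --> enorm2 l.
Proof.
move=> xl; apply: cvg_sum_ord => i.
by rewrite expr2; under eq_fun do rewrite expr2; apply: cvgM; exact: xl.
Qed.

Lemma cvg_edot p (x y : nat -> 'cV[R]_p) l m : mx_cvg x l -> mx_cvg y m ->
  (fun k => edot (x k) (y k)) @ \oo --> edot l m.
Proof.
by move=> xl ym; apply: cvg_sum_ord => i; apply: cvgM; [exact: xl|exact: ym].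
Qed.

Lemma enorm2_ge0 p (v : 'cV[R]_p) : 0 <= enorm2 v.
Proof. by apply: sumr_ge0 => i _; exact: sqr_ge0. Qed.

Lemma enorm20 p : enorm2 (0 : 'cV[R]_p) = 0.
Proof. by apply: big1 => i _; rewrite mxE expr0n. Qed.

Lemma sqr_entry_le_enorm2 p (v : 'cV[R]_p) i : v i ord0 ^+ 2 <= enorm2 v.
Proof.
rewrite /enorm2 (bigD1 i) //= lerDl; apply: sumr_ge0 => j _; exact: sqr_ge0.
Qed.

Lemma entry_le_enorm p (v : 'cV[R]_p) i : `|v i ord0| <= enorm v.
Proof. by rewrite -sqrtr_sqr; apply: ler_wsqrtr; exact: sqr_entry_le_enorm2. Qed.

Lemma enorm2_le_parallelogram p (a b : 'cV[R]_p) :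
  enorm2 (a - b) <= 2 * enorm2 a + 2 * enorm2 b.
Proof.
rewrite /enorm2 !mulr_sumr -big_split; apply: ler_sum => i _ /=.
rewrite !mxE -subr_ge0.
rewrite (_ : _ - _ = (a i ord0 + b i ord0) ^+ 2); last by ring.
exact: sqr_ge0.
Qed.

(** Only the first-order expansion at the limit point is used, with tolerance [1]: it bounds the
    increment by [|h| + |DF h|], which tends to [0]. *)
Lemma C1_on_seq_cont p q (F : 'cV[R]_p -> 'cV[R]_q) DF :
  C1_on setT F DF -> seq_cont F.
Proof.
move=> [jac _] x l xl i j; rewrite ord1 {j}.
pose h k := x k - l.
have h0 : mx_cvg h 0.
  by have := mx_cvgB xl (mx_cvg_cst l); rewrite subrr.
have en0 : (fun k => enorm (h k)) @ \oo --> (0 : R).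
  have -> : 0 = Num.sqrt (enorm2 (0 : 'cV[R]_p)) by rewrite enorm20 sqrtr0.
  by apply: (continuous_cvg _ (@sqrt_continuous R _)); exact: cvg_enorm2.
have d0 : (fun k => (DF l *m h k) i ord0) @ \oo --> (0 : R).
  have := mx_cvgM (mx_cvg_cst (DF l)) h0; rewrite mulmx0 => /(_ i ord0).
  by rewrite mxE.
have [del del0 jl] := jac l Logic.I 1 ltr01.
have bnd : \forall k \near \oo, `|F (x k) i ord0 - F l i ord0| <=
    enorm (h k) + `|(DF l *m h k) i ord0|.
  apply: filterS (cvgr_lt _ en0 _ del0) => k hk.
  have := jl (h k) Logic.I hk; rewrite mul1r {1}/h [l + _]addrC subrK => e1.
  have := le_trans (entry_le_enorm _ i) e1.
  rewrite [X in `|X|]mxE [X in `|X + _|]mxE [X in `|_ + X + _|]mxE [X in `|_ + X|]mxE.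
  by rewrite -lerBlDr; apply: le_trans; exact: lerB_dist.
have s0 : (fun k => enorm (h k) + `|(DF l *m h k) i ord0|) @ \oo --> (0 : R).
  by rewrite -[X in _ --> X]addr0; apply: cvgD => //; rewrite -(normr0 R); exact: cvg_norm.
apply/cvgrPdist_lt => e e0; apply: filterS2 bnd (cvgr_lt _ s0 _ e0) => k.
by rewrite distrC /=; exact: le_lt_trans.
Qed.

(** Compactness of the cube: points where some entry of [G] exceeds [k] would have a convergent
    subsequence, along which [G] converges and is therefore bounded. *)
Lemma seq_cont_bounded p q (G : 'cV[R]_p -> 'cV[R]_q) (C : R) :
  seq_cont G -> exists K : R, forall x : 'cV[R]_p, (forall i, `|x i ord0| <= C) ->
    forall i, `|G x i ord0| <= K.
Proof.
move=> cG; apply: contrapT => nK.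
have ex (k : nat) : {x : 'cV[R]_p | (forall i, `|x i ord0| <= C) /\
    exists i, k%:R < `|G x i ord0|}.
  apply: cid; apply: contrapT => nx; apply: nK; exists k%:R => x xC i.
  by rewrite leNgt; apply/negP => Gi; apply: nx; exists x; split => //; exists i.
pose x k := sval (ex k).
have xC k i : `|x k i ord0| <= C by rewrite /x; case: (ex k) => ? /= [].
have [kap [l [kincr xl]]] := @common_subsequence R 'I_p
  (fun k i => x k i ord0) (fun=> C) xC.
have xlm : mx_cvg (x \o kap) (\col_i l i).
  by move=> i j; rewrite ord1 mxE; exact: xl.
have Gl := cG _ _ xlm.
have bd : \forall j \near \oo, forall i, `|G (x (kap j)) i ord0| <
    \sum_i `|G (\col_i l i) i ord0| + 1.
  suff h : \forall j \near \oo, forall i, i \in enum 'I_q ->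
      `|G (x (kap j)) i ord0| < \sum_i `|G (\col_i l i) i ord0| + 1.
    by apply: filterS h => j h i; apply: h; rewrite mem_enum.
  elim: (enum 'I_q) => [|a s IH]; first exact: nearW.
  have al : `|G (\col_i0 l i0) a ord0| < \sum_i `|G (\col_i0 l i0) i ord0| + 1.
    apply: le_lt_trans (_ : \sum_i `|G (\col_i0 l i0) i ord0| < _).
      by rewrite (bigD1 a) //= lerDl; apply: sumr_ge0.
    by rewrite ltrDl.
  have Ga : \forall j \near \oo, `|G (x (kap j)) a ord0| <
      \sum_i `|G (\col_i l i) i ord0| + 1.
    exact: (cvgr_lt _ (cvg_norm (Gl a ord0)) _ al).
  apply: filterS2 IH Ga => j IH Ga i.
  by rewrite inE => /predU1P[->|/IH].
have [j0 _ hj] := bd.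
have [m mb] : exists m : nat, \sum_i `|G (\col_i l i) i ord0| + 1 < m%:R.
  by exists (Num.truncn (\sum_i `|G (\col_i l i) i ord0| + 1)).+1; exact: truncnS_gt.
have [i Gi] : exists i, (kap (maxn j0 m))%:R < `|G (x (kap (maxn j0 m))) i ord0|.
  by rewrite /x; case: (ex _) => ? /= [].
have := hj _ (leq_maxl j0 m) i => /(lt_trans Gi) /lt_trans /(_ mb).
rewrite ltr_nat ltnNge (leq_trans (leq_maxr j0 m)) //.
exact: leq_incr_seq.
Qed.

End EntrywiseLimits.

(** * Networks: joint continuity in parameters and input, uniform bounds *)

Section NetworkLimits.
Variables (R : realType) (sigma : R -> R) (N : nat -> nat) (L : nat).
Hypothesis sigma_cont : continuous sigma.

Lemma layers_cvg (Wk : nat -> weights R N) (bk : nat -> biases R N) W b (x : nat -> 'cV[R]_(N 0)) l :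
  (forall k, (k < L)%N -> mx_cvg (fun j => Wk j k) (W k)) ->
  (forall k, (k < L)%N -> mx_cvg (fun j => bk j k) (b k)) ->
  mx_cvg x l -> forall k, (k <= L)%N ->
  mx_cvg (fun j => layers sigma L (Wk j) (bk j) k (x j))
         (layers sigma L W b k l).
Proof.
move=> hW hb xl; elim=> [//|k IH] kL /=.
have hz : mx_cvg
    (fun j => Wk j k *m layers sigma L (Wk j) (bk j) k (x j) + bk j k)
    (W k *m layers sigma L W b k l + b k).
  by apply: mx_cvgD; [apply: mx_cvgM; [exact: hW|exact: IH (ltnW kL)]|exact: hb].
by case: ifP => _ //; exact: mx_cvg_map.
Qed.

Lemma Fnet_cvg (Wk : nat -> weights R N) (bk : nat -> biases R N) W b (x : nat -> 'cV[R]_(N 0)) l :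
  (forall k, (k < L)%N -> mx_cvg (fun j => Wk j k) (W k)) ->
  (forall k, (k < L)%N -> mx_cvg (fun j => bk j k) (b k)) ->
  mx_cvg x l ->
  mx_cvg (fun j => Fnet sigma L (Wk j) (bk j) (x j)) (Fnet sigma L W b l).
Proof.
move=> hW hb xl; apply: mx_cvgB; first exact: layers_cvg.
by apply: layers_cvg => //; exact: mx_cvg_cst.
Qed.

Lemma Fnet_seq_cont W b : seq_cont (Fnet (N := N) sigma L W b).
Proof.
move=> x l xl; apply: (@Fnet_cvg (fun=> W) (fun=> b)) => // k _;
exact: mx_cvg_cst.
Qed.

Lemma Fnet0 W b : Fnet (N := N) sigma L W b 0 = 0.
Proof. by rewrite /Fnet subrr. Qed.

(** The bound is uniform in the parameters: [Z] bounds the preactivation, and [sigma], being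
    continuous, is bounded on [[-Z, Z]]. *)
Lemma layers_bounded (C : R) k : (k <= L)%N -> exists K : R,
  forall (W : weights R N) (b : biases R N) (x : 'cV[R]_(N 0)),
    (forall j, (j < L)%N -> forall a c, `|W j a c| <= C) ->
    (forall j, (j < L)%N -> forall a, `|b j a ord0| <= C) ->
    (forall a, `|x a ord0| <= C) ->
    forall a, `|layers sigma L W b k x a ord0| <= K.
Proof.
elim: k => [|k IH] kL; first by exists C.
have [K hK] := IH (ltnW kL).
pose Z := C * K *+ N k + C.
have [K' hK'] := @seq_cont_bounded R (N k.+1) (N k.+1) (fun z => map_mx sigma z) Z
  (fun x l => mx_cvg_map sigma_cont (l:=l)).
exists (if (k.+1 < L)%N then K' else Z) => W b x hW hb hx.
have hz a : `|(W k *m layers sigma L W b k x + b k) a ord0| <= Z.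
  rewrite !mxE; apply: le_trans (ler_normD _ _) _; apply: lerD; last exact: hb.
  apply: le_trans (ler_norm_sum _ _ _) _.
  rewrite -[X in _ *+ X]card_ord -sumr_const; apply: ler_sum => c _.
  by rewrite normrM ler_pM //; [exact: hW|exact: hK].
by move=> a /=; case: ifP => _; [exact: hK'|exact: hz].
Qed.

Lemma Fnet_bounded (C : R) : 0 <= C -> exists K : R,
  forall (W : weights R N) (b : biases R N) (x : 'cV[R]_(N 0)),
    (forall j, (j < L)%N -> forall a c, `|W j a c| <= C) ->
    (forall j, (j < L)%N -> forall a, `|b j a ord0| <= C) ->
    (forall a, `|x a ord0| <= C) ->
    forall a, `|Fnet sigma L W b x a ord0| <= K.
Proof.
move=> C0; have [K hK] := layers_bounded C (leqnn L).
exists (K + K) => W b x hW hb hx a; rewrite !mxE.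
apply: le_trans (ler_normB _ _) _; apply: lerD; apply: hK => // c.
by rewrite mxE normr0.
Qed.

End NetworkLimits.

(** * The space W *)

Section WSpace.
Variable R : realType.
Local Notation leb := (@lebesgue_measure R).
Local Notation I0 := (@Iset R).

Lemma IsetE : I0 = `[0, +oo[%classic.
Proof. by apply/seteqP; split => t /=; rewrite in_itv /= andbT. Qed.

Lemma Iset_measurable : measurable I0.
Proof. by rewrite IsetE; exact: measurable_itv. Qed.
Hint Resolve Iset_measurable : core.

Lemma Iset_bigcup : I0 = \bigcup_k `[0, k%:R]%classic.
Proof.
apply/seteqP; split => t /=.
  move=> t0; exists (Num.truncn t).+1 => //=.
  by rewrite in_itv /= t0 ltW // truncnS_gt.
by move=> [k _] /=; rewrite in_itv /= => /andP[].
Qed.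

Lemma itv0_Iset (t : R) : `[0, t]%classic `<=` I0.
Proof. by move=> s /=; rewrite in_itv /= => /andP[]. Qed.

Lemma measurable_fun_Iset (g : R -> R) :
  (forall t : R, 0 <= t -> leb.-integrable `[0, t] (EFin \o g)) -> measurable_fun I0 g.
Proof.
move=> ig; rewrite Iset_bigcup; apply/measurable_fun_bigcup => k.
  exact: measurable_itv.
by apply/measurable_EFinP; exact: (measurable_int _ (ig k%:R (ler0n _ k))).
Qed.

(** By the fundamental theorem of calculus the derivative of the primitive is [g] almost everywhere,
    and it is [0]. As [g] is only locally integrable, this is done on each [[0, k]]; the time [0] is
    discarded as a null set. *)
Lemma zero_primitive_ae (g : R -> R) :
  (forall t : R, 0 <= t -> leb.-integrable `[0, t] (EFin \o g)) ->
  (forall t : R, 0 <= t -> \int[leb]_(s in `[0, t]) g s = 0) ->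
  {ae leb, forall t : R, I0 t -> g t = 0}.
Proof.
move=> ig g0.
have bounded_ae (k : nat) : {ae leb, forall t : R, 0 < t < k%:R -> g t = 0}.
  pose gk := g \_ `[0, k%:R]%classic.
  have iT : leb.-integrable setT (EFin \o gk).
    rewrite /gk -restrict_EFin; apply/(integrable_mkcond _ _).1 => //.
    exact: ig.
  have igk (y : R) : leb.-integrable [set` Interval (BLeft 0) (BRight y)] (EFin \o gk).
    by apply: integrableS iT.
  have := FTC1 igk (integrable_locally (@measurable_itv R `[0, k%:R]) (ig _ (ler0n _ k))).
  move=> h; apply: (ae_imp h) => t {}h /andP[t0 tk].
  have -> : g t = gk t by rewrite /gk patchE mem_set //= in_itv /= !ltW.
  have [|_ <-] := h; first by rewrite lte_fin.
  have E : \forall x \near (t : R), \int[leb]_(s in `[0, x]) gk s = cst (0 : R) x.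
    have tI : t \in `]0, k%:R[ by rewrite in_itv /= t0.
    apply: filterS (near_in_itvoo tI) => x; rewrite in_itv /= => /andP[x0 xk].
    apply: etrans (g0 x (ltW x0)); apply: eq_Rintegral => s.
    rewrite inE /= in_itv /= => /andP[s0 sx].
    by rewrite /gk patchE mem_set //= in_itv /= s0 (le_trans sx) // ltW.
  by rewrite derive1E (near_eq_derive _ E) -derive1E derive1_cst.
have all_ae : {ae leb, forall t : R, forall k : nat, 0 < t < k%:R -> g t = 0}.
  exact: ae_foralln.
have z_ae : {ae leb, forall t : R, t != 0}.
  exists [set 0]; split => //; first exact: lebesgue_measure_set1.
  by move=> t /= /negP; rewrite negbK => /eqP.
apply: (ae_imp2 all_ae z_ae) => t h t0 It.
apply: (h (Num.truncn t).+1); rewrite lt_neqAle eq_sym t0 It /=.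
exact: truncnS_gt.
Qed.

Lemma integrable_subr (D : set R) (f g : R -> R) : measurable D ->
  leb.-integrable D (EFin \o f) -> leb.-integrable D (EFin \o g) ->
  leb.-integrable D (EFin \o (fun t => f t - g t)).
Proof.
move=> mD fi gi; rewrite (_ : _ \o _ = (EFin \o f) \- (EFin \o g))%E.
  exact: integrableB.
by apply/funext => t /=; rewrite EFinB.
Qed.

Lemma is_derivI_integrable k (y g : R -> 'cV[R]_k) : is_derivI y g ->
  forall (t : R) i, 0 <= t -> leb.-integrable `[0, t] (EFin \o (fun s => g s i ord0)).
Proof. by move=> h t i t0; have [] := h t t0 i. Qed.

Lemma is_derivIE k (y g : R -> 'cV[R]_k) : is_derivI y g ->
  forall (t : R) i, 0 <= t ->
    y t i ord0 = y 0 i ord0 + \int[leb]_(s in `[0, t]) g s i ord0.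
Proof. by move=> h t i t0; have [] := h t t0 i. Qed.

Lemma is_derivI_measurable k (y g : R -> 'cV[R]_k) i : is_derivI y g ->
  measurable_fun I0 (fun s => g s i ord0).
Proof.
by move=> h; apply: measurable_fun_Iset => t t0; exact: (is_derivI_integrable h).
Qed.

(** Uniqueness of the weak derivative, which makes the choice in [Wdot] harmless: any derivative at
    hand may take its place. *)
Lemma is_derivI_ae k (y g1 g2 : R -> 'cV[R]_k) :
  is_derivI y g1 -> is_derivI y g2 ->
  {ae leb, forall t, I0 t -> g1 t = g2 t}.
Proof.
move=> h1 h2.
have hi (i : 'I_k) : {ae leb, forall t, I0 t -> g1 t i ord0 - g2 t i ord0 = 0}.
  apply: zero_primitive_ae => t t0.
    by apply: integrable_subr => //; [exact: (is_derivI_integrable h1)|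
                                      exact: (is_derivI_integrable h2)].
  rewrite RintegralB //; [|exact: (is_derivI_integrable h1)|
                           exact: (is_derivI_integrable h2)].
  by apply/eqP; rewrite subr_eq0; apply/eqP/(addrI (y 0 i ord0));
     rewrite -!is_derivIE.
apply: (ae_imp (ae_forall_countable hi)) => t h It; apply/matrixP => i j.
by rewrite ord1; apply/eqP; rewrite -subr_eq0; apply/eqP; exact: h.
Qed.

Lemma WdotP k (y : R -> 'cV[R]_k) : inW y -> is_derivI y (Wdot y) /\ L2vec (Wdot y).
Proof.
move=> [_ e]; rewrite /Wdot; case: pselect => // e'.
by case: (cid e').
Qed.

Lemma is_derivI_sub k (y g z h : R -> 'cV[R]_k) : is_derivI y g -> is_derivI z h ->
  is_derivI (fsub y z) (fsub g h).
Proof.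
move=> yg zh t t0 i.
have ig := is_derivI_integrable yg i t0; have ih := is_derivI_integrable zh i t0.
have E : (fun s => (fsub g h s i ord0)%:E) =
    EFin \o (fun s => g s i ord0 - h s i ord0).
  by apply/funext => s; rewrite /fsub /= !mxE.
split; first by rewrite E; exact: integrable_subr.
rewrite /fsub !mxE (is_derivIE yg) // (is_derivIE zh) //.
rewrite (_ : fine _ = \int[leb]_(s in `[0, t]) g s i ord0 -
    \int[leb]_(s in `[0, t]) h s i ord0); first by ring.
rewrite -RintegralB //; apply: eq_Rintegral => s _; by rewrite !mxE.
Qed.

Lemma is_derivI_scale k (a : R) (y g : R -> 'cV[R]_k) : is_derivI y g ->
  is_derivI (fun t => a *: y t) (fun t => a *: g t).
Proof.
move=> yg t t0 i; have ig := is_derivI_integrable yg i t0; split.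
  rewrite (_ : (fun s => _) = (fun s => a%:E * (g s i ord0)%:E)%E).
    exact: integrableZl.
  by apply/funext => s; rewrite mxE.
rewrite !mxE (is_derivIE yg) // mulrDr; congr (_ + _).
by rewrite -RintegralZl //; apply: eq_Rintegral => s _; rewrite mxE.
Qed.

(** The squared norm of W as an extended real, with an arbitrary derivative [g]: it makes sense
    before membership in W is known, and Fatou's lemma applies to it. *)
Definition Wint k (y g : R -> 'cV[R]_k) : \bar R :=
  (\int[leb]_(t in I0) (enorm2 (y t) + enorm2 (g t))%:E)%E.

Lemma measurable_enorm2 k (y : R -> 'cV[R]_k) (D : set R) :
  (forall i, measurable_fun D (fun t => y t i ord0)) ->
  measurable_fun D (fun t => enorm2 (y t)).
Proof. by move=> my; apply: measurable_sum => i; exact: measurable_funX. Qed.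

Lemma L2vec_int k (y : R -> 'cV[R]_k) : L2vec y ->
  (\int[leb]_(t in I0) (enorm2 (y t))%:E < +oo)%E.
Proof.
move=> hy.
rewrite (_ : (\int[leb]_(t in I0) (enorm2 (y t))%:E)%E =
  (\sum_(i < k) \int[leb]_(t in I0) (y t i ord0 ^+ 2)%:E)%E).
  apply: lte_sum_pinfty => i _; exact: (hy i).2.
rewrite -ge0_integral_sum //.
- by apply: eq_integral => t _; rewrite -sumEFin.
- move=> i; apply/measurable_EFinP/measurable_funX; exact: (hy i).1.
- by move=> i t _; rewrite lee_fin sqr_ge0.
Qed.

Lemma Wint_split k (y g : R -> 'cV[R]_k) :
  (forall i, measurable_fun I0 (fun t => y t i ord0)) ->
  (forall i, measurable_fun I0 (fun t => g t i ord0)) ->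
  Wint y g = (\int[leb]_(t in I0) (enorm2 (y t))%:E +
              \int[leb]_(t in I0) (enorm2 (g t))%:E)%E.
Proof.
move=> my mg; rewrite -ge0_integralD //.
- by move=> t _; rewrite lee_fin enorm2_ge0.
- by apply/measurable_EFinP; exact: measurable_enorm2.
- by move=> t _; rewrite lee_fin enorm2_ge0.
- by apply/measurable_EFinP; exact: measurable_enorm2.
Qed.

(** Membership in W makes the integrals finite, so that [fine] loses nothing, and uniqueness almost
    everywhere replaces [Wdot y] by [g]. *)
Lemma Wnorm_sqr k (y g : R -> 'cV[R]_k) : inW y -> is_derivI y g ->
  (Wnorm y ^+ 2)%:E = Wint y g.
Proof.
move=> Wy yg; have [yd dL] := WdotP Wy; have yL := Wy.1.
have fy : (\int[leb]_(t in I0) (enorm2 (y t))%:E)%E \is a fin_num.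
  rewrite ge0_fin_numE ?L2vec_int //.
  by apply: integral_ge0 => t _; rewrite lee_fin enorm2_ge0.
have fd : (\int[leb]_(t in I0) (enorm2 (Wdot y t))%:E)%E \is a fin_num.
  rewrite ge0_fin_numE ?L2vec_int //.
  by apply: integral_ge0 => t _; rewrite lee_fin enorm2_ge0.
rewrite Wint_split; first last.
- by move=> i; exact: is_derivI_measurable yg.
- by move=> i; exact: (yL i).1.
rewrite /Wnorm sqr_sqrtr; last first.
  by rewrite addr_ge0 //; apply: fine_ge0; apply: integral_ge0 => t _;
    rewrite lee_fin enorm2_ge0.
rewrite EFinD /l2sq !fineK //; congr (_ + _)%E.
apply: ae_eq_integral => //.
- by apply/measurable_EFinP; apply: measurable_enorm2 => i; exact: (dL i).1.
- by apply/measurable_EFinP; apply: measurable_enorm2 => i; exact: is_derivI_measurable yg.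
- by apply: (ae_imp (is_derivI_ae yd yg)) => t h It; rewrite h.
Qed.

Lemma inW_Wint k (y g : R -> 'cV[R]_k) :
  (forall i, measurable_fun I0 (fun t => y t i ord0)) -> is_derivI y g ->
  (Wint y g < +oo)%E -> inW y.
Proof.
move=> my yg fin.
have mg i : measurable_fun I0 (fun t => g t i ord0) by exact: is_derivI_measurable yg.
split; last exists g; first last.
  split => // i; split => //; apply: le_lt_trans fin.
  apply: ge0_le_lower_integral => t _; rewrite lee_fin ?sqr_ge0 //.
  by apply: le_trans (sqr_entry_le_enorm2 _ i) _; rewrite lerDr enorm2_ge0.
move=> i; split => //; apply: le_lt_trans fin.
apply: ge0_le_lower_integral => t _; rewrite lee_fin ?sqr_ge0 //.
by apply: le_trans (sqr_entry_le_enorm2 _ i) _; rewrite lerDl enorm2_ge0.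
Qed.

End WSpace.
#[global] Hint Extern 0 (measurable (@Iset _)) => solve [exact: Iset_measurable] : core.

(** * Limits in W *)

Section LimitInferior.
Variable R : realType.
Local Open Scope ereal_scope.

Lemma limn_einf_sup_einfs (u : nat -> \bar R) :
  limn_einf u = ereal_sup (range (einfs u)).
Proof. by rewrite limn_einf_lim; apply/cvg_lim => //; exact: cvg_einfs_sup. Qed.

Lemma limn_einf_gt (u : nat -> \bar R) (a : \bar R) : a < limn_einf u ->
  exists m, forall k, (m <= k)%N -> a < u k.
Proof.
rewrite limn_einf_sup_einfs => /ereal_sup_gt[_ [m _ <-] am]; exists m => k mk.
by apply: lt_le_trans am _; apply: ereal_inf_lbound; exists k.
Qed.

End LimitInferior.

Section WSpaceLimits.
Variable R : realType.
Local Notation leb := (@lebesgue_measure R).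
Local Notation I0 := (@Iset R).

(** Young's inequality, from the square [(2 eps |x| - 1)^2]. With [eps] free it does the work of the
    Cauchy-Schwarz inequality. *)
Lemma norm_le_eps_sqr (x eps : R) : 0 < eps -> `|x| <= eps * x ^+ 2 + (4 * eps)^-1.
Proof.
move=> e0; have e4 : 0 < 4 * eps by rewrite mulr_gt0.
rewrite -subr_ge0 -[x ^+ 2]real_normK ?num_real //.
have -> : eps * `|x| ^+ 2 + (4 * eps)^-1 - `|x| =
    (4 * eps)^-1 * (2 * eps * `|x| - 1) ^+ 2 by field; lra.
by rewrite mulr_ge0 ?sqr_ge0 // invr_ge0 ltW.
Qed.

Lemma integral_norm_amgm (g : R -> R) (D : set R) (eps : R) : 0 < eps ->
  measurable D -> D `<=` I0 -> measurable_fun I0 g ->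
  (\int[leb]_(t in D) `|g t|%:E <=
   eps%:E * \int[leb]_(t in I0) (g t ^+ 2)%:E + (4 * eps)^-1%:E * leb D)%E.
Proof.
move=> e0 mD DI mg.
have mg2 : measurable_fun I0 (fun t => (g t ^+ 2)%:E).
  exact/measurable_EFinP/measurable_funX.
have mgD2 : measurable_fun D (fun t => (g t ^+ 2)%:E) by exact: (measurable_funS (@Iset_measurable R) DI mg2).
apply: (@le_trans _ _
  (\int[leb]_(t in D) (eps%:E * (g t ^+ 2)%:E + (4 * eps)^-1%:E))%E).
  apply: ge0_le_lower_integral => t _; first by rewrite lee_fin.
  by rewrite -EFinM -EFinD lee_fin norm_le_eps_sqr.
rewrite ge0_integralD //.
- rewrite ge0_integralZl_EFin //; [|by move=> t _; rewrite lee_fin sqr_ge0|exact: ltW].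
  rewrite (integral_cst leb mD) leeD2r // lee_pmul2l ?lte_fin //.
  by apply: (ge0_subset_integral leb mD (@Iset_measurable R) mg2) => // t _; rewrite lee_fin sqr_ge0.
- by move=> t _; rewrite mule_ge0 // lee_fin ?sqr_ge0 // ltW.
- exact: measurable_funeM.
- by move=> t _; rewrite lee_fin invr_ge0 mulr_ge0 // ltW.
Qed.

Lemma is_derivI_increment k (y g : R -> 'cV[R]_k) i (s t : R) : is_derivI y g ->
  0 <= s -> s <= t ->
  (`|y t i ord0 - y s i ord0|%:E <= \int[leb]_(r in `]s, t]) `|g r i ord0|%:E)%E.
Proof.
move=> yg s0 st; have t0 := le_trans s0 st.
have it := is_derivI_integrable yg i t0.
have ist : leb.-integrable `]s, t] (EFin \o (fun r => g r i ord0)).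
  apply: integrableS it => //; apply: subset_itvr; by rewrite bnd_simp.
rewrite (is_derivIE yg) // [X in _ - X](is_derivIE yg) //.
rewrite opprD addrACA subrr add0r Rintegral_itvB ?bnd_simp //.
rewrite EFin_normr_Rintegral //.
apply: le_abse_integral => //; exact: (measurable_int _ ist).
Qed.

Lemma leb_itvoc (s t : R) : s <= t -> leb `]s, t]%classic = (t - s)%:E.
Proof.
move=> st; rewrite lebesgue_measure_itv /= lte_fin; case: ltP => // ts.
by rewrite (_ : t = s) ?subrr //; apply/eqP; rewrite eq_le st ts.
Qed.

Lemma is_derivI_lipschitz k (y g : R -> 'cV[R]_k) i (K : R) : is_derivI y g ->
  (forall t, 0 <= t -> `|g t i ord0| <= K) ->
  forall s t, 0 <= s -> 0 <= t -> `|y t i ord0 - y s i ord0| <= K * `|t - s|.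
Proof.
move=> yg gK.
have le_case s t : 0 <= s -> s <= t -> `|y t i ord0 - y s i ord0| <= K * `|t - s|.
  move=> s0 st; rewrite -lee_fin; apply: le_trans (is_derivI_increment i yg s0 st) _.
  apply: (@le_trans _ _ (\int[leb]_(r in `]s, t]) cst K%:E r)%E).
    apply: ge0_le_lower_integral => r; first by rewrite lee_fin.
    rewrite /= in_itv /= => /andP[sr _]; rewrite lee_fin; apply: gK.
    exact: le_trans s0 (ltW sr).
  by rewrite integral_cst //= leb_itvoc // ger0_norm ?subr_ge0 // EFinM.
move=> s t s0 t0; have [st|ts] := leP s t; first exact: le_case.
by rewrite distrC (distrC t s); apply: le_case => //; exact: ltW.
Qed.

(** A modulus of continuity common to a ball of W: [eps] makes the first term small, then the
    distance of the times makes the second small. *)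
Lemma inW_modulus k (y g : R -> 'cV[R]_k) i (eps : R) : inW y -> is_derivI y g ->
  0 < eps -> forall s t, 0 <= s -> 0 <= t ->
  `|y t i ord0 - y s i ord0| <= eps * Wnorm y ^+ 2 + (4 * eps)^-1 * `|t - s|.
Proof.
move=> Wy yg e0.
have le_case s t : 0 <= s -> s <= t ->
    `|y t i ord0 - y s i ord0| <= eps * Wnorm y ^+ 2 + (4 * eps)^-1 * `|t - s|.
  move=> s0 st; rewrite -lee_fin; apply: le_trans (is_derivI_increment i yg s0 st) _.
  have mg : measurable_fun I0 (fun t => g t i ord0) by exact: is_derivI_measurable yg.
  apply: le_trans (integral_norm_amgm (g := fun t => g t i ord0) e0 _ _ mg) _ => //.
    by move=> r /=; rewrite in_itv /= => /andP[sr _]; exact: le_trans s0 (ltW sr).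
  rewrite /= leb_itvoc // ger0_norm ?subr_ge0 // [leRHS]EFinD [X in (_ <= X + _)%E]EFinM [X in (_ <= _ + X)%E]EFinM leeD2r // lee_pmul2l ?lte_fin //.
  rewrite (Wnorm_sqr Wy yg).
  apply: ge0_le_lower_integral => r _; rewrite lee_fin ?sqr_ge0 //.
  by apply: le_trans (sqr_entry_le_enorm2 _ i) _; rewrite lerDr enorm2_ge0.
move=> s t s0 t0; have [st|ts] := leP s t; first exact: le_case.
by rewrite distrC (distrC t s); apply: le_case => //; exact: ltW.
Qed.

Definition seq_contI (h : R -> R) := forall (t : R) (s : nat -> R), 0 <= t ->
  (forall k, 0 <= s k) -> s @ \oo --> t -> (fun k => h (s k)) @ \oo --> h t.

Lemma inW_seq_cont k (y : R -> 'cV[R]_k) (t : R) (s : nat -> R) : inW y ->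
  0 <= t -> (forall j, 0 <= s j) -> s @ \oo --> t -> mx_cvg (y \o s) (y t).
Proof.
move=> Wy t0 s0 st i j; rewrite ord1 {j}.
have [yd _] := WdotP Wy.
apply/cvgrPdist_le => e e0.
(* Makes the norm term at most [e / 2]; the added [1] covers the case of norm zero. *)
pose eps := e / (2 * (Wnorm y ^+ 2 + 1)).
have W0 : 0 < Wnorm y ^+ 2 + 1 by rewrite ltr_wpDl // sqr_ge0.
have eps0 : 0 < eps by rewrite divr_gt0 // mulr_gt0.
have d0 : 0 < 4 * eps * (e / 2) by rewrite mulr_gt0 // ?divr_gt0 // mulr_gt0.
have near_t : \forall j \near \oo, `|t - s j| <= 4 * eps * (e / 2).
  by move/cvgrPdist_le : st; apply.
apply: filterS near_t => j hj /=.
apply: le_trans (inW_modulus i Wy yd eps0 (s0 j) t0) _.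
rewrite [leRHS](_ : e = e / 2 + e / 2); last by field.
apply: lerD.
  rewrite /eps mulrAC ler_pdivrMr ?mulr_gt0 //.
  rewrite [leRHS](_ : _ = e * (Wnorm y ^+ 2 + 1)); last by field.
  by rewrite ler_pM2l // lerDl.
by rewrite ler_pdivrMl //; exact: mulr_gt0.
Qed.

Lemma seq_contI_comp p q (y : R -> 'cV[R]_p) (G : 'cV[R]_p -> 'cV[R]_q) i :
  inW y -> seq_cont G -> seq_contI (fun t => G (y t) i ord0).
Proof.
by move=> Wy cG t s t0 s0 st; exact: (cG _ _ (inW_seq_cont Wy t0 s0 st) i ord0).
Qed.

(** The Caratheodory lemma with a parameter that [h] ignores. *)
Lemma seq_contI_measurable (h : R -> R) : seq_contI h -> measurable_fun I0 h.
Proof.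
move=> ch.
have m := @caratheodory_measurable _ R R (fun _ => h) (fun t _ => measurable_cst _)
  (fun _ => ch).
have m1 : measurable_fun setT (fun t : R => h (Num.max t 0)).
  exact: (measurableT_comp m (@measurable_pair1 _ _ R R 0)).
apply: (@eq_measurable_fun _ _ _ _ I0 (fun t : R => h (Num.max t 0))).
  by move=> t; rewrite inE => t0; rewrite (max_idPl t0).
exact: measurable_funTS.
Qed.

(** Dominated convergence on each [[0, t]], with the constant [K] as majorant, passes to the limit
    in the integral equation. *)
Lemma is_derivI_limit k (y_ g_ : nat -> R -> 'cV[R]_k) y g (K : R) :
  (forall j, is_derivI (y_ j) (g_ j)) ->
  (forall j t i, 0 <= t -> `|g_ j t i ord0| <= K) ->
  (forall t : R, 0 <= t -> mx_cvg (y_ ^~ t) (y t)) ->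
  (forall t : R, 0 <= t -> mx_cvg (g_ ^~ t) (g t)) -> is_derivI y g.
Proof.
move=> yg gK yl gl t t0 i.
have sub := @itv0_Iset R t.
have mg_ j : measurable_fun `[0, t]%classic (EFin \o (fun s => g_ j s i ord0)).
  exact: (measurable_int _ (is_derivI_integrable (yg j) i t0)).
have cv s : `[0, t]%classic s ->
    (fun j => (EFin \o (fun s => g_ j s i ord0)) s) @ \oo --> (g s i ord0)%:E.
  by move=> /sub s0; apply: cvg_EFin; [exact: nearW|exact: gl].
have mg : measurable_fun `[0, t]%classic (EFin \o (fun s => g s i ord0)).
  exact: emeasurable_fun_cvg mg_ cv.
have iK : leb.-integrable `[0, t] (cst K%:E).
  apply/integrableP; split => //=; rewrite integral_cst //.
  rewrite lte_mul_pinfty // ?lee_fin //.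
  by rewrite /= lebesgue_measure_itv /=; case: ifP => _ //; rewrite ltry.
have [||| ig _ cI] := @dominated_convergence _ _ R leb _ (@measurable_itv R `[0, t])
  (fun j => EFin \o (fun s => g_ j s i ord0)) (EFin \o (fun s => g s i ord0))
  (cst K%:E) mg_ mg.
- by apply: aeW => s; exact: cv.
- exact: iK.
- by apply: aeW => s j /sub s0; rewrite lee_fin; exact: gK.
split => //.
have fI : (\int[leb]_(s in `[0%R, t]) (g s i ord0)%:E)%E \is a fin_num.
  exact: integrable_fin_num.
have c1 : (fun j => y_ j 0 i ord0 + \int[leb]_(s in `[0, t]) g_ j s i ord0) @ \oo -->
    y 0 i ord0 + \int[leb]_(s in `[0, t]) g s i ord0.
  apply: cvgD; first exact: yl.
  by apply: fine_cvg; rewrite /Rintegral fineK.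
have E : (fun j => y_ j 0 i ord0 + \int[leb]_(s in `[0, t]) g_ j s i ord0) =
    (fun j => y_ j t i ord0) by apply/funext => j; rewrite -(is_derivIE (yg j)).
rewrite E in c1; exact: (@cvg_unique _ (@Rhausdorff R) _ _ _ _ (yl t t0 i ord0) c1).
Qed.

Section Limits.
Variables (k : nat) (y_ g_ : nat -> R -> 'cV[R]_k) (y g : R -> 'cV[R]_k).
Hypothesis Wy_ : forall j, inW (y_ j).
Hypothesis yg_ : forall j, is_derivI (y_ j) (g_ j).
Hypothesis yl : forall t : R, 0 <= t -> mx_cvg (y_ ^~ t) (y t).
Hypothesis gl : forall t : R, 0 <= t -> mx_cvg (g_ ^~ t) (g t).

Let energy (a b : R -> 'cV[R]_k) t := enorm2 (a t) + enorm2 (b t).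

Let menergy a b : inW a -> is_derivI a b -> measurable_fun I0 (energy a b).
Proof.
move=> Wa ab; apply: measurable_funD; apply: measurable_enorm2 => i.
  exact: (Wa.1 i).1.
exact: is_derivI_measurable ab.
Qed.

Lemma Wint_fatou : (Wint y g <= limn_einf (fun j => Wint (y_ j) (g_ j)))%E.
Proof.
apply: fatou_cvg => //.
- by move=> j; apply/measurable_EFinP; exact: menergy.
- by move=> j t _; rewrite lee_fin addr_ge0 // enorm2_ge0.
- move=> t t0; apply: cvg_EFin; first exact: nearW.
  by apply: cvgD; apply: cvg_enorm2; [exact: yl|exact: gl].
Qed.

Hypothesis Wy : inW y.
Hypothesis yg : is_derivI y g.
Hypothesis Wl : (fun j => Wnorm (y_ j)) @ \oo --> Wnorm y.

(* Radon-Riesz: convergence of the norms upgrades pointwise convergence to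
   norm convergence, by Fatou's lemma applied to [2|a_j|^2 + 2|a|^2 - |a_j -
   a|^2 >= 0]. *)
Lemma Wnorm_sub_cvg : (fun j => Wnorm (fsub (y_ j) y)) @ \oo --> (0 : R).
Proof.
pose d_ j := energy (fsub (y_ j) y) (fsub (g_ j) g).
pose w_ j t := 2 * energy (y_ j) (g_ j) t + 2 * energy y g t - d_ j t.
have Wd j : inW (fsub (y_ j) y).
  apply: (@inW_Wint _ _ _ (fsub (g_ j) g)).
  - move=> i; rewrite (_ : (fun t => _) = (fun t => y_ j t i ord0 - y t i ord0)).
      by apply: measurable_funB; [exact: ((Wy_ j).1 i).1|exact: (Wy.1 i).1].
    by apply/funext => t; rewrite /fsub !mxE.
  - exact: is_derivI_sub.
  - apply: (@le_lt_trans _ _ (\int[leb]_(t in I0)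
        (2%:E * (energy (y_ j) (g_ j) t)%:E + 2%:E * (energy y g t)%:E))%E).
      apply: ge0_le_lower_integral => t _.
        by rewrite lee_fin addr_ge0 // enorm2_ge0.
      rewrite -!EFinM -EFinD lee_fin /energy /fsub.
      have := enorm2_le_parallelogram (y_ j t) (y t).
      have := enorm2_le_parallelogram (g_ j t) (g t); lra.
    have e0 a b t : (0 <= (energy a b t)%:E)%E.
      by rewrite lee_fin addr_ge0 // enorm2_ge0.
    have mE a b : inW a -> is_derivI a b -> measurable_fun I0 (fun t => (energy a b t)%:E).
      by move=> Wa ab; apply/measurable_EFinP; exact: menergy.
    rewrite ge0_integralD //; first last.
    + by apply: measurable_funeM; exact: mE.
    + by move=> t _; rewrite mule_ge0.
    + by apply: measurable_funeM; exact: mE.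
    + by move=> t _; rewrite mule_ge0.
    rewrite !ge0_integralZl_EFin //; [|exact: mE|exact: mE].
    rewrite -!/(Wint _ _) -(Wnorm_sqr (Wy_ j) (yg_ j)) -(Wnorm_sqr Wy yg).
    by rewrite -!EFinM -EFinD ltry.
have w0 j t : 0 <= w_ j t.
  rewrite /w_ /d_ /energy /fsub subr_ge0.
  have := enorm2_le_parallelogram (y_ j t) (y t).
  have := enorm2_le_parallelogram (g_ j t) (g t); lra.
have dI j : is_derivI (fsub (y_ j) y) (fsub (g_ j) g) by exact: is_derivI_sub.
have mw j : measurable_fun I0 (w_ j).
  apply: measurable_funB; last exact: menergy.
  by apply: measurable_funD; apply: measurable_funM => //; exact: menergy.
have sum_int j : (\int[leb]_(t in I0) (w_ j t)%:E +
    (Wnorm (fsub (y_ j) y) ^+ 2)%:E =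
    (2 * Wnorm (y_ j) ^+ 2 + 2 * Wnorm y ^+ 2)%:E)%E.
  rewrite (Wnorm_sqr (Wd j) (dI j)) EFinD.
  rewrite (EFinM 2 (Wnorm (y_ j) ^+ 2)) (EFinM 2 (Wnorm y ^+ 2)).
  rewrite (Wnorm_sqr (Wy_ j) (yg_ j)) (Wnorm_sqr Wy yg).
  have e0 a b t : (0 <= (energy a b t)%:E)%E.
    by rewrite lee_fin addr_ge0 // enorm2_ge0.
  have mE a b : inW a -> is_derivI a b -> measurable_fun I0 (fun t => (energy a b t)%:E).
    by move=> Wa ab; apply/measurable_EFinP; exact: menergy.
  rewrite -!ge0_integralZl_EFin //; [|by move=> t _; exact: (e0 y g)|exact: (mE y g)
    |by move=> t _; exact: (e0 (y_ j) (g_ j))|exact: (mE (y_ j) (g_ j))].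
  rewrite -!ge0_integralD //; first last.
  - exact: (mE (fsub (y_ j) y) (fsub (g_ j) g)).
  - by move=> t _; exact: (e0 (fsub (y_ j) y) (fsub (g_ j) g)).
  - by apply/measurable_EFinP; exact: mw.
  - by move=> t _; rewrite lee_fin.
  - by apply: measurable_funeM; exact: (mE y g).
  - by move=> t _; rewrite mule_ge0 //; exact: (e0 y g).
  - by apply: measurable_funeM; exact: (mE (y_ j) (g_ j)).
  - by move=> t _; rewrite mule_ge0 //; exact: (e0 (y_ j) (g_ j)).
  apply: eq_integral => t _; rewrite -!EFinM -!EFinD; congr (_%:E).
  by rewrite /w_ /d_ /energy subrK.
(* The subtracted term tends to [0] pointwise, so the limit integrand is four times the energy
   density of [y]. *)
have fat : ((4 * Wnorm y ^+ 2)%:E <= limn_einf (fun j => \int[leb]_(t in I0) (w_ j t)%:E))%E.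
  rewrite EFinM (Wnorm_sqr Wy yg) -ge0_integralZl_EFin //; first last.
  - by apply/measurable_EFinP; exact: menergy.
  - by move=> t _; rewrite lee_fin addr_ge0 // enorm2_ge0.
  apply: fatou_cvg => //.
  - by move=> j; apply/measurable_EFinP; exact: mw.
  - by move=> j t _; rewrite lee_fin.
  - move=> t t0; rewrite -EFinM; apply: cvg_EFin; first exact: nearW.
    rewrite (_ : 4 * _ = 2 * energy y g t + 2 * energy y g t - 0); last by rewrite /energy; ring.
    have en : (fun j => energy (y_ j) (g_ j) t) @ \oo --> energy y g t.
      by apply: cvgD; apply: cvg_enorm2; [exact: yl|exact: gl].
    apply: cvgB; first by apply: cvgD; [apply: cvgMr|exact: cvg_cst].
    have -> : 0 = enorm2 (y t - y t) + enorm2 (g t - g t) :> R.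
      by rewrite !subrr !enorm20 addr0.
    by apply: cvgD; apply: cvg_enorm2; apply: mx_cvgB;
      [exact: yl|exact: mx_cvg_cst|exact: gl|exact: mx_cvg_cst].
have sq : (fun j => Wnorm (fsub (y_ j) y) ^+ 2) @ \oo --> (0 : R).
  apply/cvgrPdist_le => e e0.
  (* A loss of [e / 2] here and of [2 * (e / 4)] in the bound on [Wnorm (y_ j) ^+ 2]; by [sum_int]
     at most [e] is left for the difference. *)
  have lt4 : ((4 * Wnorm y ^+ 2 - e / 2)%:E <
      limn_einf (fun j => \int[leb]_(t in I0) (w_ j t)%:E))%E.
    by apply: lt_le_trans fat; rewrite lte_fin; lra.
  have [m hm] := limn_einf_gt lt4.
  have W2 : (fun j => Wnorm (y_ j) ^+ 2) @ \oo --> Wnorm y ^+ 2.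
    by rewrite expr2; under eq_fun do rewrite expr2; exact: cvgM.
  have e4 : Wnorm y ^+ 2 < Wnorm y ^+ 2 + e / 4 by lra.
  have [m' _ hm'] := cvgr_lt _ W2 _ e4.
  exists (maxn m m') => // j /=; rewrite geq_max => /andP[mj m'j].
  rewrite sub0r normrN ger0_norm ?sqr_ge0 //.
  have := hm' j m'j; have := hm j mj; have := sum_int j => /=.
  case: (\int[leb]_(t in I0) (w_ j t)%:E)%E => [r| |] //=.
  by rewrite -EFinD => -[]; rewrite lte_fin; lra.
rewrite (_ : (fun j => Wnorm _) = (fun j => Num.sqrt (Wnorm (fsub (y_ j) y) ^+ 2))).
  rewrite -[X in _ --> X]sqrtr0.
  exact: (continuous_cvg _ (@sqrt_continuous R _) sq).
by apply/funext => j; rewrite sqrtr_sqr ger0_norm // sqrtr_ge0.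
Qed.

End Limits.

Lemma inW_sub k (y z : R -> 'cV[R]_k) : inW y -> inW z -> inW (fsub y z).
Proof.
move=> Wy Wz; have [yd yL] := WdotP Wy; have [zd zL] := WdotP Wz.
have L2sub (a b : R -> 'cV[R]_k) : L2vec a -> L2vec b -> L2vec (fsub a b).
  move=> La Lb i; have [ma ia] := La i; have [mb ib] := Lb i.
  have E : (fun t => fsub a b t i ord0) = (fun t => a t i ord0 - b t i ord0).
    by apply/funext => t; rewrite /fsub !mxE.
  split; first by rewrite E; exact: measurable_funB.
  apply: (@le_lt_trans _ _ (\int[leb]_(t in I0)
        (2%:E * (a t i ord0 ^+ 2)%:E + 2%:E * (b t i ord0 ^+ 2)%:E))%E).
    apply: ge0_le_lower_integral => t _; first by rewrite lee_fin sqr_ge0.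
    rewrite -!EFinM -EFinD lee_fin /fsub !mxE -subr_ge0.
    rewrite (_ : _ - _ = (a t i ord0 + b t i ord0) ^+ 2); last by ring.
    exact: sqr_ge0.
  have s0 (h : R -> R) t : (0 <= (h t ^+ 2)%:E)%E by rewrite lee_fin sqr_ge0.
  have mE (h : R -> R) : measurable_fun I0 h -> measurable_fun I0 (fun t => (h t ^+ 2)%:E).
    by move=> mh; apply/measurable_EFinP; exact: measurable_funX.
  rewrite ge0_integralD //; first last.
  - by apply: measurable_funeM; exact: (mE _ mb).
  - by move=> t _; rewrite mule_ge0 // lee_fin sqr_ge0.
  - by apply: measurable_funeM; exact: (mE _ ma).
  - by move=> t _; rewrite mule_ge0 // lee_fin sqr_ge0.
  rewrite !ge0_integralZl_EFin //;
    [|by move=> t _; rewrite lee_fin sqr_ge0|exact: (mE _ mb)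
     |by move=> t _; rewrite lee_fin sqr_ge0|exact: (mE _ ma)].
  by rewrite lte_add_pinfty // lte_mul_pinfty // lee_fin.
split; first by apply: L2sub; [exact: Wy.1|exact: Wz.1].
by exists (fsub (Wdot y) (Wdot z)); split; [exact: is_derivI_sub|exact: L2sub].
Qed.

Lemma inW_scale k (a : R) (y : R -> 'cV[R]_k) : inW y -> inW (fun t => a *: y t).
Proof.
move=> Wy; have [yd yL] := WdotP Wy.
have L2scale (b : R -> 'cV[R]_k) : L2vec b -> L2vec (fun t => a *: b t).
  move=> Lb i; have [mb ib] := Lb i; split.
    by under eq_fun do rewrite mxE; exact: measurable_funM.
  under eq_integral do rewrite mxE exprMn EFinM.
  rewrite ge0_integralZl_EFin ?sqr_ge0 //.
  - by rewrite lte_mul_pinfty // lee_fin sqr_ge0.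
  - by move=> t _; rewrite lee_fin sqr_ge0.
  - by apply/measurable_EFinP; exact: measurable_funX.
split; first exact: (L2scale _ Wy.1).
exists (fun t => a *: Wdot y t); split; first exact: is_derivI_scale.
exact: L2scale.
Qed.

Lemma Wnorm_scale k (a : R) (y : R -> 'cV[R]_k) : inW y ->
  Wnorm (fun t => a *: y t) = `|a| * Wnorm y.
Proof.
move=> Wy; have [yd yL] := WdotP Wy.
suff : Wnorm (fun t => a *: y t) ^+ 2 = (`|a| * Wnorm y) ^+ 2.
  move=> /eqP; rewrite eqrXn2 ?mulr_ge0 ?sqrtr_ge0 // => /eqP //.
have e2 (v : 'cV[R]_k) : enorm2 (a *: v) = a ^+ 2 * enorm2 v.
  by rewrite /enorm2 mulr_sumr; apply: eq_bigr => i _; rewrite mxE exprMn.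
apply: EFin_inj.
rewrite (Wnorm_sqr (inW_scale a Wy) (is_derivI_scale a yd)) exprMn real_normK ?num_real //.
rewrite EFinM (Wnorm_sqr Wy yd) -ge0_integralZl_EFin ?sqr_ge0 //.
- by apply: eq_integral => t _; rewrite -EFinM !e2 -mulrDr.
- by move=> t _; rewrite lee_fin addr_ge0 // enorm2_ge0.
- apply/measurable_EFinP; apply: measurable_funD; apply: measurable_enorm2 => i.
    exact: (Wy.1 i).1.
  exact: (yL i).1.
Qed.

Lemma is_derivI0 k : is_derivI (fun _ : R => 0 : 'cV[R]_k) (fun=> 0).
Proof.
have E i : (fun _ : R => ((0 : 'cV[R]_k) i ord0)%:E) = cst 0%E.
  by apply/funext => t; rewrite mxE.
move=> t t0 i; rewrite E integral0 addr0; split => //; exact: integrable0.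
Qed.

Lemma inW0 k : inW (fun _ : R => 0 : 'cV[R]_k).
Proof.
have E i : (fun _ : R => (0 : 'cV[R]_k) i ord0) = cst 0.
  by apply/funext => t; rewrite mxE.
apply: (@inW_Wint R k (fun=> 0) (fun=> 0)).
- by move=> i; rewrite E; exact: measurable_cst.
- exact: is_derivI0.
- by rewrite /Wint enorm20 addr0 integral0.
Qed.

Lemma Wnorm0 k : Wnorm (fun _ : R => 0 : 'cV[R]_k) = 0.
Proof.
have := Wnorm_scale 0 (inW0 k); rewrite normr0 mul0r.
by under eq_fun do rewrite scaler0.
Qed.

End WSpaceLimits.

(** * Strong measurability *)

Section ContinuousSuperposition.
Context (R : realType) (d : measure_display) (T : measurableType d).

Let fgrid (N : nat) (x : R) : int := Num.floor (x * N.+1%:R).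

Let fgrid_cvg (x : R) : (fun N => (fgrid N x)%:~R / N.+1%:R : R) @ \oo --> x.
Proof.
apply/cvgrPdist_le => e e0; exists (Num.truncn e^-1) => // N /= hN.
have N0 : 0 < N.+1%:R :> R by [].
have /andP[k1 k2] := floor_itv (x * N.+1%:R).
have a1 : (fgrid N x)%:~R / N.+1%:R <= x by rewrite ler_pdivrMr.
have a2 : x <= (fgrid N x)%:~R / N.+1%:R + N.+1%:R^-1.
  rewrite -[X in _ + X]mul1r -mulrDl ler_pdivlMr // ltW //.
  by move: k2; rewrite intrD.
have a3 : N.+1%:R^-1 <= e.
  rewrite -[leRHS]invrK lef_pV2 ?posrE ?invr_gt0 //.
  by apply: le_trans (ltW (truncnS_gt e^-1)) _; rewrite ler_nat ltnS.
by rewrite ger0_norm ?subr_ge0 // lerBlDl (le_trans a2) // lerD2l.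
Qed.

Let fgrid_measurable N (g : T -> R) (v : int) : measurable_fun setT g ->
  measurable [set p | fgrid N (g p) = v].
Proof.
move=> mg.
rewrite (_ : [set p | _] = [set p | v%:~R <= g p * N.+1%:R] `&`
   [set p | g p * N.+1%:R < (v + 1)%:~R]); last first.
  apply/seteqP; split => p /=.
    by move=> <-; have /andP[] := floor_itv (g p * N.+1%:R).
  by move=> [a b]; apply: floor_def; rewrite a.
have mgN : measurable_fun setT (fun p => g p * N.+1%:R) by exact: measurable_funM.
apply: measurableI; first exact: (@measurable_le_set _ T R (fun=> v%:~R)).
exact: (@measurable_lt_set _ T R _ (fun=> (v + 1)%:~R)).
Qed.

(** Rounding each coordinate down to a grid gives a map with countably many values, each taken on a
    measurable cell; continuity of [G] gives the limit. *)
Lemma seq_cont_measurable p q (G : 'cV[R]_p -> 'cV[R]_q) (x : T -> 'cV[R]_p) j :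
  seq_cont G -> (forall i, measurable_fun setT (fun w => x w i ord0)) ->
  measurable_fun setT (fun w => G (x w) j ord0).
Proof.
move=> cG mx.
pose xN N w : 'cV[R]_p := \col_i ((fgrid N (x w i ord0))%:~R / N.+1%:R).
apply: (@measurable_fun_cvg _ _ _ _ (fun N w => G (xN N w) j ord0)); last first.
  move=> w _; apply: (cG (xN ^~ w) (x w)) => i k; rewrite ord1.
  by under eq_fun do rewrite mxE; exact: fgrid_cvg.
move=> N _ U mU; rewrite setTI.
pose cell (v : {ffun 'I_p -> int}) : set T :=
  \bigcap_(i in [set: 'I_p]) [set w | fgrid N (x w i ord0) = v i].
pose hit (v : {ffun 'I_p -> int}) := U (G (\col_i ((v i)%:~R / N.+1%:R)) j ord0).
rewrite (_ : _ @^-1` U = \bigcup_k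
    (if unpickle k is Some v then [set w | cell v w /\ hit v] else set0)).
  apply: bigcupT_measurable => k; case: (unpickle k) => // v.
  have mcell : measurable (cell v).
    by apply: fin_bigcap_measurable => // i _; exact: fgrid_measurable.
  have [hv|hv] := pselect (hit v).
    by rewrite (_ : [set w | _] = cell v) //; apply/seteqP; split => w // [].
  by rewrite (_ : [set w | _] = set0) //; apply/seteqP; split => w // [].
apply/seteqP; split => [w /= Uw|w [k _]].
  exists (pickle [ffun i => fgrid N (x w i ord0)]) => //; rewrite pickleK; split.
    by move=> i _ /=; rewrite ffunE.
  rewrite /hit (_ : (\col_i _) = xN N w) //.
  by apply/matrixP => i k; rewrite !mxE ffunE.
case: (unpickle k) => // v [cv hv] /=; rewrite (_ : xN N w = \col_i ((v i)%:~R / N.+1%:R)) //.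
by apply/matrixP => i l; rewrite !mxE cv.
Qed.

End ContinuousSuperposition.

Section StronglyMeasurable.
Context (R : realType) (n : nat) (d : measure_display) (T : measurableType d).
Variable P : probability T R.
Variable Ci : R.
Hypothesis embed : forall y : R -> 'cV[R]_n, inW y ->
  forall t, 0 <= t -> enorm (y t) <= Ci * Wnorm y.

Lemma finite_range_measurable (V : Type) (s : T -> V) (phi : V -> R) :
  finite_set (range s) -> (forall v, measurable (s @^-1` [set v])) ->
  measurable_fun setT (fun p => phi (s p)).
Proof.
move=> fs ms _ U mU; rewrite setTI.
rewrite (_ : _ @^-1` U =
    \bigcup_(v in [set v | range s v /\ U (phi v)]) (s @^-1` [set v])).
  apply: fin_bigcup_measurable => //.
  by apply: sub_finite_set fs => v [].
apply/seteqP; split => [p /= Up|p [v [_ Uv] /= sv]]; last by rewrite sv.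
by exists (s p) => //; split => //; exists p.
Qed.

(** By the embedding, evaluation at [t] turns the simple approximations into simple real functions
    that converge off [N]. One [N] serves all times, since it only has to contain the failures of
    convergence in W and of membership. *)
Lemma strongly_meas_pointwise (y : T -> R -> 'cV[R]_n) :
  strongly_meas P y -> {ae P, forall p, inW (y p)} ->
  exists N, [/\ measurable N, P N = 0%E, forall p, ~ N p -> inW (y p) &
    forall t i, 0 <= t -> measurable_fun (~` N) (fun p => y p t i ord0)].
Proof.
move=> [s [fs [ms [Ws cs]]]] Wy.
have [N [mN N0 hN]] := ae_null_cover (ae_imp2 cs Wy (fun p => @conj _ _)).
exists N; split => //; first by move=> p /hN[].
move=> t i t0.
apply: (@measurable_fun_cvg _ _ _ _ (fun k p => s k p t i ord0)).
  move=> k; apply: measurable_funTS.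
  exact: (@finite_range_measurable _ (s k) (fun v : R -> 'cV[R]_n => v t i ord0)).
move=> p /= /hN[cp Wp].
have c0 : (fun k => Ci * Wnorm (fsub (s k p) (y p))) @ \oo --> (0 : R).
  by rewrite -[X in _ --> X](mulr0 Ci); apply: cvgMr.
apply/cvgrPdist_le => e e0.
have near_e : \forall k \near \oo, Ci * Wnorm (fsub (s k p) (y p)) <= e.
  exact: (cvgr_le _ c0 _ e0).
apply: filterS near_e => k; apply: le_trans.
apply: le_trans (embed (inW_sub (Ws k p) Wp) t0).
by apply: le_trans (entry_le_enorm _ i); rewrite /fsub !mxE distrC.
Qed.

(** A multiplier of finite range keeps the approximating ensembles simple; the multipliers in use
    are signed indicators. *)
Lemma strongly_meas_scale (a : T -> R) (y : T -> R -> 'cV[R]_n) :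
  finite_set (range a) -> measurable_fun setT a ->
  strongly_meas P y -> {ae P, forall p, inW (y p)} ->
  strongly_meas P (fun p t => a p *: y p t).
Proof.
move=> fa ma [s [fs [ms [Ws cs]]]] Wy.
exists (fun k p t => a p *: s k p t); split; last split; last split.
- move=> k; apply: (@sub_finite_set _ _
    ((fun z : R * (R -> 'cV[R]_n) => fun t => z.1 *: z.2 t) @`
       (range a `*` range (s k)))).
    by move=> _ [p _ <-]; exists (a p, s k p) => //; split; exists p.
  by apply: finite_image; exact: finite_setX.
- move=> k v.
  rewrite (_ : _ @^-1` _ = \bigcup_(z in [set z : R * (R -> 'cV[R]_n) |
      (range a `*` range (s k)) z /\ (fun t => z.1 *: z.2 t) = v])
      ((a @^-1` [set z.1]) `&` (s k @^-1` [set z.2]))).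
    apply: fin_bigcup_measurable.
      apply: (@sub_finite_set _ _ (range a `*` range (s k))); first by move=> z [].
      exact: finite_setX.
    move=> z _; apply: measurableI => //.
    by rewrite -[X in measurable X]setTI; exact: ma.
  apply/seteqP; split => [p /= <-|p [[z1 z2] /= [_ zv] [/= az sz]]].
    by exists (a p, s k p) => //; split => //; split; exists p.
  by rewrite az sz.
- by move=> k p; exact: inW_scale.
- apply: (ae_imp2 cs Wy) => p cp Wp.
  have E k : Wnorm (fsub (fun t => a p *: s k p t) (fun t => a p *: y p t)) =
      `|a p| * Wnorm (fsub (s k p) (y p)).
    rewrite -Wnorm_scale; last exact: inW_sub.
    by congr Wnorm; apply/funext => t; rewrite /fsub scalerBr.
  have -> : (fun k => Wnorm (fsub (fun t => a p *: s k p t) (fun t => a p *: y p t)))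
      = (fun k => `|a p| * Wnorm (fsub (s k p) (y p))) by apply/funext.
  by rewrite -[X in _ --> X](mulr0 `|a p|); apply: cvgMr.
Qed.

(** Square integrability is compared by lower integrals, off the null set where [Phi p] may leave W,
    because homogeneity of [Wnorm] is available on W. *)
Lemma L2W_scale (a : T -> R) (Phi : T -> R -> 'cV[R]_n) :
  finite_set (range a) -> measurable_fun setT a -> (forall p, `|a p| <= 1) ->
  L2W P Phi -> L2W P (fun p t => a p *: Phi p t).
Proof.
move=> fa ma a1 [sP [WP iP]]; split; first exact: strongly_meas_scale.
split; first by apply: (ae_imp WP) => p Wp; exact: inW_scale.
have [N [mN N0 hN]] := ae_null_cover WP.
have drop (h : T -> \bar R) (h0 : (forall p, 0 <= h p)%E) :=
  lower_integral_setC_null h0 mN N0.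
rewrite drop; last by move=> p; rewrite lee_fin sqr_ge0.
apply: le_lt_trans iP; rewrite [leRHS]drop; last by move=> p; rewrite lee_fin sqr_ge0.
apply: ge0_le_lower_integral => p Np; first by rewrite lee_fin sqr_ge0.
rewrite lee_fin Wnorm_scale; last exact: hN.
rewrite exprMn ler_piMl ?sqr_ge0 // expr_le1 //.
Qed.

Lemma L2W_cst (phi : R -> 'cV[R]_n) : inW phi -> L2W P (fun=> phi).
Proof.
move=> Wphi; split; last split.
- exists (fun _ _ => phi); split; last split; last split.
  + by move=> k; apply: (@sub_finite_set _ _ [set phi]) => // _ [p _ <-].
  + move=> k v; have [->|pv] := pselect (phi = v).
      by rewrite (_ : _ @^-1` _ = setT) //; apply/seteqP; split.
    by rewrite (_ : _ @^-1` _ = set0) //; apply/seteqP; split.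
  + by [].
  + apply: aeW => p; rewrite (_ : fsub phi phi = fun=> 0).
      by rewrite Wnorm0; exact: cvg_cst.
    by apply/funext => t; rewrite /fsub subrr.
- by apply: aeW => p.
- by rewrite integral_cst //= probability_setT mule1 ltry.
Qed.

End StronglyMeasurable.

(** * Trapezoidal test functions *)

Section TestFunctions.
Variable R : realType.
Local Notation leb := (@lebesgue_measure R).
Local Notation I0 := (@Iset R).

Lemma integrable_bounded_itv (g : R -> R) (t K : R) :
  measurable_fun `[0, t]%classic g ->
  (forall s, `[0, t]%classic s -> `|g s| <= K) ->
  leb.-integrable `[0, t] (EFin \o g).
Proof.
move=> mg gK; apply: (@le_integrable _ _ _ _ _ _ _ (cst K%:E)) => //.
- exact/measurable_EFinP.
- move=> s hs /=; rewrite lee_fin; apply: le_trans (gK s hs) _; exact: ler_norm.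
- apply/integrableP; split => //=; rewrite integral_cst //=.
  rewrite lte_mul_pinfty ?lee_fin //.
  by rewrite lebesgue_measure_itv /=; case: ifP => _ //; rewrite ltry.
Qed.

Definition ramp k (i : 'I_k) (a t : R) : 'cV[R]_k :=
  Num.max (t - a) 0 *: delta_mx i ord0.

Definition step k (i : 'I_k) (a t : R) : 'cV[R]_k :=
  \1_(`]a, +oo[%classic) t *: delta_mx i ord0.

Lemma is_derivI_ramp k (i : 'I_k) (a : R) : 0 <= a -> is_derivI (ramp i a) (step i a).
Proof.
move=> a0 t t0 j.
have E : (fun s => (step i a s j ord0)%:E) =
    (fun s => ((delta_mx i ord0 : 'cV[R]_k) j ord0)%:E * (\1_(`]a, +oo[%classic) s)%:E)%E.
  by apply/funext => s; rewrite /step mxE mulrC EFinM.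
have i1 : leb.-integrable `[0, t] (EFin \o \1_(`]a, +oo[%classic)).
  apply: (@integrable_bounded_itv _ _ 1); first exact: measurable_indic.
  by move=> s _; rewrite indicE; case: (_ \in _); rewrite ?normr1 ?normr0.
rewrite E; split; first exact: integrableZl.
rewrite integralZl // integral_indic //=.
have -> : `]a, +oo[%classic `&` `[0, t]%classic = `]a, t]%classic :> set R.
  apply/seteqP; split => s /=; rewrite !in_itv /= andbT.
    by move=> [-> /andP[_ ->]].
  by move=> /andP[as_ ->]; split => //; rewrite andbT (le_trans a0) // ltW.
have -> : ramp i a 0 j ord0 = 0.
  by rewrite /ramp mxE (max_idPr _) ?mul0r // sub0r oppr_le0.
rewrite /ramp mxE add0r mulrC.
have [ta|at_] := leP t a.
  have -> : `]a, t]%classic = set0 :> set R by apply: set_itv_ge; rewrite bnd_simp -leNgt.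
  by rewrite measure0 mule0 /= (max_idPr _) ?subr_le0 // mulr0.
by rewrite leb_itvoc ?(ltW at_) //= (max_idPl _) // subr_ge0 ltW.
Qed.

(** For [0 < h <= b] a trapezoid: up on [[0, h]], equal to [1] on [[h, b]], down on [[b, b + h]]. As
    a combination of four ramps it gets its derivative by linearity. It starts at [0], which removes
    the initial condition from the tested equation. *)
Definition trap (h b t : R) : R := h^-1 *
  ((Num.max (t - 0) 0 - Num.max (t - h) 0) - (Num.max (t - b) 0 - Num.max (t - (b + h)) 0)).

Definition trap_deriv (h b t : R) : R := h^-1 *
  ((\1_(`]0, +oo[%classic) t - \1_(`]h, +oo[%classic) t) -
   (\1_(`]b, +oo[%classic) t - \1_(`](b + h), +oo[%classic) t)).

Section Trapezoid.
Variables (h b : R).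
Hypotheses (h0 : 0 < h) (hb : h <= b).

Lemma is_derivI_trap k (i : 'I_k) :
  is_derivI (fun t => trap h b t *: delta_mx i ord0 : 'cV[R]_k)
            (fun t => trap_deriv h b t *: delta_mx i ord0).
Proof.
have h0' := ltW h0; have b0 : 0 <= b by exact: le_trans hb.
have := is_derivI_scale h^-1 (is_derivI_sub
  (is_derivI_sub (is_derivI_ramp i (lexx 0)) (is_derivI_ramp i h0'))
  (is_derivI_sub (is_derivI_ramp i b0) (is_derivI_ramp i (addr_ge0 b0 h0')))).
rewrite /fsub /ramp /step.
by under eq_fun do rewrite -!scalerBl scalerA;
   under [X in is_derivI _ X]eq_fun do rewrite -!scalerBl scalerA.
Qed.

Lemma trap0 : trap h b 0 = 0.
Proof.
have b0 : 0 <= b by apply: le_trans hb; exact: ltW.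
rewrite /trap !sub0r oppr0 !(max_idPr _) ?oppr_le0 ?subrr ?mulr0 //.
- by rewrite addr_ge0 // ltW.
- exact: ltW.
Qed.

Let unscale (x : R) : h^-1 * (h * x) = x.
Proof. by rewrite mulKf // gt_eqF. Qed.

Lemma trap_end (t : R) : b + h <= t -> trap h b t = 0.
Proof.
have h0' := h0; have hb' := hb.
by move=> ht; rewrite /trap !(max_idPl _) ?subr_ge0 //; lra.
Qed.

Lemma trap_itv (t : R) : 0 <= t -> 0 <= trap h b t <= 1.
Proof.
have h0' := h0; have hb' := hb => t0.
have : 0 <= h * trap h b t <= h.
  rewrite /trap mulVKf ?gt_eqF // subr0.
  have [?|?] := leP t 0; have [?|?] := leP (t - h) 0;
  have [?|?] := leP (t - b) 0; have [?|?] := leP (t - (b + h)) 0; apply/andP; split; lra.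
by move=> /andP[a1 a2]; rewrite -(pmulr_rge0 _ h0) a1 -(ler_pM2l h0) mulr1.
Qed.

Lemma trap_dist (t : R) : 0 <= t -> ~~ (t \in `[0, h]) -> ~~ (t \in `[b, b + h]) ->
  trap h b t = ((t <= b)%R : bool)%:R.
Proof.
have h0' := h0; have hb' := hb => t0.
rewrite !in_itv /= t0 /= -ltNge negb_and -!ltNge => ht /orP[tb|tb].
  rewrite (ltW tb) /trap subr0 (max_idPl _) // (max_idPl _) ?subr_ge0 ?ltW //.
  rewrite !(max_idPr _) ?subr_le0; try lra.
  by rewrite (_ : _ - _ = h * 1) ?unscale //; ring.
rewrite trap_end; last exact: ltW.
by rewrite leNgt (_ : b < t) //; lra.
Qed.

Lemma trap_measurable (D : set R) : measurable_fun D (trap h b).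
Proof.
apply: measurable_funTS; apply: measurable_funM => //.
have mr (a : R) : measurable_fun setT (fun t : R => Num.max (t - a) 0).
  by apply: measurable_maxr => //; exact: measurable_funB.
by apply: measurable_funB; apply: measurable_funB; exact: mr.
Qed.

Let indic_ray (a t : R) : \1_(`]a, +oo[%classic) t = (a < t)%R%:R :> R.
Proof. by rewrite indicE mem_setE in_itv /= andbT. Qed.

Lemma trap_deriv_le (t : R) : `|trap_deriv h b t| <= h^-1.
Proof.
have h0' := h0; have hb' := hb.
have hi : 0 < h^-1 by rewrite invr_gt0.
rewrite /trap_deriv normrM (gtr0_norm hi) ler_piMr ?(ltW hi) // !indic_ray ler_norml.
have [?|?] := ltP 0 t; have [?|?] := ltP h t; have [?|?] := ltP b t;
have [?|?] := ltP (b + h) t; apply/andP; split => /=; lra.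
Qed.

Lemma trap_deriv_end (t : R) : b + h < t -> trap_deriv h b t = 0.
Proof.
have h0' := h0; have hb' := hb => ht; rewrite /trap_deriv !indic_ray.
have -> : 0 < t by lra.
have -> : h < t by lra.
have -> : b < t by lra.
by rewrite ht /= !subrr mulr0.
Qed.

Lemma inW_trap k (i : 'I_k) : inW (fun t => trap h b t *: delta_mx i ord0 : 'cV[R]_k).
Proof.
have b0 : 0 <= b by apply: le_trans hb; exact: ltW.
apply: (inW_Wint _ (is_derivI_trap i)).
  move=> j; under eq_fun do rewrite mxE.
  by apply: measurable_funM => //; exact: trap_measurable.
have e2 (x : R) : enorm2 (x *: delta_mx i ord0 : 'cV[R]_k) = x ^+ 2.
  rewrite /enorm2 (bigD1 i) //= big1 => [|j ji]; rewrite !mxE eqxx ?eqxx.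
    by rewrite mulr1 addr0.
  by rewrite (negbTE ji) mulr0 expr0n.
(* Here [1] bounds the squared height and [h^-1 ^+ 2] the squared slope; both vanish beyond
   [b + h]. *)
pose C := 1 + h^-1 ^+ 2.
have C0 : 0 <= C by rewrite addr_ge0 // sqr_ge0.
apply: (@le_lt_trans _ _ (\int[leb]_(t in `[0%R, (b + h)%R]) cst C%:E t)%E).
  rewrite /Wint [leLHS]integral_mkcond [leRHS]integral_mkcond.
  apply: ge0_le_lower_integral => t _.
    rewrite patchE; case: ifP => // _.
    by rewrite lee_fin addr_ge0 // enorm2_ge0.
  rewrite !patchE; case: ifPn => [/set_mem t0|_]; last first.
    by case: ifP => // _; rewrite lee_fin.
  have /andP[t1 t2] := trap_itv t0.
  have [tb|tb] := leP t (b + h); last first.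
    rewrite !e2 trap_end ?(ltW tb) // trap_deriv_end // expr0n addr0.
    by case: ifP => // _; rewrite lee_fin.
  rewrite !e2 mem_set /= ?in_itv /= ?tb ?andbT // lee_fin lerD ?expr_le1 //.
  rewrite -real_normK ?num_real // ler_sqr ?nnegrE ?invr_ge0 ?(ltW h0) //.
  exact: trap_deriv_le.
rewrite integral_cst //= lte_mul_pinfty ?lee_fin //.
by rewrite lebesgue_measure_itv /=; case: ifP => _ //; rewrite ltry.
Qed.

End Trapezoid.
End TestFunctions.

(** * Residuals tested with trapezoids *)

Section Residual.
Variable R : realType.
Local Notation leb := (@lebesgue_measure R).
Local Notation I0 := (@Iset R).
Variables (k : nat) (y : R -> 'cV[R]_k) (i : 'I_k) (gi : R -> R) (K h b eps : R).
Hypothesis Wy : inW y.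
Hypothesis mgi : measurable_fun I0 gi.
Hypothesis giK : forall t, 0 <= t -> `|gi t| <= K.
Hypotheses (h0 : 0 < h) (hb : h <= b) (eps0 : 0 < eps).

Let r (t : R) := Wdot y t i ord0 - gi t.

Let K0 : 0 <= K.
Proof. by apply: le_trans (giK (lexx 0)). Qed.

Let mr : measurable_fun I0 r.
Proof. by apply: measurable_funB => //; exact: ((WdotP Wy).2 i).1. Qed.

(** On a set of measure [h] Young's inequality controls the derivative part by the W-norm alone, so
    the bound is common to all paths of a ball of W. *)
Let residual_small (D : set R) : measurable D -> D `<=` I0 -> leb D = h%:E ->
  (\int[leb]_(t in D) `|r t|%:E <=
    (eps * Wnorm y ^+ 2 + ((4 * eps)^-1 + K) * h)%:E)%E.
Proof.
move=> mD DI Dh; have [yd yL] := WdotP Wy.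
have md : measurable_fun I0 (fun t => Wdot y t i ord0) by exact: (yL i).1.
have mdD : measurable_fun D (fun t => `|Wdot y t i ord0|%:E).
  apply/measurable_EFinP; apply: measurableT_comp => //.
  exact: (measurable_funS (@Iset_measurable R) DI md).
apply: (@le_trans _ _ (\int[leb]_(t in D) (`|Wdot y t i ord0|%:E + K%:E))%E).
  apply: ge0_le_lower_integral => t Dt; rewrite ?lee_fin //.
  apply: le_trans (ler_normB _ _) _.
  by rewrite lerD2l; apply: giK; exact: DI.
rewrite ge0_integralD //.
rewrite (integral_cst leb mD).
apply: (@le_trans _ _ (((eps * Wnorm y ^+ 2)%:E + ((4 * eps)^-1 * h)%:E) + (K * h)%:E)%E).
  apply: leeD; last by rewrite EFinM /= Dh.
  apply: le_trans (integral_norm_amgm (g := fun t => Wdot y t i ord0) eps0 mD DI md) _.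
  rewrite /= Dh (EFinM eps (Wnorm y ^+ 2)) (EFinM (4 * eps)^-1 h); apply: leeD => //.
  apply: lee_pmul => //; first by rewrite lee_fin ltW.
    by apply: integral_ge0 => t _; rewrite lee_fin sqr_ge0.
  rewrite (Wnorm_sqr Wy yd).
  apply: ge0_le_lower_integral => t _; rewrite lee_fin ?sqr_ge0 //.
  by apply: le_trans (sqr_entry_le_enorm2 _ i) _; rewrite lerDr enorm2_ge0.
rewrite -!EFinD lee_fin le_eqVlt; apply/orP; left; apply/eqP; ring.
Qed.

Let J := `[0, (b + h)]%classic : set R.

Let rJ : leb.-integrable J (EFin \o r).
Proof.
have bh0 : 0 <= b + h.
  by rewrite addr_ge0 ?(ltW h0) // (le_trans _ hb) // ltW.
apply: (@integrable_subr _ J (fun t => Wdot y t i ord0) gi).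
- exact: measurable_itv.
- exact: (is_derivI_integrable (WdotP Wy).1 i bh0).
apply: (@integrable_bounded_itv _ _ _ K).
  exact: (measurable_funS (@Iset_measurable R) (@itv0_Iset R _) mgi).
by move=> s /itv0_Iset; exact: giK.
Qed.

Lemma trap_residual_integrable :
  leb.-integrable I0 (EFin \o (fun t => r t * trap h b t)).
Proof.
have mJ : measurable J by exact: measurable_itv.
have mrJ : measurable_fun J r by apply/measurable_EFinP; exact: (measurable_int _ rJ).
have i1 : leb.-integrable J (EFin \o (fun t => r t * trap h b t)).
  apply: le_integrable rJ => //.
    by apply/measurable_EFinP; apply: measurable_funM => //; exact: trap_measurable.
  move=> t /itv0_Iset t0; rewrite lee_fin normrM ler_piMr //.
  by have /andP[? ?] := trap_itv h0 hb t0; rewrite ger0_norm.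
have i2 : leb.-integrable setT ((EFin \o (fun t => r t * trap h b t)) \_ J).
  by apply/(integrable_mkcond _ _).1.
apply/(integrable_mkcond _ _).2 => //; move: i2.
congr (integrable _ _ _); apply/funext => t.
rewrite IsetE !patchE /J !mem_setE !in_itv /= andbT; have [t0|//] := leP 0 t.
by have [//|/ltW tbh] := leP t (b + h); rewrite /= trap_end // mulr0.
Qed.

(** Against the indicator of [[0, b]] the residual integrates to the defect of the integral
    equation. The trapezoid differs from that indicator only on [[0, h]] and [[b, b + h]], by at
    most [1]; hence the factor [2]. *)
Lemma trap_residual :
  `|\int[leb]_(t in I0) (r t * trap h b t) -
    (y b i ord0 - y 0 i ord0 - \int[leb]_(t in `[0, b]) gi t)| <=
  2 * (eps * Wnorm y ^+ 2 + ((4 * eps)^-1 + K) * h).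
Proof.
have b0 : 0 <= b by apply: le_trans hb; exact: ltW.
have bh : b <= b + h by rewrite lerDl ltW.
have [yd yL] := WdotP Wy.
have mJ : measurable J by exact: measurable_itv.
pose c t : R := ((t <= b)%R : bool)%:R.
have mc : measurable_fun J c.
  rewrite (_ : c = \1_(`]-oo, b]%classic)); first exact: measurable_indic.
  by apply/funext => t; rewrite indicE mem_setE in_itv.
have mrJ : measurable_fun J r by apply/measurable_EFinP; exact: (measurable_int _ rJ).
have i1 : leb.-integrable J (EFin \o (fun t => r t * trap h b t)).
  apply: le_integrable rJ => //.
    apply/measurable_EFinP; apply: measurable_funM => //; exact: trap_measurable.
  move=> t /itv0_Iset t0; rewrite lee_fin normrM ler_piMr //.
  by have /andP[? ?] := trap_itv h0 hb t0; rewrite ger0_norm.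
have i2 : leb.-integrable J (EFin \o (fun t => r t * c t)).
  apply: le_integrable rJ => //.
    by apply/measurable_EFinP; apply: measurable_funM.
  move=> t _; rewrite lee_fin normrM ler_piMr //.
  by rewrite /c; case: (t <= b); rewrite ?normr0 ?normr1.
have E1 : \int[leb]_(t in I0) (r t * trap h b t) =
    \int[leb]_(t in J) (r t * trap h b t).
  rewrite IsetE Rintegral_mkcond [RHS]Rintegral_mkcond; apply: eq_Rintegral => t _.
  rewrite !patchE /J !mem_setE !in_itv /= andbT; have [t0|//] := leP 0 t.
  by have [//|/ltW tbh] := leP t (b + h); rewrite trap_end // mulr0.
have E2 : y b i ord0 - y 0 i ord0 - \int[leb]_(t in `[0, b]) gi t =
    \int[leb]_(t in J) (r t * c t).
  rewrite (is_derivIE yd) // [y 0 i ord0 + _]addrC addrK -RintegralB //; first last.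
  - apply: (@integrable_bounded_itv _ _ _ K).
      exact: (measurable_funS (@Iset_measurable R) (@itv0_Iset R _) mgi).
    by move=> s /itv0_Iset; exact: giK.
  - exact: (is_derivI_integrable yd i b0).
  rewrite Rintegral_mkcond [RHS]Rintegral_mkcond; apply: eq_Rintegral => t _.
  rewrite !patchE /J !mem_setE !in_itv /= /c.
  have [t0|t0] := leP 0 t => //=.
  have [tb|tb] := leP t b => /=; first by rewrite (le_trans tb bh) mulr1.
  by rewrite mulr0; case: ifP.
rewrite E1 E2 -RintegralB //.
have i3 : leb.-integrable J (EFin \o (fun t => r t * trap h b t - r t * c t)).
  exact: integrable_subr.
pose D1 := `[0, h]%classic : set R; pose D2 := `[b, (b + h)]%classic : set R.
have D1I : D1 `<=` I0 by exact: itv0_Iset.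
have D2I : D2 `<=` I0.
  by move=> t; rewrite /D2 /= in_itv /= => /andP[bt _]; exact: le_trans b0 bt.
have mD1 : measurable D1 by exact: measurable_itv.
have mD2 : measurable D2 by exact: measurable_itv.
have mabs (D : set R) : measurable D -> D `<=` I0 ->
    measurable_fun setT ((fun t => `|r t|%:E) \_ D).
  move=> mD DI; apply/(measurable_restrictT _ _).1 => //.
  apply/measurable_EFinP; apply: measurableT_comp => //.
  exact: (measurable_funS (@Iset_measurable R) DI mr).
rewrite -lee_fin EFin_normr_Rintegral //.
apply: le_trans (le_abse_integral leb mJ (measurable_int _ i3)) _.
apply: (@le_trans _ _ (\int[leb]_t
   (((fun t => `|r t|%:E) \_ D1) t + ((fun t => `|r t|%:E) \_ D2) t))%E).
  rewrite [leLHS]integral_mkcond; apply: ge0_le_lower_integral => t _.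
    by rewrite patchE; case: ifP.
  rewrite !patchE.
  have p0 (D : set R) : (0 <= (if t \in D then `|r t|%:E else 0))%E.
    by case: ifP => // _; rewrite lee_fin.
  case: ifPn => [/set_mem/itv0_Iset t0|_]; last by rewrite adde_ge0.
  rewrite /= -mulrBr normrM.
  have /andP[ta tb] := trap_itv h0 hb t0.
  have cl : `|trap h b t - c t| <= 1.
    by rewrite /c; case: (t <= b)%R; rewrite ler_norml; apply/andP; split => /=; lra.
  have cle : (((`|r t| * `|trap h b t - c t|)%:E <= `|r t|%:E)%E).
    by rewrite lee_fin ler_piMr.
  have [t1|t1] := boolP (t \in D1); first by apply: le_trans cle _; rewrite leeDl.
  have [t2|t2] := boolP (t \in D2); first by apply: le_trans cle _; rewrite leeDr.
  rewrite trap_dist //; first by rewrite subrr normr0 mulr0 adde0.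
    by move: t1; rewrite mem_setE.
  by move: t2; rewrite mem_setE.
rewrite ge0_integralD //; first last.
- exact: mabs.
- by move=> t _; rewrite patchE; case: ifP => // _; rewrite lee_fin.
- exact: mabs.
- by move=> t _; rewrite patchE; case: ifP => // _; rewrite lee_fin.
rewrite -!integral_mkcond mulr2n mulrDl mul1r EFinD; apply: leeD.
  apply: residual_small => //; rewrite lebesgue_measure_itv /= lte_fin h0.
  by rewrite sube0.
apply: residual_small => //; rewrite lebesgue_measure_itv /= lte_fin ltrDl h0.
by rewrite -EFinB addrAC subrr add0r.
Qed.

End Residual.

(** * Paths of ensemble solutions *)

Section EnsembleFlow.
Context (R : realType) (n m : nat) (d : measure_display) (T : measurableType d).
Local Notation leb := (@lebesgue_measure R).
Local Notation I0 := (@Iset R).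
Variables (f : 'cV[R]_n -> 'cV[R]_n) (B : 'M[R]_(n, m)) (F : 'cV[R]_n -> 'cV[R]_m).
Variables (P : probability T R) (pt : T -> 'cV[R]_n) (Ci MY : R).
Hypothesis Ci0 : 0 < Ci.
Hypothesis embed : forall y : R -> 'cV[R]_n, inW y ->
  forall t, 0 <= t -> enorm (y t) <= Ci * Wnorm y.
Hypotheses (cf : seq_cont f) (cF : seq_cont F).

Definition drift (x : 'cV[R]_n) : 'cV[R]_n := f x + B *m F x.

Definition flow (c : R) (y : R -> 'cV[R]_n) :=
  [/\ inW y, Wnorm y <= c & is_derivI y (fun t => drift (y t))].

(** Replacing the path by zero on a null set gives an ensemble whose properties hold at every [p],
    as the measurable choice requires. *)
Definition zero_on (N : set T) (y : T -> R -> 'cV[R]_n) (p : T) : R -> 'cV[R]_n :=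
  if p \in N then (fun=> 0) else y p.

Lemma zero_on_measurable (N : set T) (y : T -> R -> 'cV[R]_n) t i : measurable N ->
  measurable_fun (~` N) (fun p => y p t i ord0) ->
  measurable_fun setT (fun p => zero_on N y p t i ord0).
Proof.
move=> mN my.
rewrite (_ : (fun p => _) = (fun p => y p t i ord0) \_ (~` N)).
  by apply/(measurable_restrictT _ _).1 => //; exact: measurableC.
apply/funext => p; rewrite patchE /zero_on in_setC; case: (p \in N) => //=.
by rewrite mxE.
Qed.

Lemma drift_seq_cont : seq_cont drift.
Proof.
move=> x l xl; apply: mx_cvgD; first exact: cf.
by apply: mx_cvgM; [exact: mx_cvg_cst|exact: cF].
Qed.

Arguments drift_seq_cont x l : clear implicits.

(** Serves to extract [0 <= 2 * MY] from a norm bound that holds almost everywhere. *)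
Lemma null_set_nonempty (N : set T) : P N = 0%E -> exists p, ~ N p.
Proof.
move=> N0; apply: contrapT => /forallNP h.
have NT : N = setT by apply/seteqP; split => // p _; apply: contrapT; exact: h.
by move: N0; rewrite NT probability_setT => /eqP; rewrite onee_eq0.
Qed.

Lemma inW_entry_bound (y : R -> 'cV[R]_n) (c : R) : inW y -> Wnorm y <= c ->
  forall t i, 0 <= t -> `|y t i ord0| <= Ci * c.
Proof.
move=> Wy yc t i t0; apply: le_trans (entry_le_enorm _ i) _.
by apply: le_trans (embed Wy t0) _; rewrite ler_pM2l.
Qed.

Lemma measurable_drift_integral (z : T -> R -> 'cV[R]_n) (K b : R) i :
  (forall p, inW (z p)) ->
  (forall p t, 0 <= t -> `|drift (z p t) i ord0| <= K) ->
  (forall (t : R) j, 0 <= t -> measurable_fun setT (fun p => z p t j ord0)) -> 0 <= b ->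
  measurable_fun setT (fun p => \int[leb]_(t in `[0, b]) drift (z p t) i ord0).
Proof.
move=> Wz zK mz b0.
have cz p : seq_contI (fun t => drift (z p t) i ord0).
  exact: (@seq_contI_comp _ _ _ _ _ i (Wz p) drift_seq_cont).
have id p : leb.-integrable `[0, b] (EFin \o (fun t => drift (z p t) i ord0)).
  apply: (@integrable_bounded_itv _ _ _ K).
    apply: (measurable_funS (@Iset_measurable R) (@itv0_Iset R _)).
    exact: seq_contI_measurable.
  by move=> s /itv0_Iset; exact: zK.
have iK : leb.-integrable `[0, b] (EFin \o (cst K)).
  by apply: (@integrable_bounded_itv _ _ _ `|K|) => // s _.
(* Adding [K] makes the integrand nonnegative, as the Tonelli argument asks; the constant is
   subtracted afterwards. *)
pose h p t := drift (z p t) i ord0 + K.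
have mh := @measurable_fun_integral_param _ T R h _ _ `[0, b]%classic.
have {mh} : measurable_fun setT (fun p => \int[leb]_(t in `[0%R, b]) (h p t)%:E)%E.
  apply: mh => //.
  - move=> t t0; apply: measurable_funD => //.
    by apply: (seq_cont_measurable i drift_seq_cont) => j; exact: mz.
  - by move=> p t s t0 s0 st; apply: cvgD; [exact: cz|exact: cvg_cst].
  - exact: itv0_Iset.
  - by move=> p t t0; rewrite /h -lerBlDr sub0r; have := zK p t t0; rewrite ler_norml => /andP[].
move=> mh.
rewrite (_ : (fun p => _) = (fun p => fine (\int[leb]_(t in `[0%R, b]) (h p t)%:E)%E -
    \int[leb]_(t in `[0, b]) K)).
  by apply: measurable_funB => //; apply: measurableT_comp => //; exact: fine_measurable.
apply/funext => p; rewrite -[fine _]/(\int[leb]_(t in `[0, b]) h p t) RintegralD //.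
by rewrite addrK.
Qed.

(** The value [y0] disappears because the trapezoid is [0] at time [0], so the initial data do not
    enter what is tested. *)
Lemma aform_trap (y : R -> 'cV[R]_n) (y0 : 'cV[R]_n) (a h b K : R) i :
  0 < h -> h <= b -> inW y -> (forall t, 0 <= t -> `|drift (y t) i ord0| <= K) ->
  aform f B F y y0 (fun t => a *: (trap h b t *: delta_mx i ord0)) =
  a * \int[leb]_(t in I0) ((Wdot y t i ord0 - drift (y t) i ord0) * trap h b t).
Proof.
move=> h0 hb Wy yK.
have md : measurable_fun I0 (fun t => drift (y t) i ord0).
  by apply: seq_contI_measurable; exact: (@seq_contI_comp _ _ _ _ _ i _ drift_seq_cont).
rewrite /aform trap0 // scale0r scaler0.
have -> (v : 'cV[R]_n) : edot v 0 = 0 by apply: big1 => j _; rewrite mxE mulr0.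
rewrite addr0 -RintegralZl //; last exact: (@trap_residual_integrable R n y i (fun t => drift (y t) i ord0) K h b Wy md yK h0 hb).
apply: eq_Rintegral => t _; rewrite /edot (bigD1 i) //= big1 => [|j ji].
  by rewrite /drift !mxE !eqxx /= mulr1 addr0; ring.
by rewrite !mxE (negbTE ji) /= !mulr0.
Qed.

Lemma aform0 (y : R -> 'cV[R]_n) y0 : aform f B F y y0 (fun=> 0) = 0.
Proof.
have e0 (v : 'cV[R]_n) : edot v 0 = 0 by apply: big1 => j _; rewrite mxE mulr0.
rewrite /aform e0 addr0 /l2dot.
by under eq_integral do rewrite e0; rewrite integral0.
Qed.

Lemma indic_sign_L2W (A : set T) (s : R) (Phi : T -> R -> 'cV[R]_n) :
  measurable A -> `|s| <= 1 -> L2W P Phi ->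
  L2W P (fun p t => (s * \1_A p) *: Phi p t).
Proof.
move=> mA s1 LP; apply: L2W_scale => //.
- apply: (@sub_finite_set _ _ [set 0; s]); last exact: finite_set2.
  move=> _ [p _ <-]; rewrite indicE; case: (p \in A); rewrite ?mulr1 ?mulr0 /=.
    by right.
  by left.
- by apply: measurable_funM => //; exact: measurable_indic.
- move=> p; rewrite indicE; case: (p \in A); rewrite ?mulr1 ?mulr0 ?normr0 //.
Qed.

Section Solution.
Variable y : T -> R -> 'cV[R]_n.
Hypothesis sol : ensemble_sol f B P pt MY F y.
Variable N0 : set T.
Hypotheses (mN0 : measurable N0) (PN0 : P N0 = 0%E).
Hypothesis Wy : forall p, ~ N0 p -> inW (y p).
Hypothesis yMY : forall p, ~ N0 p -> Wnorm (y p) <= 2 * MY.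
Hypothesis my : forall (t : R) i, 0 <= t -> measurable_fun (~` N0) (fun p => y p t i ord0).

Let z := zero_on N0 y.

Let MY_ge0 : 0 <= 2 * MY.
Proof.
by have [p /yMY] := null_set_nonempty PN0; apply: le_trans; exact: sqrtr_ge0.
Qed.

Let zE p : ~ N0 p -> z p = y p.
Proof. by move=> Np; rewrite /z /zero_on memNset. Qed.

Let Wz p : inW (z p).
Proof.
rewrite /z /zero_on; case: ifPn => [_|/negP pN]; first exact: inW0.
by apply: Wy => /mem_set.
Qed.

Let zMY p : Wnorm (z p) <= 2 * MY.
Proof.
rewrite /z /zero_on; case: ifPn => [_|/negP pN]; first by rewrite Wnorm0.
by apply: yMY => /mem_set.
Qed.

Let mz (t : R) i : 0 <= t -> measurable_fun setT (fun p => z p t i ord0).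
Proof. by move=> t0; apply: zero_on_measurable => //; exact: my. Qed.

Let defect i (b : R) p : R :=
  z p b i ord0 - z p 0 i ord0 - \int[leb]_(t in `[0, b]) drift (z p t) i ord0.

Variable K : R.
Hypothesis K0 : 0 <= K.
Hypothesis driftK : forall x : 'cV[R]_n, (forall i, `|x i ord0| <= Ci * (2 * MY)) ->
  forall i, `|drift x i ord0| <= K.

Let zK p (t : R) i : 0 <= t -> `|drift (z p t) i ord0| <= K.
Proof.
by move=> t0; apply: driftK => j; exact: (inW_entry_bound (Wz p) (zMY p)).
Qed.

Let mdefect i b : 0 <= b -> measurable_fun setT (defect i b).
Proof.
move=> b0; apply: measurable_funB.
  by apply: measurable_funB; exact: mz.
by apply: (@measurable_drift_integral _ K) => // p t; exact: zK.
Qed.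

(* Testing with [+-1_A] times a trapezoid approximating [1_[0, b]] bounds the
   defect of the integral equation; the error is uniform in the parameter. *)
Let defect_null i (b c s : R) : 0 < b -> 0 < c -> `|s| = 1 ->
  P (~` N0 `&` [set p | c <= s * defect i b p]) = 0%E.
Proof.
move=> b0 c0 s1; set A := _ `&` _.
have mA : measurable A.
  apply: measurableI; first exact: measurableC.
  apply: (@measurable_le_set _ T R (fun=> c)) => //.
  by apply: measurable_funM => //; apply: mdefect; exact: ltW.
pose W2 := (2 * MY) ^+ 2.
have W20 : 0 <= W2 by exact: sqr_ge0.
(* Both [eps * W2] and [q * h] are made at most [c / 8]; [trap_residual] doubles their sum, so the
   error is [c / 2] and a lower bound [c / 2] survives on [A]. *)
pose eps := c / (8 * (W2 + 1)).
have eps0 : 0 < eps by rewrite divr_gt0 // mulr_gt0 // ltr_wpDl.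
pose q := (4 * eps)^-1 + K.
have q0 : 0 < q by rewrite ltr_wpDr // invr_gt0 mulr_gt0.
pose h := Num.min b (c / (8 * q)).
have h0 : 0 < h by rewrite lt_min b0 divr_gt0 // mulr_gt0.
have hb : h <= b by rewrite ge_min lexx.
have hq : q * h <= c / 8.
  have : h <= c / (8 * q) by rewrite ge_min lexx orbT.
  rewrite ler_pdivlMr ?mulr_gt0 //; lra.
have eW : eps * W2 <= c / 8.
  rewrite /eps mulrAC ler_pdivrMr ?mulr_gt0 // ?ltr_wpDl //.
  have : c * W2 <= c * (W2 + 1) by rewrite ler_pM2l // lerDl.
  lra.
pose Phi p (t : R) : 'cV[R]_n := (s * \1_A p) *: (trap h b t *: delta_mx i ord0).
have LPhi : L2W P Phi.
  by apply: indic_sign_L2W => //; [rewrite s1|apply: L2W_cst; exact: inW_trap].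
have I0P := sol.2 _ LPhi.
have on_A p : A p -> c / 2 <= aform f B F (y p) (pt p) (Phi p).
  move=> Ap; have [Np] := Ap; rewrite /= => cd.
  rewrite /Phi indicE mem_set // mulr1 -(zE Np) (aform_trap _ _ h0 hb (Wz p) (K := K)); last first.
    by move=> t t0; exact: zK.
  have md : measurable_fun I0 (fun t => drift (z p t) i ord0).
    by apply: seq_contI_measurable; exact: (@seq_contI_comp _ _ _ _ _ i _ drift_seq_cont).
  have := @trap_residual R n (z p) i (fun t => drift (z p t) i ord0) K h b eps (Wz p) md (fun t => @zK p t i) h0 hb eps0.
  set J := \int[leb]_(t in I0) _ => JD.
  have e1 : eps * Wnorm (z p) ^+ 2 <= c / 8.
    by apply: le_trans eW; rewrite ler_pM2l // ler_sqr ?nnegrE ?sqrtr_ge0.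
  have : `|s * (J - defect i b p)| <= c / 2.
    by rewrite normrM s1 mul1r; apply: le_trans JD _; rewrite -/q; lra.
  rewrite mulrBr ler_norml => /andP[+ _]; lra.
have off_A p : ~ A p -> aform f B F (y p) (pt p) (Phi p) = 0.
  move=> nA; rewrite /Phi indicE memNset // mulr0.
  by under eq_fun do rewrite scale0r; rewrite aform0.
apply: (@integral_eq0_null _ T R P _ A (c / 2) _ mA _ on_A I0P); last by rewrite divr_gt0.
move=> p; have [/on_A|/off_A ->//] := pselect (A p).
by apply: le_trans; rewrite divr_ge0 // ltW.
Qed.

(** Both signs and the thresholds [1/(k+1)] exhaust the set where the defect is nonzero. *)
Let defect_ae i b : 0 < b -> {ae P, forall p, ~ N0 p -> defect i b p = 0}.
Proof.
move=> b0.
have sgn (s : R) : `|s| = 1 ->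
    {ae P, forall p, forall k : nat, ~ (~ N0 p /\ k.+1%:R^-1 <= s * defect i b p)}.
  move=> s1; apply: ae_foralln => k.
  exists (~` N0 `&` [set p | k.+1%:R^-1 <= s * defect i b p]); split.
  - apply: measurableI; first exact: measurableC.
    apply: (@measurable_le_set _ T R (fun=> k.+1%:R^-1)) => //.
    by apply: measurable_funM => //; apply: mdefect; exact: ltW.
  - exact: defect_null.
  - by move=> p /= /contrapT.
have inv_le (x : R) : 0 < x -> exists k : nat, k.+1%:R^-1 <= x.
  move=> x0; exists (Num.truncn x^-1).
  rewrite -[leRHS]invrK lef_pV2 ?posrE ?invr_gt0 //; exact: ltW (truncnS_gt _).
have n1 : `|-1| = 1 :> R by rewrite normrN normr1.
apply: (ae_imp2 (sgn 1 (normr1 R)) (sgn (-1) n1)) => p hp hn Np.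
have [d0|d0|//] := ltgtP (defect i b p) 0.
  have [|k hk] := inv_le (- defect i b p); first by rewrite oppr_gt0.
  by case: (hn k); split => //; rewrite mulN1r.
have [k hk] := inv_le _ d0.
by case: (hp k); split => //; rewrite mul1r.
Qed.

(** Countably many grid times share one null set; off it both sides of the integral equation are
    continuous in time, so they agree at all times. *)
Lemma ensemble_drift : exists N, [/\ measurable N, P N = 0%E, N0 `<=` N &
  forall p, ~ N p -> is_derivI (y p) (fun t => drift (y p t))].
Proof.
have ae1 : {ae P, forall p, forall q : nat * nat * 'I_n,
    ~ N0 p -> defect q.2 (q.1.1.+1%:R / q.1.2.+1%:R) p = 0}.
  by apply: ae_forall_countable => q; apply: defect_ae; rewrite divr_gt0.
have [N1 [mN1 PN1 hN1]] := ae_null_cover ae1.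
exists (N0 `|` N1); split.
- exact: measurableU.
- by apply: null_set_setU.
- by move=> p; left.
move=> p /not_orP[Np N1p].
have cz i : seq_contI (fun t => drift (z p t) i ord0).
  exact: (@seq_contI_comp _ _ _ _ _ i (Wz p) drift_seq_cont).
have id (i : 'I_n) (t : R) : 0 <= t ->
    leb.-integrable `[0, t] (EFin \o (fun t => drift (z p t) i ord0)).
  move=> t0; apply: (@integrable_bounded_itv _ _ _ K).
    apply: (measurable_funS (@Iset_measurable R) (@itv0_Iset R _)).
    exact: seq_contI_measurable.
  by move=> s /itv0_Iset; exact: zK.
rewrite -(zE Np).
(* The integral side of the equation: its derivative is bounded by [K], so it is Lipschitz. *)
pose w (t : R) : 'cV[R]_n :=
  \col_i (z p 0 i ord0 + \int[leb]_(s in `[0, t]) drift (z p s) i ord0).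
have w0 i : w 0 i ord0 = z p 0 i ord0.
  by rewrite mxE set_itv1 Rintegral_set1 addr0.
have wd : is_derivI w (fun t => drift (z p t)).
  move=> t t0 i; split; first exact: id.
  by rewrite w0 mxE.
have zw (t : R) i : 0 <= t -> z p t i ord0 = w t i ord0.
  move=> t0.
  pose s N : R := (grid N t)%:R / N.+1%:R.
  have s0 N : 0 <= s N by rewrite mulr_ge0.
  have st : s @ \oo --> t by exact: cvg_grid.
  have zs : (fun N => (z p \o s) N i ord0) @ \oo --> z p t i ord0.
    exact: (inW_seq_cont (Wz p) t0 s0 st).
  have ws : (fun N => w (s N) i ord0) @ \oo --> w t i ord0.
    apply/cvgrPdist_le => e e0.
    have near_t : \forall N \near \oo, `|t - s N| <= e / (K + 1).
      by move/cvgrPdist_le : st; apply; rewrite divr_gt0 // ltr_wpDl.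
    apply: filterS near_t => N; rewrite ler_pdivlMr ?ltr_wpDl // => hN.
    apply: le_trans (is_derivI_lipschitz (i := i) (K := K) wd _ (s0 N) t0) _.
      by move=> r r0; exact: zK.
    by apply: le_trans hN; rewrite mulrC ler_wpM2l // lerDl.
  have E : (fun N => (z p \o s) N i ord0) = (fun N => w (s N) i ord0).
    (* Time [0] is treated apart: the defect is known to vanish only at positive grid times. *)
    apply/funext => N /=; rewrite /s; case: (grid N t) => [|k].
      by rewrite mul0r w0.
    have := hN1 p N1p (k, N, i) Np; rewrite /= /defect mxE => /eqP.
    by rewrite subr_eq0 subr_eq addrC => /eqP.
  rewrite E in zs; exact: (@cvg_unique _ (@Rhausdorff R) _ _ _ _ zs ws).
move=> t t0 i; have [h1 h2] := wd t t0 i; split => //.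
by rewrite (zw t i t0) (zw 0 i (lexx 0)).
Qed.

End Solution.

Lemma ensemble_flow (y : T -> R -> 'cV[R]_n) : ensemble_sol f B P pt MY F y ->
  exists N, [/\ measurable N, P N = 0%E, forall p, ~ N p -> flow (2 * MY) (y p) &
    forall (t : R) i, 0 <= t -> measurable_fun (~` N) (fun p => y p t i ord0)].
Proof.
move=> sol; have [sm bd] := sol.1.
have Wae : {ae P, forall p, inW (y p)} by apply: (ae_imp bd) => p [].
have [N1 [mN1 PN1 W1 m1]] := strongly_meas_pointwise embed sm Wae.
have [N2 [mN2 PN2 h2]] := ae_null_cover bd.
pose N0 := N1 `|` N2.
have mN0 : measurable N0 by exact: measurableU.
have PN0 : P N0 = 0%E by exact: null_set_setU.
have [K hK] := seq_cont_bounded (Ci * (2 * MY)) drift_seq_cont.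
have W0 p : ~ N0 p -> inW (y p) by move=> /not_orP[/W1].
have b0 p : ~ N0 p -> Wnorm (y p) <= 2 * MY by move=> /not_orP[_ /h2[]].
have m0 (t : R) i : 0 <= t -> measurable_fun (~` N0) (fun p => y p t i ord0).
  move=> t0; apply: (measurable_funS _ _ (m1 t i t0)); first exact: measurableC.
  by apply: subsetC => p; left.
have hK' (x : 'cV[R]_n) : (forall i, `|x i ord0| <= Ci * (2 * MY)) ->
    forall i, `|drift x i ord0| <= `|K|.
  by move=> hx i; apply: le_trans (hK x hx i) _; exact: ler_norm.
have [N [mN PN N0N hN]] := ensemble_drift sol mN0 PN0 W0 b0 m0 (normr_ge0 K) hK'.
exists N; split => //.
  move=> p Np; have N0p : ~ N0 p by move=> /N0N.
  by split; [exact: W0|exact: b0|exact: hN].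
move=> t i t0; apply: (measurable_funS _ _ (m0 t i t0)); first exact: measurableC.
exact: subsetC.
Qed.

End EnsembleFlow.

(** * Strong measurability from countably many cuts *)

Section CutConvergence.
Variable R : realType.

Lemma cvg_same_cuts (x : nat -> R) (l : R) :
  (forall q : rat, exists m, forall k, (m <= k)%N -> (x k < ratr q) <-> (l < ratr q)) ->
  x @ \oo --> l.
Proof.
move=> h; apply/cvgrPdist_le => e e0.
have [q /andP[lq qe]] : exists q : rat, l < ratr q < l + e.
  by apply: ratr_between; rewrite ltrDl.
have [q' /andP[eq' q'l]] : exists q' : rat, l - e < ratr q' < l.
  by apply: ratr_between; rewrite gtrBl.
have [m hm] := h q; have [m' hm'] := h q'.
exists (maxn m m') => // k /=; rewrite geq_max => /andP[mk m'k].
have x1 : x k < ratr q by apply/(hm k mk).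
have x2 : ratr q' <= x k.
  by rewrite leNgt; apply/negP => /(hm' k m'k) /(lt_trans q'l); rewrite ltxx.
rewrite ler_norml; move: x1 x2 qe eq'; lra.
Qed.

Definition lip_on_I (K : R) (u : R -> R) :=
  forall s t, 0 <= s -> 0 <= t -> `|u t - u s| <= K * `|t - s|.

Lemma grid_approx (t e : R) : 0 <= t -> 0 < e ->
  exists k N : nat, `|t - k%:R / N.+1%:R| < e.
Proof.
move=> t0 e0.
have st := @cvg_grid R t t0.
have [N _ hN] : \forall N \near \oo, `|t - (grid N t)%:R / N.+1%:R| < e.
  by move/cvgrPdist_lt : st; apply.
by exists (grid N t), N; exact: (hN N (leqnn N)).
Qed.

(** The grid point is within [e / (4 * (K + 1))] of [t] and depends on neither [u] nor [v]; each of
    the two Lipschitz increments costs [e / 4]. *)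
Lemma lip_grid_close (K t e : R) : 0 <= K ->
  0 <= t -> 0 < e -> exists k N : nat, forall u v, lip_on_I K u -> lip_on_I K v ->
  `|u (k%:R / N.+1%:R) - v (k%:R / N.+1%:R)| <= e / 2 -> `|u t - v t| <= e.
Proof.
move=> K0 t0 e0; have K1 : 0 < 4 * (K + 1) by rewrite mulr_gt0 // ltr_wpDl.
have [k [N hkN]] := @grid_approx t (e / (4 * (K + 1))) t0 (divr_gt0 e0 K1).
exists k, N => u v lu lv; set b := k%:R / N.+1%:R => uvb.
have b0 : 0 <= b by rewrite mulr_ge0.
have Kb : K * `|t - b| <= e / 4.
  have : `|t - b| * (4 * (K + 1)) < e by rewrite -ltr_pdivlMr.
  have : 0 <= `|t - b| by [].
  nra.
have h1 := lu b t b0 t0; have h2 := lv b t b0 t0.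
have -> : u t - v t = (u t - u b) + (u b - v b) - (v t - v b) by ring.
apply: le_trans (ler_normB _ _) _; apply: le_trans (lerD (ler_normD _ _) (lexx _)) _.
lra.
Qed.

Lemma lip_grid_cvg (K : R) (u_ : nat -> R -> R) (u : R -> R) : 0 <= K ->
  (forall j, lip_on_I K (u_ j)) -> lip_on_I K u ->
  (forall k N : nat, (fun j => u_ j (k%:R / N.+1%:R)) @ \oo --> u (k%:R / N.+1%:R)) ->
  forall t, 0 <= t -> (fun j => u_ j t) @ \oo --> u t.
Proof.
move=> K0 lu_ lu ul t t0; apply/cvgrPdist_le => e e0.
have [k [N hkN]] := lip_grid_close K0 t0 e0.
have near_b : \forall j \near \oo, `|u (k%:R / N.+1%:R) - u_ j (k%:R / N.+1%:R)| <= e / 2.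
  by move/cvgrPdist_le : (ul k N); apply; rewrite divr_gt0.
by apply: filterS near_b => j; exact: hkN.
Qed.

Lemma lip_grid_is_cvg (K : R) (u_ : nat -> R -> R) : 0 <= K ->
  (forall j, lip_on_I K (u_ j)) ->
  (forall k N : nat, cvgn (fun j => u_ j (k%:R / N.+1%:R))) ->
  forall t, 0 <= t -> cvgn (fun j => u_ j t).
Proof.
move=> K0 lu_ ul t t0; apply/cauchy_cvgP/cauchy_exP => e e0.
have e2 : 0 < e / 2 by rewrite divr_gt0.
have [k [N hkN]] := lip_grid_close K0 t0 e2.
(* Two distances of [e / 8] to the grid limit add up to [e / 4], half of the tolerance [e / 2] given
   to [lip_grid_close]. *)
have e8 : 0 < e / 2 / 2 / 2 by rewrite !divr_gt0.
have /cvgrPdist_le /(_ _ e8) [m _ hm] := ul k N.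
exists (u_ m t); exists m => // j /= mj; rewrite /ball /=.
apply: (@le_lt_trans _ _ (e / 2)); last by rewrite ltr_pdivrMr // ltr_pMr // ltr1n.
apply: hkN => //.
have h1 := hm m (leqnn m); have h2 := hm j mj.
set l := lim _ in h1 h2.
have -> : u_ m (k%:R / N.+1%:R) - u_ j (k%:R / N.+1%:R) =
  (l - u_ j (k%:R / N.+1%:R)) - (l - u_ m (k%:R / N.+1%:R)) by ring.
apply: le_trans (ler_normB _ _) _; move: h1 h2 => /=; lra.
Qed.

End CutConvergence.

Section StrongMeasurability.
Context (R : realType) (n : nat) (d : measure_display) (T : measurableType d).
Variable P : probability T R.
Local Notation leb := (@lebesgue_measure R).
Local Notation I0 := (@Iset R).
Variables (G : 'cV[R]_n -> 'cV[R]_n) (y : T -> R -> 'cV[R]_n) (K : R).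
Hypothesis cG : seq_cont G.
Hypothesis Wy : forall p, inW (y p).
Hypothesis yd : forall p, is_derivI (y p) (fun t => G (y p t)).
Hypothesis K0 : 0 <= K.
Hypothesis GK : forall p (t : R) i, 0 <= t -> `|G (y p t) i ord0| <= K.
Hypothesis my : forall (t : R) i, 0 <= t -> measurable_fun setT (fun p => y p t i ord0).

(** The derivative of a path is [G] along it, so the energy density is continuous in time and its
    parameter integral is measurable. *)
Let mW2 : measurable_fun setT (fun p => Wnorm (y p) ^+ 2).
Proof.
pose h p t := enorm2 (y p t) + enorm2 (G (y p t)).
have mW : measurable_fun setT (fun p => Wint (y p) (fun t => G (y p t))).
  apply: (@measurable_fun_integral_param _ T R h).
  - move=> t t0; apply: measurable_funD; apply: measurable_sum => i;
    apply: measurable_funX; first exact: my.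
    by apply: (seq_cont_measurable i cG) => j; exact: my.
  - move=> p t s t0 s0 st.
    have ys : mx_cvg (y p \o s) (y p t) := inW_seq_cont (Wy p) t0 s0 st.
    by apply: cvgD; apply: cvg_enorm2 => //; exact: (cG ys).
  - exact: Iset_measurable.
  - by [].
  - by move=> p t _; rewrite addr_ge0 // enorm2_ge0.
rewrite (_ : (fun p => _) = fine \o (fun p => Wint (y p) (fun t => G (y p t)))).
  by apply: measurableT_comp => //; exact: fine_measurable.
by apply/funext => p /=; rewrite -(Wnorm_sqr (Wy p) (yd p)).
Qed.

Local Notation index := ('I_n * nat * nat * rat + rat)%type.

(** Two families of cuts: values at grid times, which give pointwise convergence, and the squared
    norm, which gives the convergence of norms required by [Wnorm_sub_cvg]. *)
Let E (a : nat) : set T := match unpickle a : option index with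
  | Some (inl (i, k, N, q)) => [set p | y p (k%:R / N.+1%:R) i ord0 < ratr q]
  | Some (inr q) => [set p | Wnorm (y p) ^+ 2 < ratr q]
  | None => set0 end.

Let mE a : measurable (E a).
Proof.
rewrite /E; case: (unpickle a : option index) => [[[[[i k] N] q]|q]|] //.
  by apply: (@measurable_lt_set _ T R _ (fun=> ratr q)) => //; apply: my; rewrite mulr_ge0.
by apply: (@measurable_lt_set _ T R _ (fun=> ratr q)).
Qed.

Let cell M (p : T) : {ffun 'I_M -> bool} := [ffun a : 'I_M => `[< E a p >]].
(** For [c = cell M p] the set contains [p], so the default [point] is only met on empty cells. *)
Let rep M (c : {ffun 'I_M -> bool}) : T := xget point [set p | cell M p = c].
Let approx M (p : T) : T := rep (cell M p).

Let approxE M p : cell M (approx M p) = cell M p.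
Proof.
rewrite /approx /rep; case: xgetP => [q -> //|/(_ p)]; by case.
Qed.

Let approx_eventually p a : forall M, (a < M)%N -> E a (approx M p) <-> E a p.
Proof.
move=> M aM; have /ffunP /(_ (Ordinal aM)) := approxE M p.
rewrite !ffunE /= => e; split => /asboolP; first by rewrite e => /asboolP.
by rewrite -e => /asboolP.
Qed.

Let ly p i : lip_on_I K (fun t => y p t i ord0).
Proof.
by move=> s t s0 t0; apply: (is_derivI_lipschitz (yd p)) => // r r0; exact: GK.
Qed.

Let approx_cvg p (t : R) : 0 <= t -> mx_cvg (fun M => y (approx M p) t) (y p t).
Proof.
move=> t0 i j; rewrite ord1.
apply: (@lip_grid_cvg _ K (fun M t => y (approx M p) t i ord0)
  (fun t => y p t i ord0)) => // k N.
apply: cvg_same_cuts => q; exists (pickle (inl (i, k, N, q) : index)).+1 => M hM.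
by have := approx_eventually p hM; rewrite /E pickleK.
Qed.

Let approx_Wnorm p : (fun M => Wnorm (y (approx M p))) @ \oo --> Wnorm (y p).
Proof.
have sq : (fun M => Wnorm (y (approx M p)) ^+ 2) @ \oo --> Wnorm (y p) ^+ 2.
  apply: cvg_same_cuts => q; exists (pickle (inr q : index)).+1 => M hM.
  by have := approx_eventually p hM; rewrite /E pickleK.
have sqrtW p' : Wnorm (y p') = Num.sqrt (Wnorm (y p') ^+ 2).
  by rewrite sqrtr_sqr ger0_norm // sqrtr_ge0.
rewrite sqrtW (_ : (fun M => _) = (fun M => Num.sqrt (Wnorm (y (approx M p)) ^+ 2))).
  exact: (continuous_cvg _ (@sqrt_continuous R _) sq).
by apply/funext => M; exact: sqrtW.
Qed.

(* The simple approximations replace [p] by a representative of the finite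
   partition generated by the first [M] cuts. *)
Lemma strongly_meas_solution : strongly_meas P y.
Proof.
exists (fun M p => y (approx M p)); split; last split; last split.
- move=> M; apply: (@sub_finite_set _ _ ((fun c => y (rep c)) @` [set: {ffun 'I_M -> bool}])).
    by move=> _ [p _ <-]; exists (cell M p).
  by apply: finite_image; exact: finite_finset.
- move=> M v.
  rewrite (_ : _ @^-1` _ = \bigcup_(c in [set c | y (rep c) = v]) (cell M @^-1` [set c])).
    apply: fin_bigcup_measurable; first exact: finite_finset.
    move=> c _.
    rewrite (_ : _ @^-1` _ = \bigcap_(a in [set: 'I_M])
        (if c a then E a else ~` E a)).
      apply: fin_bigcap_measurable => [|a _]; first exact: finite_finset.
      by case: (c a) => //; exact: measurableC.
    apply/seteqP; split => [p /= <- a _|p h].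
      by rewrite ffunE; case: asboolP.
    apply/ffunP => a; rewrite ffunE; have := h a Logic.I.
    by case: (c a) => /= Ea; apply/asboolP.
  apply/seteqP; split => [p /= yv|p [c /= yc pc]]; first by exists (cell M p).
  by rewrite /approx pc.
- by move=> M p; exact: Wy.
- apply: aeW => p.
  apply: (@Wnorm_sub_cvg R n (fun M => y (approx M p)) (fun M t => G (y (approx M p) t))
     (y p) (fun t => G (y p t))) => //.
  + by move=> t t0; exact: approx_cvg.
  + by move=> t t0; exact: (cG (@approx_cvg p t t0)).
Qed.

End StrongMeasurability.

(** * Limits of ensemble solutions *)

Section InitialCondition.
Context (R : realType) (n m : nat) (d : measure_display) (T : measurableType d).
Variables (f : 'cV[R]_n -> 'cV[R]_n) (B : 'M[R]_(n, m)) (F : 'cV[R]_n -> 'cV[R]_m).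
Variables (P : probability T R) (pt : T -> 'cV[R]_n) (MY : R).

(** The residual of a flow vanishes at almost every time. As [phi] is arbitrary the integrand may
    fail to be measurable, hence the passage through [integral_eq0_of_null]. *)
Lemma aform_flow (y phi : R -> 'cV[R]_n) y0 c : flow f B F c y ->
  aform f B F y y0 phi = edot (y 0 - y0) (phi 0).
Proof.
move=> [Wy _ yd]; rewrite /aform -[RHS]add0r; congr (_ + _).
rewrite /l2dot.
have [M [mM M0 hM]] := ae_null_cover (is_derivI_ae (WdotP Wy).1 yd).
pose h (t : R) := edot (Wdot y t - f (y t) - B *m F (y t)) (phi t).
rewrite integral_mkcond (_ : _ \_ _ = (fun t => ((h \_ (@Iset R)) t)%:E)); last first.
  by apply/funext => t; rewrite !patchE; case: ifP.
have h0 t : ~ M t -> (h \_ (@Iset R)) t = 0.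
  move=> Mt; rewrite patchE; case: ifPn => // /set_mem It.
  rewrite /h (hM t Mt It) /drift (_ : _ - _ - _ = 0).
    by apply: big1 => i _; rewrite mxE mul0r.
  by rewrite addrAC addrK subrr.
rewrite integral_eq0_of_null // => A c' mA c0 hA;
  apply: (subset_measure0 mA mM _ M0) => t At; apply: contrapT => Mt;
  by have := hA t At; rewrite h0 // ?oppr0 leNgt c0.
Qed.

(** Testing with [s] times the indicator of [A] times [Phi] leaves an integrand that is nonnegative
    everywhere and at least [c] on [A], so that [integral_eq0_null] applies. *)
Lemma ensemble_initial (y Phi : T -> R -> 'cV[R]_n) (N A : set T) (s c : R) :
  ensemble_sol f B P pt MY F y ->
  (forall p, ~ N p -> flow f B F (2 * MY) (y p)) -> L2W P Phi ->
  measurable A -> (forall p, A p -> ~ N p) -> `|s| <= 1 -> 0 < c ->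
  (forall p, A p -> c <= s * edot (y p 0 - pt p) (Phi p 0)) -> P A = 0%E.
Proof.
move=> sol fl LP mA AN s1 c0 hA.
have int0 := sol.2 _ (indic_sign_L2W mA s1 LP).
pose a p := aform f B F (y p) (pt p) (fun t => (s * \1_A p) *: Phi p t).
have on_A p : A p -> a p = s * edot (y p 0 - pt p) (Phi p 0).
  move=> Ap; rewrite /a (aform_flow _ _ (fl p (AN p Ap))) indicE mem_set // mulr1.
  by rewrite /edot mulr_sumr; apply: eq_bigr => i _; rewrite !mxE mulrCA.
have off_A p : ~ A p -> a p = 0.
  move=> nA; rewrite /a indicE memNset // mulr0.
  by under eq_fun do rewrite scale0r; rewrite aform0.
apply: (@integral_eq0_null _ T R P a A c _ mA c0 _ int0).
  move=> p; have [Ap|/off_A ->//] := pselect (A p).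
  by rewrite on_A // (le_trans (ltW c0)) // hA.
by move=> p Ap; rewrite on_A // hA.
Qed.

End InitialCondition.

Lemma cut_limit_measurable (R : realType) (d : measure_display) (T : measurableType d)
    (g : T -> R) (b : rat -> set T) :
  (forall q, measurable (b q)) ->
  (forall p r, g p < r <-> exists2 q : rat, b q p & ratr q < r) ->
  measurable_fun setT g.
Proof.
move=> mb hg _; apply: (measurability _ (RGenInftyO.measurableE R)) => //.
move=> _ [_ [r ->] <-]; rewrite setTI.
rewrite (_ : _ @^-1` _ = \bigcup_q (if ratr q < r then b q else set0)).
  by apply: bigcupT_measurable_rat => q; case: ifP.
apply/seteqP; split => p /=; rewrite in_itv /=.
  by move=> /hg[q bq qr]; exists q => //; rewrite qr.
move=> [q _]; case: ifP => // qr bq; apply/hg; by exists q.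
Qed.

(** * Limits of flows along subsequences depending on the parameter *)

Section LimitSolution.
Context (R : realType) (n m : nat) (d : measure_display) (T : measurableType d).
Local Notation leb := (@lebesgue_measure R).
Local Notation I0 := (@Iset R).
Variables (f : 'cV[R]_n -> 'cV[R]_n) (B : 'M[R]_(n, m)) (Q : 'M[R]_n) (beta : R).
Variables (P : probability T R) (pt : T -> 'cV[R]_n) (Ci MY : R).
Hypothesis Ci0 : 0 < Ci.
Hypothesis embed : forall y : R -> 'cV[R]_n, inW y ->
  forall t, 0 <= t -> enorm (y t) <= Ci * Wnorm y.
Hypotheses (cf : seq_cont f) (f0 : f 0 = 0) (beta0 : 0 < beta).
Variables (F_ : nat -> 'cV[R]_n -> 'cV[R]_m) (F : 'cV[R]_n -> 'cV[R]_m).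
Hypotheses (cF_ : forall k, seq_cont (F_ k)) (cF : seq_cont F).
Hypothesis F_0 : forall k, F_ k 0 = 0.
(** Continuous convergence, along every subsequence since the one in use varies with [p]. *)
Hypothesis F_cvg : forall (kap : nat -> nat) x l,
  (forall j, (kap j < kap j.+1)%N) -> mx_cvg x l ->
  mx_cvg (fun j => F_ (kap j) (x j)) (F l).
Variable K : R.
Hypothesis K0 : 0 <= K.
Hypothesis driftK : forall k (x : 'cV[R]_n), (forall i, `|x i ord0| <= Ci * (2 * MY)) ->
  forall i, `|drift f B (F_ k) x i ord0| <= K.

Section Flows.
Variable z : nat -> T -> R -> 'cV[R]_n.
Hypothesis fl : forall k p, flow f B (F_ k) (2 * MY) (z k p).
Hypothesis mz : forall k (t : R) i, 0 <= t -> measurable_fun setT (fun p => z k p t i ord0).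

Let Wz k p : inW (z k p). Proof. by have [] := fl k p. Qed.
Let zMY k p : Wnorm (z k p) <= 2 * MY. Proof. by have [] := fl k p. Qed.
Let zd k p : is_derivI (z k p) (fun t => drift f B (F_ k) (z k p t)).
Proof. by have [] := fl k p. Qed.

Let zC k p (t : R) i : 0 <= t -> `|z k p t i ord0| <= Ci * (2 * MY).
Proof. by move=> t0; exact: (inW_entry_bound Ci0 embed (Wz k p) (zMY k p)). Qed.

Let zK k p (t : R) i : 0 <= t -> `|drift f B (F_ k) (z k p t) i ord0| <= K.
Proof. by move=> t0; apply: driftK => j; exact: zC. Qed.

Let lz k p i : lip_on_I K (fun t => z k p t i ord0).
Proof.
by move=> s t s0 t0; apply: (is_derivI_lipschitz (zd k p)) => // r r0; exact: zK.
Qed.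

Let J k p : \bar R := Jcost Q beta (z k p) (fun t => F_ k (z k p t)).

Let running (G : 'cV[R]_n -> 'cV[R]_m) (x : 'cV[R]_n) : R :=
  enorm2 (Q *m x) + beta * enorm2 (G x).

Let running_ge0 G x : 0 <= running G x.
Proof. by rewrite addr_ge0 ?mulr_ge0 ?enorm2_ge0 // ltW. Qed.

Let cvg_running (G_ : nat -> 'cV[R]_n -> 'cV[R]_m) G x l :
  mx_cvg x l -> mx_cvg (fun j => G_ j (x j)) (G l) ->
  (fun j => running (G_ j) (x j)) @ \oo --> running G l.
Proof.
move=> xl Gl; apply: cvgD; first by apply: cvg_enorm2; apply: mx_cvgM => //; exact: mx_cvg_cst.
by apply: cvgMr; exact: cvg_enorm2.
Qed.

Let J_ge0 k p : (0 <= J k p)%E.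
Proof.
rewrite mule_ge0 ?lee_fin ?divr_ge0 //.
by apply: integral_ge0 => t _; rewrite lee_fin running_ge0.
Qed.

Let running_contI k p : seq_contI (fun t => running (F_ k) (z k p t)).
Proof.
move=> t s t0 s0 st.
have zs : mx_cvg (z k p \o s) (z k p t) by exact: inW_seq_cont.
by apply: (@cvg_running (fun=> F_ k)) => //; exact: (cF_ zs).
Qed.

Let mJ k : measurable_fun setT (J k).
Proof.
apply: measurable_funeM.
apply: (@measurable_fun_integral_param _ T R (fun p t => running (F_ k) (z k p t))).
- move=> t t0; apply: measurable_funD.
    apply: measurable_sum => i; apply: measurable_funX.
    apply: (@seq_cont_measurable _ _ _ _ _ (mulmx Q) (fun p => z k p t)) => [x l xl|j].
      by apply: mx_cvgM => //; exact: mx_cvg_cst.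
    exact: mz.
  apply: measurable_funM => //; apply: measurable_sum => i; apply: measurable_funX.
  by apply: (@seq_cont_measurable _ _ _ _ _ (F_ k) (fun p => z k p t) i (@cF_ k)) => j; exact: mz.
- by move=> p; exact: running_contI.
- exact: Iset_measurable.
- by [].
- by move=> p t _; exact: running_ge0.
Qed.

Let X p : \bar R := limn_einf (fun k => J k p).

Let X_ge0 p : (0 <= X p)%E.
Proof.
rewrite /X limn_einf_sup_einfs; apply: le_ereal_sup_tmp; exists (einfs (J ^~ p) 0) => //.
by apply: le_ereal_inf_tmp => _ [k _ <-]; exact: J_ge0.
Qed.

Let mX : measurable_fun setT X.
Proof.
rewrite (_ : X = (fun p => - limn_esup (fun k => - J k p))%E) //.
apply: measurableT_comp => //; apply: measurable_fun_limn_esup => k.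
exact: measurableT_comp.
Qed.

(** The slack [1/(j+1)] vanishes along the diagonal sequence; the target [X p] is the lower limit
    over all [k], so it does not depend on the extraction. *)
Let D (j k : nat) : set T := [set p | (J k p <= X p + j.+1%:R^-1%:E)%E].

Let mD j k : measurable (D j k).
Proof.
rewrite -[X in measurable X]setTI; apply: emeasurable_fun_le => //.
by apply: emeasurable_funD.
Qed.

Let D_noninc j k p : D j.+1 k p -> D j k p.
Proof.
move=> h; apply: le_trans h _; apply: leeD2l.
by rewrite lee_fin lef_pV2 ?posrE // ler_nat.
Qed.

Let D_io p j l : exists2 k, (l <= k)%N & D j k p.
Proof.
apply: contrapT => nk.
have lt k : (l <= k)%N -> (X p + j.+1%:R^-1%:E < J k p)%E.
  move=> lk; rewrite ltNge; apply/negP => h; by apply: nk; exists k.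
have : (X p + j.+1%:R^-1%:E <= X p)%E.
  rewrite {2}/X limn_einf_sup_einfs; apply: le_ereal_sup_tmp.
  exists (einfs (J ^~ p) l) => //.
  by apply: le_ereal_inf_tmp => _ [k /= lk <-]; apply: ltW; exact: lt.
(* If [X p] is [+oo], then [J k p] would have to exceed [+oo]. *)
case: (X p) (X_ge0 p) (lt l (leqnn l)) => [r| |] //= _.
- by move=> _; rewrite -EFinD lee_fin gerDl leNgt invr_gt0 ltr0n.
- by rewrite addye // ltNge leey.
Qed.

Local Notation index := ('I_n * nat * nat * rat)%type.

Let E (a k : nat) : set T := match unpickle a : option index with
  | Some (i, b, N, q) => [set p | z k p (b%:R / N.+1%:R) i ord0 < ratr q]
  | None => set0 end.

Let mE a k : measurable (E a k).
Proof.
rewrite /E; case: (unpickle a : option index) => [[[[i b] N] q]|] //.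
by apply: (@measurable_lt_set _ T R _ (fun=> ratr q)) => //; apply: mz; rewrite mulr_ge0.
Qed.

Let choice_at i b N (q : rat) : set T := sel_choice D E (pickle ((i, b, N, q) : index)).

Let kap p : nat -> nat := sval (cid (selection E D_noninc D_io p)).

Let kapP p : [/\ forall j, (kap p j < kap p j.+1)%N, forall j, D j (kap p j) p &
  forall a j, (a < j)%N -> E a (kap p j) p <-> sel_choice D E a p].
Proof. by rewrite /kap; case: cid. Qed.

Let cuts p i b N (q : rat) : exists l, forall j, (l <= j)%N ->
  (z (kap p j) p (b%:R / N.+1%:R) i ord0 < ratr q) <-> choice_at i b N q p.
Proof.
have [_ _ h] := kapP p; exists (pickle ((i, b, N, q) : index)).+1 => j hj.
by have := h _ _ hj; rewrite /E pickleK.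
Qed.

Let grid_ge0 (b N : nat) : 0 <= b%:R / N.+1%:R :> R.
Proof. by rewrite mulr_ge0. Qed.

Let grid_cvg p i b N : (fun j => z (kap p j) p (b%:R / N.+1%:R) i ord0) @ \oo -->
  cut_limit R (choice_at i b N ^~ p).
Proof.
apply: (@cvg_cut_limit _ _ (Ci * (2 * MY))); first by move=> j; exact: zC.
exact: cuts.
Qed.

(** Cuts secure the limit at grid times, the common Lipschitz bound at the others. *)
Definition limit_sol p (t : R) : 'cV[R]_n :=
  \col_i limn (fun j => z (kap p j) p t i ord0).

Local Notation y := limit_sol.

Let y_cvg p (t : R) : 0 <= t -> mx_cvg (fun j => z (kap p j) p t) (y p t).
Proof.
move=> t0 i o; rewrite ord1 mxE.
apply: (@lip_grid_is_cvg _ K (fun j t => z (kap p j) p t i ord0)) => //.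
by move=> b N; apply/cvg_ex; eexists; exact: grid_cvg.
Qed.

Let drift_cvg p (t : R) : 0 <= t ->
  mx_cvg (fun j => drift f B (F_ (kap p j)) (z (kap p j) p t)) (drift f B F (y p t)).
Proof.
move=> t0; have [kincr _ _] := kapP p; have yc := @y_cvg p t t0.
apply: mx_cvgD; first exact: (cf yc).
by apply: mx_cvgM; [exact: mx_cvg_cst|exact: F_cvg].
Qed.

Let yd p : is_derivI (y p) (fun t => drift f B F (y p t)).
Proof.
apply: (@is_derivI_limit _ _ (fun j => z (kap p j) p)
  (fun j t => drift f B (F_ (kap p j)) (z (kap p j) p t)) _ _ K).
- by move=> j; exact: zd.
- by move=> j t i; exact: zK.
- by move=> t; exact: y_cvg.
- by move=> t; exact: drift_cvg.
Qed.

Let MY_ge0 : 0 <= 2 * MY.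
Proof. by apply: le_trans (zMY 0 point); exact: sqrtr_ge0. Qed.

(** Fatou's lemma in time carries the norm bound to the limit before its membership in W is
    known. *)
Let yW p : (Wint (y p) (fun t => drift f B F (y p t)) <= ((2 * MY) ^+ 2)%:E)%E.
Proof.
apply: le_trans (@Wint_fatou _ _ (fun j => z (kap p j) p)
  (fun j t => drift f B (F_ (kap p j)) (z (kap p j) p t)) _ _ _ _ _ _) _.
- by move=> j; exact: Wz.
- by move=> j; exact: zd.
- by move=> t; exact: y_cvg.
- by move=> t; exact: drift_cvg.
apply: (@limn_einf_le_cvg _ _ (fun=> ((2 * MY) ^+ 2)%:E)); last exact: cvg_cst.
move=> j; rewrite -(Wnorm_sqr (Wz _ p) (zd _ p)) lee_fin.
by rewrite ler_sqr ?nnegrE ?sqrtr_ge0.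
Qed.

Lemma limit_flow p : flow f B F (2 * MY) (y p).
Proof.
have Wy : inW (y p).
  apply: (inW_Wint _ (yd p)); last exact: le_lt_trans (yW p) (ltry _).
  move=> i; apply: (@measurable_fun_cvg _ _ _ _ (fun j t => z (kap p j) p t i ord0)).
    by move=> j; exact: ((Wz (kap p j) p).1 i).1.
  by move=> t t0; exact: y_cvg.
split => //; have := yW p; rewrite -(Wnorm_sqr Wy (yd p)) lee_fin.
by rewrite ler_sqr ?nnegrE ?sqrtr_ge0.
Qed.

(** At grid times the limit is a cut limit whose cuts are the measurable sets [choice_at]; other
    times follow by continuity of the paths. *)
Lemma limit_measurable (t : R) i : 0 <= t -> measurable_fun setT (fun p => y p t i ord0).
Proof.
move=> t0.
have my b N : measurable_fun setT (fun p => y p (b%:R / N.+1%:R) i ord0).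
  apply: (@cut_limit_measurable _ _ _ _ (choice_at i b N)).
    by move=> q; exact: sel_choice_measurable.
  move=> p r.
  have -> : y p (b%:R / N.+1%:R) i ord0 = cut_limit R (choice_at i b N ^~ p).
    have yc : (fun j => z (kap p j) p (b%:R / N.+1%:R) i ord0) @ \oo -->
        y p (b%:R / N.+1%:R) i ord0 by apply: y_cvg; exact: grid_ge0.
    have gc := @grid_cvg p i b N.
    exact: (@cvg_unique _ (@Rhausdorff R) _ _ _ _ yc gc).
  apply: (@cut_limit_lt _ (fun j => z (kap p j) p (b%:R / N.+1%:R) i ord0) (Ci * (2 * MY))).
    by move=> j; exact: zC.
  exact: cuts.
apply: (@measurable_fun_cvg _ _ _ _
  (fun N p => y p ((grid N t)%:R / N.+1%:R) i ord0)) => // p _.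
have [Wy _ _] := limit_flow p.
exact: (inW_seq_cont Wy t0 (fun N => grid_ge0 (grid N t) N) (cvg_grid t0)).
Qed.

(** Level [D j] is met at the [j]-th chosen index, so the costs along [kap p] have lower limit at
    most [X p]; Fatou's lemma in time does the rest. *)
Lemma limit_cost p : (Jcost Q beta (y p) (fun t => F (y p t)) <= X p)%E.
Proof.
have [kincr Dk _] := kapP p.
have inv0 : (fun j => (j.+1%:R^-1)%:E) @ \oo --> (0%:E : \bar R).
  by apply: cvg_EFin; [exact: nearW|exact: cvg_harmonic].
have le_lim : (limn_einf (fun j => J (kap p j) p) <= X p)%E.
  apply: (@limn_einf_le_cvg _ _ (fun j => X p + j.+1%:R^-1%:E)%E) => //.
  rewrite -[X in _ --> X]adde0; apply: cvgeD => //; first by rewrite fin_num_adde_defl.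
  exact: cvg_cst.
apply: le_trans le_lim.
rewrite /Jcost.
have half0 : 0 <= 1 / 2 :> R by rewrite divr_ge0.
have mrun k : measurable_fun I0 (fun t => (running (F_ k) (z k p t))%:E).
  by apply/measurable_EFinP; apply: seq_contI_measurable; exact: running_contI.
rewrite -ge0_integralZl_EFin //; first last.
- apply/measurable_EFinP; apply: (@measurable_fun_cvg _ _ _ _
    (fun j t => running (F_ (kap p j)) (z (kap p j) p t))).
    by move=> j; apply/measurable_EFinP; exact: mrun.
  by move=> t t0; apply: cvg_running; [exact: y_cvg|apply: F_cvg => //; exact: y_cvg].
- by move=> t _; rewrite lee_fin running_ge0.
have JE j : J (kap p j) p =
    (\int[leb]_(t in I0) ((1 / 2)%:E * (running (F_ (kap p j)) (z (kap p j) p t))%:E))%E.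
  rewrite ge0_integralZl_EFin //; last exact: mrun.
  by move=> t _; rewrite lee_fin running_ge0.
have -> : (fun j => J (kap p j) p) = (fun j => \int[leb]_(t in I0)
    ((1 / 2)%:E * (running (F_ (kap p j)) (z (kap p j) p t))%:E))%E.
  by apply/funext => j; exact: JE.
apply: (@fatou_cvg _ _ _ leb I0
  (fun j t => (1 / 2)%:E * (running (F_ (kap p j)) (z (kap p j) p t))%:E)%E) => //.
- by move=> j; apply: measurable_funeM; exact: mrun.
- by move=> j t _; rewrite mule_ge0 // lee_fin running_ge0.
- move=> t t0; rewrite -EFinM; apply: cvg_EFin; first exact: nearW.
  by apply: cvgMr; apply: cvg_running; [exact: y_cvg|apply: F_cvg => //; exact: y_cvg].
Qed.

(** Since [X] is the lower limit over all [k], Fatou's lemma in [p] is applied to the original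
    sequence, and the subsequences depending on [p] no longer appear. *)
Lemma limit_jcost : (jcost Q beta P F y <= limn_einf (fun k => \int[P]_p J k p))%E.
Proof.
apply: (@le_trans _ _ (\int[P]_p X p)%E); last by apply: fatou.
apply: ge0_le_lower_integral => p _; last exact: limit_cost.
rewrite mule_ge0 ?lee_fin ?divr_ge0 //.
by apply: integral_ge0 => t _; rewrite lee_fin running_ge0.
Qed.

Lemma limit_exists : exists y' : T -> R -> 'cV[R]_n,
  [/\ forall p, flow f B F (2 * MY) (y' p),
      forall (t : R) i, 0 <= t -> measurable_fun setT (fun p => y' p t i ord0),
      forall p, exists ka : nat -> nat, mx_cvg (fun j => z (ka j) p 0) (y' p 0) &
      (jcost Q beta P F y' <= limn_einf (fun k =>
        \int[P]_p Jcost Q beta (z k p) (fun t => F_ k (z k p t))))%E].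
Proof.
exists y; split.
- exact: limit_flow.
- exact: limit_measurable.
- by move=> p; exists (kap p); exact: y_cvg.
- exact: limit_jcost.
Qed.

End Flows.

(** * From flows back to ensemble solutions *)

Section Ensembles.
Variable y_ : nat -> T -> R -> 'cV[R]_n.
Hypothesis sol : forall k, ensemble_sol f B P pt MY (F_ k) (y_ k).

Let null k : {N | [/\ measurable N, P N = 0%E,
    forall p, ~ N p -> flow f B (F_ k) (2 * MY) (y_ k p) &
    forall (t : R) i, 0 <= t -> measurable_fun (~` N) (fun p => y_ k p t i ord0)]}.
Proof. by apply: cid; exact: (ensemble_flow Ci0 embed cf (@cF_ k) (sol k)). Qed.

Let N := \bigcup_k (sval (null k)).

Let mN : measurable N.
Proof. by apply: bigcupT_measurable => k; case: (null k) => ? []. Qed.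

Let PN : P N = 0%E.
Proof.
apply/(negligibleP P mN); apply: negligible_bigcup => k.
by case: (null k) => ? /= [? ? _ _]; apply/negligibleP.
Qed.

Let fl_off k p : ~ N p -> flow f B (F_ k) (2 * MY) (y_ k p).
Proof.
by move=> Np; have [_ _ h _] := svalP (null k); apply: h => Ap; apply: Np; exists k.
Qed.

Let m_off k (t : R) i : 0 <= t -> measurable_fun (~` N) (fun p => y_ k p t i ord0).
Proof.
move=> t0; have [mA _ _ h] := svalP (null k).
apply: (measurable_funS _ _ (h t i t0)); first exact: measurableC.
by apply: subsetC => p Ap; exists k.
Qed.

Let z k := zero_on N (y_ k).

Let zE k p : ~ N p -> z k p = y_ k p.
Proof. by move=> Np; rewrite /z /zero_on memNset. Qed.

Let z0 k p : N p -> z k p = fun=> 0.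
Proof. by move=> Np; rewrite /z /zero_on mem_set. Qed.

(** On the null set the zero path is a flow, as [0] is an equilibrium of every
    [drift f B (F_ k)]. *)
Let fl k p : flow f B (F_ k) (2 * MY) (z k p).
Proof.
have [Np|Np] := pselect (N p); last by rewrite zE //; exact: fl_off.
rewrite z0 //; split; first exact: inW0.
  rewrite Wnorm0; have [p' /(@fl_off k)[_ + _]] := null_set_nonempty PN.
  by apply: le_trans; exact: sqrtr_ge0.
have -> : drift f B (F_ k) 0 = 0 by rewrite /drift f0 F_0 mulmx0 addr0.
exact: is_derivI0.
Qed.

Let mz k (t : R) i : 0 <= t -> measurable_fun setT (fun p => z k p t i ord0).
Proof. by move=> t0; apply: zero_on_measurable => //; exact: m_off. Qed.

Let cost_ge0 (x : R -> 'cV[R]_n) (u : R -> 'cV[R]_m) : (0 <= Jcost Q beta x u)%E.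
Proof.
rewrite mule_ge0 ?lee_fin ?divr_ge0 //; apply: integral_ge0 => t _.
by rewrite lee_fin addr_ge0 ?mulr_ge0 ?enorm2_ge0 // ltW.
Qed.

Let cost_le k :
  (\int[P]_p Jcost Q beta (z k p) (fun t => F_ k (z k p t)) <= jcost Q beta P (F_ k) (y_ k))%E.
Proof.
apply: ge0_le_lower_integral => p _; first exact: cost_ge0.
have [Np|Np] := pselect (N p); last by rewrite zE.
rewrite z0 // F_0; apply: le_trans (cost_ge0 _ _).
rewrite /Jcost mulmx0 !enorm20 mulr0 addr0.
by rewrite integral0 mule0.
Qed.

Section Constraint.
Variable y : T -> R -> 'cV[R]_n.
Hypothesis fy : forall p, flow f B F (2 * MY) (y p).
Hypothesis my : forall (t : R) i, 0 <= t -> measurable_fun setT (fun p => y p t i ord0).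
Hypothesis cl : forall p, exists ka : nat -> nat, mx_cvg (fun j => z (ka j) p 0) (y p 0).

(* The initial value of the limit is a cluster point of the approximate ones,
   so a set where its pairing with a test function is bounded below is covered
   by countably many such sets for the approximations. *)
Let limit_initial (Phi : T -> R -> 'cV[R]_n) (A : set T) (s c : R) :
  L2W P Phi -> measurable A -> `|s| <= 1 -> 0 < c ->
  (forall p, A p -> c <= s * edot (y p 0 - pt p) (Phi p 0)) -> P A = 0%E.
Proof.
move=> LP mA s1 c0 hA; have [sP [WP _]] := LP.
have [N1 [mN1 PN1 _ m1]] := strongly_meas_pointwise embed sP WP.
pose Phi' := zero_on N1 Phi.
(* In this difference [pt] cancels, so [g k] is measurable although the pairing bounded below on [A]
   need not be. *)
pose g k p := edot (z k p 0 - y p 0) (Phi' p 0).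
have mg k : measurable_fun setT (g k).
  apply: measurable_sum => i; under eq_fun do rewrite !mxE.
  apply: measurable_funM; last by apply: zero_on_measurable => //; exact: m1.
  by apply: measurable_funB; [exact: mz|exact: my].
(* On [Ak k] the pairing for the [k]-th ensemble keeps at least [c / 2] of the lower bound, so
   [ensemble_initial] makes this set null. *)
pose Ak k := (A `&` ~` (N `|` N1)) `&` [set p | `|g k p| <= c / 2].
have mNN : measurable (N `|` N1) by exact: measurableU.
have mAk k : measurable (Ak k).
  apply: measurableI; first by apply: measurableI => //; exact: measurableC.
  apply: (@measurable_le_set _ T R _ (fun=> c / 2)) => //.
  exact: measurableT_comp.
have PAk k : P (Ak k) = 0%E.
  apply: (ensemble_initial (s := s) (c := c / 2) (N := N) (sol k) _ LP (mAk k)).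
  - by move=> p; exact: fl_off.
  - by move=> p [[_ /not_orP[]]].
  - exact: s1.
  - by rewrite divr_gt0.
  - move=> p [[Ap /not_orP[Np N1p]] /= gp]; have := hA p Ap.
    have PE : Phi' p = Phi p by rewrite /Phi' /zero_on memNset.
    have -> : edot (y_ k p 0 - pt p) (Phi p 0) =
        edot (y p 0 - pt p) (Phi p 0) + g k p.
      rewrite /g PE zE // /edot -big_split; apply: eq_bigr => i _ /=.
      by rewrite !mxE -mulrDl; congr (_ * _); ring.
    have : `|s * g k p| <= c / 2.
      by rewrite normrM -[leRHS]mul1r ler_pM.
    rewrite mulrDr ler_norml => /andP[+ _]; lra.
have : P.-negligible ((N `|` N1) `|` \bigcup_k Ak k).
  apply: negligibleU; first by apply/negligibleP => //; exact: null_set_setU.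
  by apply: negligible_bigcup => k; apply/(negligibleP P (mAk k)); exact: PAk.
move=> neg; apply/negligibleP => //; apply: negligibleS neg => p Ap.
have [Np|Np] := pselect ((N `|` N1) p); [by left|right].
have [ka kc] := cl p.
have gc : (fun j => g (ka j) p) @ \oo --> (0 : R).
  have -> : 0 = edot (y p 0 - y p 0) (Phi' p 0).
    by rewrite subrr; apply/esym/big1 => i _; rewrite mxE mul0r.
  by apply: cvg_edot; [apply: mx_cvgB => //; exact: mx_cvg_cst|exact: mx_cvg_cst].
have c2 : 0 < c / 2 by rewrite divr_gt0.
have [j _ hj] : \forall j \near \oo, `|0 - g (ka j) p| <= c / 2.
  by move/cvgrPdist_le : gc; apply.
exists (ka j) => //; split => //=.
by have := hj j (leqnn j); rewrite /= sub0r normrN.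
Qed.

(** Strong measurability comes from the countable cuts; the weak formulation reduces to the initial
    pairing, which is tested with both signs. *)
Lemma limit_ensemble_sol : ensemble_sol f B P pt MY F y.
Proof.
have [K' hK'] := @seq_cont_bounded _ _ _ (drift f B F) (Ci * (2 * MY))
  (@drift_seq_cont _ _ _ f B F cf cF).
have yK p (t : R) i : 0 <= t -> `|drift f B F (y p t) i ord0| <= `|K'|.
  move=> t0; have [Wy yMY _] := fy p.
  apply: le_trans (ler_norm K'); apply: hK' => j.
  exact: (inW_entry_bound Ci0 embed Wy yMY).
split.
  split; last by apply: aeW => p; have [] := fy p.
  apply: (@strongly_meas_solution _ _ _ _ P (drift f B F) y `|K'|) => //.
  - exact: (@drift_seq_cont _ _ _ f B F cf cF).
  - by move=> p; have [] := fy p.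
  - by move=> p; have [] := fy p.
move=> Phi LP; apply: integral_eq0_of_null => A c mA c0 hA.
  apply: (limit_initial (s := 1) LP mA _ c0); first by rewrite normr1.
  by move=> p Ap; rewrite mul1r -(aform_flow _ _ (fy p)); exact: hA.
apply: (limit_initial (s := -1) LP mA _ c0); first by rewrite normrN normr1.
by move=> p Ap; rewrite mulN1r -(aform_flow _ _ (fy p)); exact: hA.
Qed.

End Constraint.

(** The bounds [v] allow the regularizer to be moved to the right-hand side before the limit is
    taken. *)
Lemma limit_ensemble : exists y, ensemble_sol f B P pt MY F y /\
  forall (v : nat -> \bar R) l, (forall k, jcost Q beta P (F_ k) (y_ k) <= v k)%E ->
    v @ \oo --> l -> (jcost Q beta P F y <= l)%E.
Proof.
have [y [fy my cl cost]] := limit_exists fl mz.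
exists y; split; first exact: limit_ensemble_sol.
move=> v l hv vl; apply: le_trans cost _; apply: (limn_einf_le_cvg _ vl) => k.
exact: le_trans (cost_le k) (hv k).
Qed.

End Ensembles.
End LimitSolution.

(** * Existence of a minimizer *)

Section ParameterCompactness.
Variables (R : realType) (N : nat -> nat) (L : nat).

Local Notation index := (nat * nat * nat + nat * nat)%type.

(** All entries as one family over a countable index of natural numbers, so that the index type does
    not depend on the layer; positions outside the architecture read [0]. *)
Let coord (W : weights R N) (b : biases R N) (x : index) : R :=
  match x with
  | inl (k, a, c) => if (k < L)%N then
      match insub a, insub c with Some a', Some c' => W k a' c' | _, _ => 0 end else 0
  | inr (k, a) => if (k < L)%N then
      if insub a is Some a' then b k a' ord0 else 0 else 0
  end.

Lemma parameter_subsequence (W : nat -> weights R N) (b : nat -> biases R N) (C : R) :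
  (forall i k, (k < L)%N -> forall a c, `|W i k a c| <= C) ->
  (forall i k, (k < L)%N -> forall a, `|b i k a ord0| <= C) -> 0 <= C ->
  exists (kap : nat -> nat) (W' : weights R N) (b' : biases R N),
  [/\ forall j, (kap j < kap j.+1)%N,
      forall k, (k < L)%N -> mx_cvg (fun j => W (kap j) k) (W' k) &
      forall k, (k < L)%N -> mx_cvg (fun j => b (kap j) k) (b' k)].
Proof.
move=> WC bC C0.
have bd i x : `|coord (W i) (b i) x| <= C.
  case: x => [[[k a] c]|[k a]] /=; case: ifPn => kL; rewrite ?normr0 //.
    case: (insub a) => [a'|]; last by rewrite normr0.
    by case: (insub c) => [c'|]; [exact: WC|rewrite normr0].
  by case: (insub a) => [a'|]; [exact: bC|rewrite normr0].
have [kap [l [kincr hl]]] := common_subsequence bd.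
exists kap, (fun k => \matrix_(a, c) l (inl (k, a : nat, c : nat))),
  (fun k => \col_a l (inr (k, a : nat))); split => // k kL a c.
  have := hl (inl (k, a : nat, c : nat)); rewrite /= kL !valK mxE; exact.
have := hl (inr (k, a : nat)); rewrite /= kL valK mxE (ord1 c); exact.
Qed.

End ParameterCompactness.

Section Bounds.
Variable R : realType.

Lemma cvg_le_cst (x : nat -> R) (l e : R) :
  x @ \oo --> l -> (forall k, x k <= e) -> l <= e.
Proof.
move=> xl xe; rewrite leNgt; apply/negP => el.
have [k _ hk] := cvgr_gt _ xl _ el.
by have := lt_le_trans (hk k (leqnn k)) (xe k); rewrite ltxx.
Qed.

Lemma le_mx_inf_norm p q (A : 'M[R]_(p, q)) e : 0 <= e ->
  mx_inf_norm A <= e <-> forall i, \sum_j `|A i j| <= e.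
Proof.
move=> e0; split=> [h i|h]; last by apply: bigmax_le.
by apply: le_trans h; exact: le_bigmax.
Qed.

Lemma le_vec_max_norm k (v : 'cV[R]_k) e : 0 <= e ->
  vec_max_norm v <= e <-> forall i, `|v i ord0| <= e.
Proof.
move=> e0; split=> [h i|h]; last by apply: bigmax_le.
by apply: le_trans h; exact: (le_bigmax _ (fun i => `|v i ord0|)).
Qed.

Lemma frob2_ge0 p q (A : 'M[R]_(p, q)) : 0 <= frob2 A.
Proof. by apply: sumr_ge0 => i _; apply: sumr_ge0 => j _; exact: sqr_ge0. Qed.

Lemma sqr_entry_le_frob2 p q (A : 'M[R]_(p, q)) i j : A i j ^+ 2 <= frob2 A.
Proof.
rewrite /frob2 (bigD1 i) //= (bigD1 j) //= -addrA lerDl addr_ge0 //.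
  by apply: sumr_ge0 => j' _; exact: sqr_ge0.
by apply: sumr_ge0 => i' _; apply: sumr_ge0 => j' _; exact: sqr_ge0.
Qed.

Lemma R_ad_cvg (N : nat -> nat) (L : nat) (eta1 eta2 : R)
    (W : nat -> weights R N) (b : nat -> biases R N) W' b' :
  0 <= eta1 -> 0 <= eta2 -> (0 < L)%N ->
  (forall i, R_ad L eta1 eta2 (W i) (b i)) ->
  (forall k, (k < L)%N -> mx_cvg (fun j => W j k) (W' k)) ->
  (forall k, (k < L)%N -> mx_cvg (fun j => b j k) (b' k)) ->
  R_ad L eta1 eta2 W' b'.
Proof.
move=> e1 e2 L0 ad cW cb; split.
  apply/le_mx_inf_norm => // i.
  have c : (fun j => \sum_c `|W j 0%N i c|) @ \oo --> \sum_c `|W' 0%N i c|.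
    by apply: cvg_sum_ord => c; apply: cvg_norm; exact: cW.
  apply: (cvg_le_cst c) => j.
  exact: ((le_mx_inf_norm _ e1).1 (ad j).1 i).
move=> k kL; apply/le_vec_max_norm => // i.
have c : (fun j => `|b j k i ord0|) @ \oo --> `|b' k i ord0|.
  by apply: cvg_norm; exact: cb.
apply: (cvg_le_cst c) => j.
exact: ((le_vec_max_norm _ e2).1 ((ad j).2 k kL) i).
Qed.

End Bounds.

Theorem mainTheorem14
  (R : realType) (N : nat -> nat) (L : nat)
  (f : 'cV[R]_(N 0%N) -> 'cV[R]_(N 0%N)) (B : 'M[R]_(N 0%N, N L))
  (Q : 'M[R]_(N 0%N)) (beta : R)
  (Y0 : set 'cV[R]_(N 0%N)) (Ci : R)
  (Nb : set 'cV[R]_(N 0%N)) (Fs : 'cV[R]_(N 0%N) -> 'cV[R]_(N L))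
  (ystar : 'cV[R]_(N 0%N) -> R -> 'cV[R]_(N 0%N)) (M : R)
  (d : measure_display) (T : measurableType d) (P : probability T R)
  (pt : T -> 'cV[R]_(N 0%N))
  (sigma : R -> R) (eta1 eta2 alpha : R) :
  standing_assumption f B Q beta Y0 Ci Nb Fs ystar M ->
  (* (Y0, A, mu) is a complete probability space, identified with T via pt *)
  injective pt -> range pt = Y0 -> complete_prob P ->
  (* sigma in C^1(R) *)
  (forall x, derivable sigma x 1) -> continuous (derive1 sigma) ->
  (2 <= L)%N -> 0 < eta1 -> 0 < eta2 -> 0 < alpha ->
  (* at least one admissible pair *)
  (exists (Wt : weights R N) (bt : biases R N) (y : T -> R -> 'cV[R]_(N 0%N)),
      R_ad L eta1 eta2 Wt bt /\
      ensemble_sol f B P pt (MY0 M Y0) (Fnet sigma L Wt bt) y) ->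
  (* existence of a global minimizer *)
  exists (Wt : weights R N) (bt : biases R N) (y : T -> R -> 'cV[R]_(N 0%N)),
    R_ad L eta1 eta2 Wt bt /\
    ensemble_sol f B P pt (MY0 M Y0) (Fnet sigma L Wt bt) y /\
    forall (Wt' : weights R N) (bt' : biases R N) (y' : T -> R -> 'cV[R]_(N 0%N)),
      ensemble_sol f B P pt (MY0 M Y0) (Fnet sigma L Wt' bt') y' ->
      (jcost Q beta P (Fnet sigma L Wt bt) y + Greg L eta1 eta2 alpha Wt bt
        <= jcost Q beta P (Fnet sigma L Wt' bt') y'
           + Greg L eta1 eta2 alpha Wt' bt')%E.
Proof.
move=> sa _ _ _ dsigma _ L2 eta10 eta20 alpha0 [W0 [b0 [y0 [ad0 sol0]]]].
have [_ [_ [beta0 [Ci0 [embed [_ [_ [[Df [C1f _]] [f0 _]]]]]]]]] := sa.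
set MY := MY0 M Y0 in sol0 *.
have cf : seq_cont f := C1_on_seq_cont C1f.
have csigma : continuous sigma.
  by move=> x; apply: differentiable_continuous; apply/derivable1_diffP.
have L0 : (0 < L)%N by exact: ltnW.
pose reg (W : weights R N) : R := alpha * \sum_(1 <= k < L) frob2 (W k).
have reg_ge0 W : 0 <= reg W.
  by rewrite mulr_ge0 ?(ltW alpha0) // sumr_ge0 // => k _; exact: frob2_ge0.
have GregE W b : R_ad L eta1 eta2 W b -> Greg L eta1 eta2 alpha W b = (reg W)%:E.
  by move=> ad; rewrite /Greg; case: pselect.
have jcost_ge0 (F : 'cV[R]_(N 0%N) -> 'cV[R]_(N L)) y : (0 <= jcost Q beta P F y)%E.
  apply: integral_ge0 => p _; rewrite mule_ge0 ?lee_fin ?divr_ge0 //.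
  apply: integral_ge0 => t _.
  by rewrite lee_fin addr_ge0 ?mulr_ge0 ?enorm2_ge0 // ltW.
pose val W b y := (jcost Q beta P (Fnet sigma L W b) y + Greg L eta1 eta2 alpha W b)%E.
pose S := [set v | exists W b y,
  ensemble_sol f B P pt MY (Fnet sigma L W b) y /\ v = val W b y].
have val_ge0 W b y : (0 <= val W b y)%E.
  rewrite adde_ge0 // /Greg; case: pselect => // _.
  by rewrite lee_fin; exact: reg_ge0.
have inf_le W b y : ensemble_sol f B P pt MY (Fnet sigma L W b) y ->
    (ereal_inf S <= val W b y)%E.
  by move=> sol; apply: ereal_inf_lbound; exists W, b, y.
have inf_ge0 : (0 <= ereal_inf S)%E.
  by apply: le_ereal_inf_tmp => _ [W [b [y [_ ->]]]].
(* If no pair has a finite value, the given admissible pair is already a minimizer. *)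
have [inf_y|inf_fin] := eqVneq (ereal_inf S) +oo%E.
  exists W0, b0, y0; split => //; split => // W b y sol.
  have le_y := inf_le W b y sol; rewrite inf_y in le_y.
  exact: le_trans (leey _) le_y.
have {}inf_fin : ereal_inf S \is a fin_num.
  by rewrite ge0_fin_numE // ltey.
pose r := fine (ereal_inf S).
have rE : ereal_inf S = r%:E by rewrite fineK.
(* A finite infimum forces admissibility, since [Greg] is [+oo] otherwise; the regularizer, now
   real, is moved to the right. *)
have min_seq (k : nat) : {z : weights R N * biases R N * (T -> R -> 'cV[R]_(N 0%N)) |
    [/\ ensemble_sol f B P pt MY (Fnet sigma L z.1.1 z.1.2) z.2,
        R_ad L eta1 eta2 z.1.1 z.1.2 &
        (jcost Q beta P (Fnet sigma L z.1.1 z.1.2) z.2 <=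
          (r + k.+1%:R^-1 - reg z.1.1)%:E)%E]}.
  apply: cid.
  have k0 : 0 < k.+1%:R^-1 :> R by [].
  have [_ [W [b [y [sol ->]]]] lt] := lb_ereal_inf_adherent k0 inf_fin.
  exists (W, b, y) => /=.
  have ad : R_ad L eta1 eta2 W b.
    apply: contrapT => nad; move: lt; rewrite /val /Greg; case: pselect => // _.
    by rewrite addey ?rE -?EFinD ?ltNge ?leey // gt_eqF // (lt_le_trans _ (jcost_ge0 _ _)).
  split => //; move: lt; rewrite /val (GregE _ _ ad) rE -EFinD => lt.
  by rewrite EFinB leeBrDr // ltW.
pose Wk k := (sval (min_seq k)).1.1; pose bk k := (sval (min_seq k)).1.2.
pose yk k := (sval (min_seq k)).2.
have min_seqP k : [/\ ensemble_sol f B P pt MY (Fnet sigma L (Wk k) (bk k)) (yk k),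
        R_ad L eta1 eta2 (Wk k) (bk k) &
        (jcost Q beta P (Fnet sigma L (Wk k) (bk k)) (yk k) <=
          (r + k.+1%:R^-1 - reg (Wk k))%:E)%E].
  exact: (svalP (min_seq k)).
have reg_le k : reg (Wk k) <= r + 1.
  have [_ _ h] := min_seqP k; have := le_trans (jcost_ge0 _ _) h.
  rewrite lee_fin subr_ge0 => /le_trans; apply; rewrite lerD2l.
  by rewrite invf_le1 // ler1n.
have r1 : 0 <= r + 1 by exact: le_trans (reg_ge0 _) (reg_le 0).
have MY_ge0 : 0 <= 2 * MY.
  have [[_ bd] _] := sol0; have [N1 [_ PN1 h1]] := ae_null_cover bd.
  have [p /h1[_]] := null_set_nonempty PN1; apply: le_trans; exact: sqrtr_ge0.
(* One constant for everything: [eta1] covers the first weights, [eta2] the biases, the square root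
   the other weights through the regularizer, and [Ci * (2 * MY)] the states fed to the network. *)
pose C := eta1 + eta2 + Num.sqrt ((r + 1) / alpha) + Ci * (2 * MY).
have sC : 0 <= Num.sqrt ((r + 1) / alpha) by exact: sqrtr_ge0.
have CM : 0 <= Ci * (2 * MY) by rewrite mulr_ge0 // ltW.
have C0 : 0 <= C by rewrite /C; lra.
have WC i k : (k < L)%N -> forall a c, `|Wk i k a c| <= C.
  move=> kL a c; have [_ [ad1 _] _] := min_seqP i.
  case: k kL a c => [|k] kL a c.
    apply: (@le_trans _ _ eta1); last by rewrite /C; lra.
    apply: le_trans ((le_mx_inf_norm _ (ltW eta10)).1 ad1 a).
    by rewrite (bigD1 c) //= lerDl; exact: sumr_ge0.
  apply: (@le_trans _ _ (Num.sqrt ((r + 1) / alpha))); last by rewrite /C; lra.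
  rewrite -sqrtr_sqr; apply: ler_wsqrtr; apply: le_trans (sqr_entry_le_frob2 _ a c) _.
  rewrite ler_pdivlMr // mulrC; apply: le_trans (reg_le i); rewrite ler_pM2l //.
  rewrite (bigD1_seq k.+1) /= ?mem_index_iota ?iota_uniq // lerDl.
  by apply: sumr_ge0 => j _; exact: frob2_ge0.
have bC i k : (k < L)%N -> forall a, `|bk i k a ord0| <= C.
  move=> kL a; have [_ [_ ad2] _] := min_seqP i.
  apply: (@le_trans _ _ eta2); last by rewrite /C; lra.
  exact: ((le_vec_max_norm _ (ltW eta20)).1 (ad2 k kL) a).
have [kap [W [b [kincr cW cb]]]] := parameter_subsequence WC bC C0.
pose F_ i := Fnet sigma L (Wk (kap i)) (bk (kap i)).
have [K1 hK1] := seq_cont_bounded (Ci * (2 * MY)) cf.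
have [K2 hK2] := @Fnet_bounded R sigma N L csigma C C0.
(* Summing over all entries of [B] makes the bound independent of the row. *)
pose K := `|K1| + \sum_i \sum_a `|B i a| * `|K2|.
have K0 : 0 <= K.
  by rewrite addr_ge0 // sumr_ge0 // => i _; rewrite sumr_ge0 // => a _; rewrite mulr_ge0.
have driftK k (x : 'cV[R]_(N 0%N)) : (forall i, `|x i ord0| <= Ci * (2 * MY)) ->
    forall i, `|drift f B (F_ k) x i ord0| <= K.
  move=> hx i; rewrite !mxE; apply: le_trans (ler_normD _ _) _; apply: lerD.
    by apply: le_trans (hK1 x hx i) _; exact: ler_norm.
  apply: le_trans (ler_norm_sum _ _ _) _.
  apply: (@le_trans _ _ (\sum_a `|B i a| * `|K2|)).
    apply: ler_sum => a _; rewrite normrM ler_wpM2l //.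
    apply: le_trans (ler_norm K2); apply: hK2.
    - by move=> j jL; exact: WC.
    - by move=> j jL; exact: bC.
    - by move=> c; apply: le_trans (hx c) _; rewrite /C; lra.
  rewrite [leRHS](bigD1 i) //= lerDl; apply: sumr_ge0 => j _.
  by apply: sumr_ge0 => a _; rewrite mulr_ge0.
have F_cvg (ka : nat -> nat) x l : (forall j, (ka j < ka j.+1)%N) -> mx_cvg x l ->
    mx_cvg (fun j => F_ (ka j) (x j)) (Fnet sigma L W b l).
  move=> kaincr xl; apply: (@Fnet_cvg R sigma N L csigma
    (fun j => Wk (kap (ka j))) (fun j => bk (kap (ka j)))) => // k kL.
    exact: (mx_cvg_subseq kaincr (cW k kL)).
  exact: (mx_cvg_subseq kaincr (cb k kL)).
have [y [sol cost]] := @limit_ensemble R (N 0%N) (N L) d T f B Q beta P pt Ci MY Ci0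
  embed cf f0 beta0 F_ (Fnet sigma L W b)
  (fun k => @Fnet_seq_cont R sigma N L csigma (Wk (kap k)) (bk (kap k)))
  (@Fnet_seq_cont R sigma N L csigma W b)
  (fun k => Fnet0 sigma L (Wk (kap k)) (bk (kap k))) F_cvg K K0 driftK
  (fun k => yk (kap k))
  (fun k => let: And3 s _ _ := min_seqP (kap k) in s).
have ad : R_ad L eta1 eta2 W b.
  apply: (R_ad_cvg (ltW eta10) (ltW eta20) L0 _ cW cb) => i.
  by have [] := min_seqP (kap i).
exists W, b, y; split => //; split => // W' b' y' sol'.
apply: le_trans (inf_le W' b' y' sol'); rewrite (GregE _ _ ad) rE.
(* The regularizer is a polynomial in the entries, so it converges, and the upper bounds on the cost
   tend to exactly [r - reg W]. *)
have regc : (fun i => reg (Wk (kap i))) @ \oo --> reg W.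
  apply: cvgMr.
  have sum_cvg (s : seq nat) : (forall k, k \in s -> (k < L)%N) ->
      (fun i => \sum_(k <- s) frob2 (Wk (kap i) k)) @ \oo --> \sum_(k <- s) frob2 (W k).
    elim: s => [|k s IH] sL.
      by rewrite big_nil; under eq_fun do rewrite big_nil; exact: cvg_cst.
    rewrite big_cons; under eq_fun do rewrite big_cons.
    apply: cvgD; last by apply: IH => j js; apply: sL; rewrite inE js orbT.
    by apply: cvg_frob2; apply: cW; apply: sL; rewrite mem_head.
  by apply: sum_cvg => k; rewrite mem_index_iota => /andP[].
have hv i : (jcost Q beta P (F_ i) (yk (kap i)) <=
    (r + (kap i).+1%:R^-1 - reg (Wk (kap i)))%:E)%E by have [] := min_seqP (kap i).
have lim_v : (fun i => (r + (kap i).+1%:R^-1 - reg (Wk (kap i)))%:E) @ \oo -->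
    (r - reg W)%:E.
  apply: cvg_EFin; first exact: nearW.
  apply: cvgB => //; rewrite -[X in _ --> X]addr0; apply: cvgD; first exact: cvg_cst.
  exact: (cvg_subseq kincr (@cvg_harmonic R)).
by have := cost _ _ hv lim_v; rewrite EFinB leeBrDr.
Qed.
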